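(* Fix $n\in\mathbb{N}_0$ and let $U\in\left(0,\frac{T}{\ln^2T}\right]$. Consider the set $\bigcup_{k=0}^{n+1}[\varphi_1^k(T),\varphi_1^k(T+U)]$. Then, for every fixed $\epsilon>0$ and all sufficiently large $T$: (i) $t\sim\varphi_1^k(t)$ as $t\to\infty$ and $\varphi_1^k(T)\ge(1-\epsilon)T$, for $k=0,1,\dots,n+1$; (ii) $\varphi_1^k(T+U)-\varphi_1^k(T)<\frac{1}{2n+5}\frac{T}{\ln T}$ for $k=1,\dots,n+1$; (iii) $\varphi_1^k(T)-\varphi_1^{k+1}(T+U)>0.18\cdot\frac{T}{\ln T}$ for $k=0,1,\dots,n$. In particular the set is disconnected, with components $[\varphi_1^k(T),\varphi_1^k(T+U)]$ ordered from right to left as $k$ increases.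
   Context: Let $\zeta$ be the Riemann zeta-function and $Z(t)=e^{i\vartheta(t)}\zeta(\tfrac12+it)$ with $\vartheta(t)=-\tfrac t2\ln\pi+\operatorname{Im}\ln\Gamma(\tfrac14+\tfrac{it}{2})$, so that $Z(t)$ is real and $Z^2(t)=|\zeta(\tfrac12+it)|^2$. Let $\mu(y)$ be any function with $\mu(y)\ge 7y\ln y$; a Jacob's ladder is $\varphi_1(T)=\tfrac12\varphi(T)$, where $\varphi(T)=\varphi_\mu(T)$ is a solution $x=x(T)$ of the nonlinear integral equation $\int_0^{\mu[x(T)]}Z^2(t)e^{-2t/x(T)}\,dt=\int_0^T Z^2(t)\,dt$. The function $\varphi_1$ is increasing for $t\ge T_0[\varphi_1]$. Its iterates are $\varphi_1^0(t)=t$, $\varphi_1^k(t)=\varphi_1(\varphi_1^{k-1}(t))$ for $k\ge1$. $U=U(T)$ denotes an arbitrary function of $T$ in the indicated range, and $A\sim B$ means $A/B\to1$ as $T\to\infty$. *)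

(* Defs.v *)
From Stdlib Require Export Reals Lra ClassicalEpsilon.
Open Scope R_scope.

(* Limit of a real sequence (chosen by epsilon; meaningful when it converges). *)
Definition seq_lim (u : nat -> R) : R :=
  epsilon (inhabits 0) (fun l => Un_cv u l).

(* Dirichlet eta function on the critical line s = 1/2 + i t:
   eta(s) = sum_{m>=1} (-1)^(m-1) m^(-s), convergent for Re s > 0.
   m^(-1/2 - i t) = m^(-1/2) (cos(t ln m) - i sin(t ln m)). *)
Definition eta_re (t : R) : R :=
  seq_lim (fun N => sum_f_R0 (fun m =>
     (-1) ^ m / sqrt (INR (S m)) * cos (t * ln (INR (S m)))) N).
Definition eta_im (t : R) : R :=
  seq_lim (fun N => sum_f_R0 (fun m =>
     - ((-1) ^ m / sqrt (INR (S m)) * sin (t * ln (INR (S m))))) N).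

(* Z^2(t) = |zeta(1/2 + i t)|^2, using zeta(s) = eta(s) / (1 - 2^(1-s));
   |1 - 2^(1/2 - i t)|^2 = 3 - 2 sqrt 2 cos (t ln 2) (never 0). *)
Definition Z2 (t : R) : R :=
  (eta_re t ^ 2 + eta_im t ^ 2) / (3 - 2 * sqrt 2 * cos (t * ln 2)).

(* Riemann integral int_a^b f (value independent of the integrability proof). *)
Definition Rint (f : R -> R) (a b : R) : R :=
  epsilon (inhabits 0)
    (fun v => exists pr : Riemann_integrable f a b, RiemannInt pr = v).

Definition solves_ladder_eq (mu phi : R -> R) : Prop :=
  exists T0, forall T, T0 <= T ->
    0 < phi T /\
    Rint (fun t => Z2 t * exp (- (2 * t) / phi T)) 0 (mu (phi T)) = Rint Z2 0 T.

Definition iterR (k : nat) (f : R -> R) (t : R) : R := Nat.iter k f t.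

(* Main.v *)
Require Import Defs.
From Stdlib Require Import Reals ZArith Lra Lia.
From Coquelicot Require Import Coquelicot.
Open Scope R_scope.

(** Writing [{x}] for the fractional part, [- zeta(s) / s] is the Mellin transform of [{x}], so the measure
    [|zeta(1/2+it)|^2 / (1/4+t^2) dt] has the autocorrelation of [{x}] under dilations as its Fourier transform.
    Near the identity this autocorrelation is governed by the mean square of [{(1+al) x} - {x}], that is by the
    variance of the number of integers in the intervals [(x, (1+al) x]]; it equals [al (c - ln al) + O(al^2)].
    Testing the measure against a smoothed indicator function of [[0, A]] turns this expansion into
    [int_0^T Z^2 = T ln T + a T + o(T)].

    Integrating by parts, [int_0^m Z^2(t) exp(-t/y) dt = y (ln y + a + c0) + o(y)] with the same [a] and
    [c0 = int_0^oo s ln s exp(-s) ds = 1 - gamma].  Comparing the two expansions in the integral equation gives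
    [T - phi_1(T) ~ c0 T / ln T], and [c0 >= 1/4 > 0.18].  Iterating, [phi_1^k(T+U) = T - k c0 T/ln T + o(T/ln T)]
    uniformly for [0 <= U <= T / ln^2 T], which contains all the assertions. *)

(* [RInt] lands in the carrier of a Coquelicot module, which [ring] does not recognize as [R]. *)
Ltac rint_atoms := repeat match goal with |- context [@RInt ?V ?f ?a ?b] =>
  let X := fresh in pose (X := (@RInt V f a b) : R);
  change (@RInt V f a b) with X; clearbody X end.
Ltac rring := rint_atoms; match goal with |- @eq _ ?a ?b => change (@eq R a b) end; ring.
Ltac rfield := rint_atoms; match goal with |- @eq _ ?a ?b => change (@eq R a b) end; field.

(** The test functions are second differences in [A], with step [D], of the truncated parabola
    [(A - t)_+^2 / 2]. Divided by [D^2] they are smoothed indicators of [[0, A]], and their cosine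
    transform [2 sin (A tau) (1 - cos (D tau)) / tau^3] decays so fast that beyond [tau = 1]
    boundedness of the autocorrelation is enough; only its expansion at the identity has to be
    known. As [Z2] is the density of the measure times [1/4 + t^2], an error [o(T)] for the mean
    square requires [o(1/A)] for the mass on [[0, A]]. With the error terms obtained, [D] must lie
    between [A^(2/3)] and [A / ln A]; the choice is [A^(3/4)]. The coefficient 1 of [T ln T] goes
    back to the coefficient of [- al ln al]. Improper integrals are cut off to [[1/N, N]] with
    explicit errors, and [N] tends to infinity only once [A] and [D] are fixed. The fractional part
    jumps, so integrals are exchanged by an estimate in the mean instead of continuity in two
    variables. A solution [phi] could a priori stay bounded, so its divergence is derived before the
    growth of [mu] and the expansions are applied to it. *)

Lemma is_lim_seq_eps (u : nat -> R) (l : R) : is_lim_seq u l <->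
  (forall eps, 0 < eps -> exists N, forall n, (N <= n)%nat -> Rabs (u n - l) < eps).
Proof.
split; intros H.
- apply is_lim_seq_spec in H; intros eps He; exact (H (mkposreal eps He)).
- apply is_lim_seq_spec; intros [eps He]; exact (H eps He).
Qed.

(** * Calculus of real-valued integrals *)

Lemma RInt_plusR f g a b : ex_RInt f a b -> ex_RInt g a b ->
  RInt (fun x => f x + g x) a b = RInt f a b + RInt g a b.
Proof. exact (RInt_plus f g a b). Qed.

Lemma RInt_minusR f g a b : ex_RInt f a b -> ex_RInt g a b ->
  RInt (fun x => f x - g x) a b = RInt f a b - RInt g a b.
Proof. exact (RInt_minus f g a b). Qed.

Lemma RInt_scalR k f a b : ex_RInt f a b ->
  RInt (fun x => k * f x) a b = k * RInt f a b.
Proof. exact (RInt_scal f a b k). Qed.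

Lemma RInt_constR c a b : RInt (fun _ => c) a b = (b - a) * c.
Proof. exact (RInt_const a b c). Qed.

Lemma RInt_ChaslesR f a b c : ex_RInt f a b -> ex_RInt f b c ->
  RInt f a b + RInt f b c = RInt f a c.
Proof. exact (RInt_Chasles f a b c). Qed.

Lemma ex_RInt_plusR f g a b : ex_RInt f a b -> ex_RInt g a b ->
  ex_RInt (fun x => f x + g x) a b.
Proof. exact (ex_RInt_plus f g a b). Qed.

Lemma ex_RInt_minusR f g a b : ex_RInt f a b -> ex_RInt g a b ->
  ex_RInt (fun x => f x - g x) a b.
Proof. exact (ex_RInt_minus f g a b). Qed.

Lemma ex_RInt_scalR k f a b : ex_RInt f a b -> ex_RInt (fun x => k * f x) a b.
Proof. exact (ex_RInt_scal f a b k). Qed.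

Lemma RInt_lin2 k l f g a b : ex_RInt f a b -> ex_RInt g a b ->
  RInt (fun x => k * f x + l * g x) a b = k * RInt f a b + l * RInt g a b.
Proof.
intros Hf Hg; rewrite RInt_plusR, !RInt_scalR; auto; now apply ex_RInt_scalR.
Qed.

Lemma ex_RInt_sub (f : R -> R) a b c d : a <= c -> c <= d -> d <= b ->
  ex_RInt f a b -> ex_RInt f c d.
Proof.
intros H1 H2 H3 H.
apply (ex_RInt_Chasles_2 f a c d); [lra|].
now apply (ex_RInt_Chasles_1 f a d b); [lra|].
Qed.

Lemma ex_RInt_cont (f : R -> R) a b : a <= b ->
  (forall x, a <= x <= b -> continuous f x) -> ex_RInt f a b.
Proof.
intros Hab H; apply (ex_RInt_continuous f); intros z.
now rewrite Rmin_left, Rmax_right by easy; apply H.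
Qed.

Lemma ex_RInt_everywhere (f : R -> R) a b : (forall x, continuous f x) -> ex_RInt f a b.
Proof. intros H; apply (ex_RInt_continuous f); auto. Qed.

Lemma RInt_extR (f g : R -> R) a b : a <= b ->
  (forall x, a < x < b -> f x = g x) -> RInt f a b = RInt g a b.
Proof.
intros Hab H; apply RInt_ext; intros x.
now rewrite Rmin_left, Rmax_right by easy; apply H.
Qed.

Lemma ex_RInt_extR (f g : R -> R) a b : a <= b ->
  (forall x, a < x < b -> f x = g x) -> ex_RInt f a b -> ex_RInt g a b.
Proof.
intros Hab H; apply ex_RInt_ext; intros x.
now rewrite Rmin_left, Rmax_right by easy; apply H.
Qed.

Lemma RInt_FTC (F f : R -> R) a b : a <= b ->
  (forall x, a <= x <= b -> is_derive F x (f x)) ->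
  (forall x, a <= x <= b -> continuous f x) -> RInt f a b = F b - F a.
Proof.
intros Hab H1 H2; apply is_RInt_unique.
apply (is_RInt_derive F f); intros x; rewrite Rmin_left, Rmax_right by easy; auto.
Qed.

Lemma RInt_abs_le (f g : R -> R) a b : a <= b -> ex_RInt f a b -> ex_RInt g a b ->
  (forall x, a < x < b -> Rabs (f x) <= g x) -> Rabs (RInt f a b) <= RInt g a b.
Proof.
intros Hab Hf Hg H; apply Rabs_le; split.
- replace (- RInt g a b) with (-1 * RInt g a b) by ring.
  rewrite <- RInt_scalR by easy.
  apply RInt_le; auto; [now apply ex_RInt_scalR|].
  intros x Hx; specialize (H x Hx); apply Rabs_le_between in H; lra.
- apply RInt_le; auto.
  intros x Hx; specialize (H x Hx); apply Rabs_le_between in H; lra.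
Qed.

Lemma RInt_abs_le_derive (f G g : R -> R) a b : a <= b -> ex_RInt f a b ->
  (forall x, a <= x <= b -> is_derive G x (g x)) ->
  (forall x, a <= x <= b -> continuous g x) ->
  (forall x, a < x < b -> Rabs (f x) <= g x) -> Rabs (RInt f a b) <= G b - G a.
Proof.
intros Hab Hf HG Hg H; rewrite <- (RInt_FTC G g) by auto.
apply RInt_abs_le; auto; now apply ex_RInt_cont.
Qed.

Lemma RInt_const_bound (f : R -> R) a b M : a <= b -> ex_RInt f a b ->
  (forall x, a < x < b -> Rabs (f x) <= M) -> Rabs (RInt f a b) <= (b - a) * M.
Proof.
intros Hab Hf H; rewrite <- RInt_constR.
apply RInt_abs_le; auto; apply ex_RInt_const.
Qed.

Lemma RInt_le_ge0 (f : R -> R) a b c d : a <= c -> c <= d -> d <= b -> ex_RInt f a b ->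
  (forall x, a < x < b -> 0 <= f x) -> RInt f c d <= RInt f a b.
Proof.
intros H1 H2 H3 Hf H.
rewrite <- (RInt_ChaslesR f a c b), <- (RInt_ChaslesR f c d b);
 try (eapply ex_RInt_sub; [| | |exact Hf]; lra).
assert (0 <= RInt f a c).
{ apply RInt_ge_0; [lra| |intros; apply H; lra]. eapply ex_RInt_sub; [| | |exact Hf]; lra. }
assert (0 <= RInt f d b).
{ apply RInt_ge_0; [lra| |intros; apply H; lra]. eapply ex_RInt_sub; [| | |exact Hf]; lra. }
lra.
Qed.

(** * Piecewise continuous functions on the positive half-line *)

(** Discontinuities are isolated, and the pieces on either side extend continuously across them. The
    value at [p] itself is left free, since it does not affect an integral. Only [p > 0] is tested,
    because the integrands are singular at 0. *)
Definition PC (f : R -> R) := forall p, 0 < p -> exists d, 0 < d /\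
  exists f1 f2 : R -> R,
  (forall x, Rabs (x - p) < d -> continuous f1 x /\ continuous f2 x) /\
  (forall x, p - d < x < p -> f x = f1 x) /\ (forall x, p < x < p + d -> f x = f2 x).

(** Compactness of [[a, b]] through a supremum: if [s] is the supremum of the points up to which [f]
    is integrable, the left piece at [s] gives integrability up to [s] and the right piece carries
    it beyond, unless [s = b]. *)
Lemma PC_ex_RInt f a b : PC f -> 0 < a -> a <= b -> ex_RInt f a b.
Proof.
intros Hf Ha Hab.
set (E := fun x => a <= x <= b /\ ex_RInt f a x).
assert (HE : E a) by (split; [lra|apply ex_RInt_point]).
destruct (completeness E) as [s [Hs1 Hs2]].
{ exists b; intros x [H _]; lra. }
{ now exists a. }
assert (Has : a <= s) by now apply Hs1.
assert (Hsb : s <= b) by (apply Hs2; intros x [H _]; lra).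
destruct (Hf s) as (d & Hd & f1 & f2 & Hc & Hl & Hr); [lra|].
assert (Hx0 : exists x0, E x0 /\ s - d < x0).
{ destruct (classic (exists x0, E x0 /\ s - d < x0)) as [H|H]; [easy|].
  assert (s <= s - d); [|lra].
  apply Hs2; intros x Hx; apply Rnot_lt_le; intros Hlt; apply H; now exists x. }
destruct Hx0 as (x0 & Hx0 & Hx0s).
assert (x0 <= s) by now apply Hs1.
assert (Es : ex_RInt f a s).
{ apply (ex_RInt_Chasles f a x0 s); [apply Hx0|].
  apply (ex_RInt_extR f1); [lra|intros; symmetry; apply Hl; lra|].
  apply ex_RInt_cont; [lra|]; intros x Hx; apply Hc; apply Rabs_def1; lra. }
set (e := Rmin b (s + d / 2)).
assert (He1 : s <= e) by (apply Rmin_glb; lra).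
assert (He2 : e <= s + d / 2) by apply Rmin_r.
assert (He3 : e <= b) by apply Rmin_l.
assert (Ee : ex_RInt f a e).
{ apply (ex_RInt_Chasles f a s e); [easy|].
  apply (ex_RInt_extR f2); [lra|intros; symmetry; apply Hr; lra|].
  apply ex_RInt_cont; [lra|]; intros x Hx; apply Hc; apply Rabs_def1; lra. }
assert (He4 : e <= s) by (apply Hs1; split; [lra|easy]).
assert (s = b); [|congruence].
unfold e, Rmin in *; destruct (Rle_dec b (s + d / 2)); lra.
Qed.

Lemma PC_cont f : (forall x, 0 < x -> continuous f x) -> PC f.
Proof.
intros H p Hp; exists p; split; [easy|]; exists f, f; repeat split; auto;
 apply H; apply Rabs_def2 in H0; lra.
Qed.

Lemma PC_comp2 (h : R -> R -> R) f g :
  (forall (f g : R -> R) (x : R), continuous f x -> continuous g x -> continuous (fun x => h (f x) (g x)) x) ->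
  PC f -> PC g -> PC (fun x => h (f x) (g x)).
Proof.
intros Hh Hf Hg p Hp.
destruct (Hf p Hp) as (d & Hd & f1 & f2 & Hc & Hl & Hr).
destruct (Hg p Hp) as (d' & Hd' & g1 & g2 & Hc' & Hl' & Hr').
exists (Rmin d d'); split; [now apply Rmin_pos|].
pose proof (Rmin_l d d'); pose proof (Rmin_r d d').
exists (fun x => h (f1 x) (g1 x)), (fun x => h (f2 x) (g2 x)); repeat split.
- apply Hh; [apply Hc|apply Hc']; lra.
- apply Hh; [apply Hc|apply Hc']; lra.
- intros x Hx; rewrite Hl, Hl' by lra; reflexivity.
- intros x Hx; rewrite Hr, Hr' by lra; reflexivity.
Qed.

Lemma PC_plus f g : PC f -> PC g -> PC (fun x => f x + g x).
Proof. apply (PC_comp2 Rplus); intros; now apply (continuous_plus f0 g0). Qed.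

Lemma PC_minus f g : PC f -> PC g -> PC (fun x => f x - g x).
Proof. apply (PC_comp2 Rminus); intros; now apply (continuous_minus f0 g0). Qed.

Lemma PC_mult f g : PC f -> PC g -> PC (fun x => f x * g x).
Proof. apply (PC_comp2 Rmult); intros; now apply (continuous_mult f0 g0). Qed.

Lemma PC_const c : PC (fun _ => c).
Proof. apply PC_cont; intros; apply continuous_const. Qed.

Lemma PC_abs f : PC f -> PC (fun x => Rabs (f x)).
Proof.
intros H; apply (PC_comp2 (fun x _ => Rabs x) f f); auto; intros.
now apply (continuous_comp f0 Rabs); [|apply continuous_Rabs].
Qed.

Lemma PC_pow f n : PC f -> PC (fun x => f x ^ n).
Proof.
intros H; induction n; simpl; [apply PC_const|now apply PC_mult].
Qed.

Lemma PC_ext f g : (forall x, 0 < x -> f x = g x) -> PC f -> PC g.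
Proof.
intros He Hf p Hp; destruct (Hf p Hp) as (d & Hd & f1 & f2 & Hc & Hl & Hr).
exists (Rmin d p); split; [now apply Rmin_pos|].
pose proof (Rmin_l d p); pose proof (Rmin_r d p).
exists f1, f2; repeat split.
- apply Hc; lra.
- apply Hc; lra.
- intros x Hx; rewrite <- He, Hl by lra; reflexivity.
- intros x Hx; rewrite <- He, Hr by lra; reflexivity.
Qed.

Lemma PC_scale f l : 0 < l -> PC f -> PC (fun x => f (l * x)).
Proof.
intros Hl0 Hf p Hp.
destruct (Hf (l * p)) as (d & Hd & f1 & f2 & Hc & Hl & Hr); [now apply Rmult_lt_0_compat|].
assert (E : d = l * (d / l)) by (field; lra).
exists (d / l); split; [now apply Rdiv_lt_0_compat|].
exists (fun x => f1 (l * x)), (fun x => f2 (l * x)); split; [|split].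
- intros x Hx.
  assert (Rabs (l * x - l * p) < d).
  { rewrite <- Rmult_minus_distr_l, Rabs_mult, (Rabs_pos_eq l) by lra.
    rewrite E; now apply Rmult_lt_compat_l. }
  assert (continuous (fun x => l * x) x)
   by (apply (continuous_mult (fun _ => l) (fun x => x)); [apply continuous_const|apply continuous_id]).
  split; [apply (continuous_comp (fun x => l * x) f1)|apply (continuous_comp (fun x => l * x) f2)]; auto; now apply Hc.
- intros x Hx; apply Hl; split; [|apply Rmult_lt_compat_l; lra].
  rewrite E, <- Rmult_minus_distr_l; apply Rmult_lt_compat_l; lra.
- intros x Hx; apply Hr; split; [apply Rmult_lt_compat_l; lra|].
  rewrite E, <- Rmult_plus_distr_l; apply Rmult_lt_compat_l; lra.
Qed.

Lemma frac_bounds x : 0 <= frac_part x < 1.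
Proof. destruct (base_fp x); lra. Qed.

Lemma frac_eq z x : IZR z <= x < IZR z + 1 -> frac_part x = x - IZR z.
Proof.
intros H; destruct (Int_part_frac_part_spec x z (x - IZR z)) as [_ E]; [lra|ring|easy].
Qed.

Lemma PC_frac : PC frac_part.
Proof.
intros p _; destruct (base_Int_part p) as [H1 H2].
set (n := Int_part p) in *.
assert (Hc : forall c x, continuous (fun x => x - c) x).
{ intros; apply (continuous_minus (fun x : R => x) (fun _ : R => c)); [apply continuous_id|apply continuous_const]. }
destruct (Rle_lt_or_eq_dec _ _ H1) as [H|H].
- exists (Rmin (p - IZR n) (IZR n + 1 - p)); split; [apply Rmin_pos; lra|].
  pose proof (Rmin_l (p - IZR n) (IZR n + 1 - p)); pose proof (Rmin_r (p - IZR n) (IZR n + 1 - p)).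
  exists (fun x => x - IZR n), (fun x => x - IZR n); repeat split; auto; intros x Hx; apply frac_eq; lra.
- exists 1; split; [lra|].
  exists (fun x => x - IZR (n - 1)), (fun x => x - IZR n); repeat split; auto; intros x Hx; apply frac_eq;
   rewrite ?minus_IZR; lra.
Qed.

(** * Interchange of integrals *)

(** Cutting [[c, d]] into [n] equal parts bounds the total increment by [K (d - c)^2 / n]. This
    replaces the argument by a vanishing derivative. *)
Lemma quadratic_increment_const (F : R -> R) c d K : c <= d -> 0 <= K ->
  (forall x y, c <= x <= y -> y <= d -> Rabs (F y - F x) <= K * (y - x) ^ 2) -> F d = F c.
Proof.
intros Hcd HK H.
assert (Hn : forall n, (0 < n)%nat -> Rabs (F d - F c) <= K * (d - c) ^ 2 / INR n).
{ intros n Hn; assert (Hn' : 0 < INR n) by now apply lt_0_INR.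
  set (h := (d - c) / INR n).
  assert (Hh : 0 <= h) by (apply Rmult_le_pos; [lra|apply Rlt_le, Rinv_0_lt_compat; lra]).
  assert (Hh' : INR n * h = d - c) by (unfold h; field; lra).
  assert (HI : forall k, (k <= n)%nat -> Rabs (F (c + INR k * h) - F c) <= INR k * (K * h ^ 2)).
  { induction k; intros Hk.
    - simpl; rewrite Rmult_0_l, Rplus_0_r, Rminus_diag, Rabs_R0; lra.
    - assert (Hk1 : INR k + 1 <= INR n) by (rewrite <- S_INR; now apply le_INR).
      assert (0 <= INR k) by apply pos_INR.
      rewrite S_INR.
      replace (F (c + (INR k + 1) * h) - F c) with
        ((F (c + (INR k + 1) * h) - F (c + INR k * h)) + (F (c + INR k * h) - F c)) by ring.
      eapply Rle_trans; [apply Rabs_triang|].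
      assert (Rabs (F (c + (INR k + 1) * h) - F (c + INR k * h)) <= K * h ^ 2).
      { replace (h ^ 2) with ((c + (INR k + 1) * h - (c + INR k * h)) ^ 2) by ring.
        apply H; [split; nra|].
        replace d with (c + INR n * h) by (rewrite Hh'; ring).
        apply Rplus_le_compat_l, Rmult_le_compat_r; lra. }
      specialize (IHk ltac:(lia)); lra. }
  specialize (HI n (le_n _)); rewrite Hh' in HI; replace (c + (d - c)) with d in HI by ring.
  eapply Rle_trans; [apply HI|]; right; unfold h; field; lra. }
destruct (Req_dec (F d - F c) 0) as [E|E]; [lra|exfalso].
assert (He : 0 < Rabs (F d - F c)) by now apply Rabs_pos_lt.
set (e := Rabs (F d - F c)) in *.
set (B := K * (d - c) ^ 2) in *.
assert (HB : 0 <= B) by (apply Rmult_le_pos; [easy|apply pow2_ge_0]).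
destruct (INR_unbounded (B / e)) as [n Hn0].
assert (Hn1 : 0 < INR n) by (eapply Rle_lt_trans; [|apply Hn0]; apply Rmult_le_pos; [easy|apply Rlt_le, Rinv_0_lt_compat; lra]).
assert (Hn2 : (0 < n)%nat) by (apply INR_lt; easy).
specialize (Hn n Hn2).
assert (B < INR n * e) by (apply (Rmult_lt_compat_r e) in Hn0; [|easy]; replace (B / e * e) with B in Hn0 by (field; lra); lra).
apply (Rmult_le_compat_r (INR n)) in Hn; [|lra]; replace (B / INR n * INR n) with B in Hn by (field; lra); lra.
Qed.

Lemma Lipschitz_ex_RInt (f : R -> R) c d K : c <= d ->
  (forall x y, c <= x <= y -> y <= d -> Rabs (f y - f x) <= K * (y - x)) -> ex_RInt f c d.
Proof.
intros Hcd H.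
(* Clamping the argument to [[c, d]] gives a function that is Lipschitz on the whole line, hence
   continuous in the two-sided sense at the end points as well. *)
set (g := fun x => f (Rmax c (Rmin d x))).
assert (Hcl : forall x, c <= Rmax c (Rmin d x) <= d).
{ intros x; split; [apply Rmax_l|apply Rmax_lub; [easy|apply Rmin_l]]. }
assert (HK : forall x y, x <= y -> Rabs (g y - g x) <= Rabs K * (y - x)).
{ intros x y Hxy; unfold g.
  assert (H1 : Rmax c (Rmin d x) <= Rmax c (Rmin d y)).
  { apply Rle_max_compat_l, Rle_min_compat_l; easy. }
  eapply Rle_trans; [apply H; [split; [apply Hcl|easy]|apply Hcl]|].
  assert (H2 : Rmax c (Rmin d y) - Rmax c (Rmin d x) <= y - x).
  { unfold Rmax, Rmin; repeat destruct Rle_dec; lra. }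
  eapply Rle_trans; [apply Rmult_le_compat_r; [lra|apply Rle_abs]|].
  apply Rmult_le_compat_l; [apply Rabs_pos|easy]. }
apply (ex_RInt_extR g); [easy| |].
{ intros x Hx; unfold g; now rewrite Rmin_right, Rmax_right by lra. }
apply ex_RInt_cont; [easy|]; intros x _.
apply continuity_pt_filterlim.
intros e He; exists (e / (Rabs K + 1)).
assert (0 < Rabs K + 1) by (pose proof (Rabs_pos K); lra).
split; [now apply Rdiv_lt_0_compat|].
intros y [_ Hy]; simpl in *; unfold R_dist in *.
assert (Rabs (g y - g x) <= Rabs K * Rabs (y - x)).
{ destruct (Rle_dec x y).
  - rewrite (Rabs_pos_eq (y - x)) by lra; auto.
  - rewrite <- (Rabs_Ropp (g y - g x)), <- (Rabs_Ropp (y - x)), (Rabs_pos_eq (- (y - x))) by lra.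
    replace (- (g y - g x)) with (g x - g y) by ring; replace (- (y - x)) with (x - y) by ring.
    apply HK; lra. }
apply (Rmult_lt_compat_l (Rabs K + 1)) in Hy; [|easy].
replace ((Rabs K + 1) * (e / (Rabs K + 1))) with e in Hy by (field; lra).
pose proof (Rabs_pos (y - x)); lra.
Qed.

(* An integrated modulus of continuity in the second variable: unlike continuity, it holds for functions
   such as [frac_part (l * x)]. *)
Definition osc_bound (f : R -> R -> R) a b c d K := forall t1 t2, c <= t1 <= t2 -> t2 <= d ->
  exists w, ex_RInt w a b /\ RInt w a b <= K * (t2 - t1) /\
  forall u s, a <= u <= b -> t1 <= s <= t2 -> Rabs (f u s - f u t1) <= w u.

Lemma osc_bound_ex_RInt (f : R -> R -> R) a b c d K : a <= b -> c <= d ->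
  (forall t, c <= t <= d -> ex_RInt (fun u => f u t) a b) ->
  osc_bound f a b c d K ->
  (forall x y, c <= x <= y -> y <= d ->
     Rabs (RInt (fun u => f u y) a b - RInt (fun u => f u x) a b) <= K * (y - x)) /\
  ex_RInt (fun t => RInt (fun u => f u t) a b) c d.
Proof.
intros Hab Hcd H1 H.
assert (HL : forall x y, c <= x <= y -> y <= d ->
     Rabs (RInt (fun u => f u y) a b - RInt (fun u => f u x) a b) <= K * (y - x)).
{ intros x y Hx Hy; destruct (H x y Hx Hy) as (w & Hw1 & Hw2 & Hw3).
  rewrite <- RInt_minusR by (apply H1; lra).
  eapply Rle_trans; [|apply Hw2].
  apply RInt_abs_le; auto; [apply ex_RInt_minusR; apply H1; lra|].
  intros u Hu; apply Hw3; lra. }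
split; [easy|]; now apply (Lipschitz_ex_RInt _ c d K).
Qed.

(** As functions of the upper limit, the two iterated integrals have increments over [[x, y]] that
    both differ from [(y - x)] times the inner integral at [x] by at most [K (y - x)^2]. Their
    difference is therefore constant, and it vanishes when the upper limit is [c]. *)
Lemma RInt_RInt_swap (f : R -> R -> R) a b c d K : a <= b -> c <= d -> 0 <= K ->
  (forall u, a <= u <= b -> ex_RInt (f u) c d) ->
  (forall t, c <= t <= d -> ex_RInt (fun u => f u t) a b) ->
  (forall t, c <= t <= d -> ex_RInt (fun u => RInt (f u) c t) a b) ->
  osc_bound f a b c d K ->
  RInt (fun u => RInt (f u) c d) a b = RInt (fun t => RInt (fun u => f u t) a b) c d.
Proof.
intros Hab Hcd HK H1 H2 H3 H.
destruct (osc_bound_ex_RInt f a b c d K) as [HL Hex]; auto.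
set (G := fun t => RInt (fun u => f u t) a b) in *.
assert (E : RInt (fun u => RInt (f u) c d) a b - RInt G c d =
            RInt (fun u => RInt (f u) c c) a b - RInt G c c).
{ apply (quadratic_increment_const (fun X => RInt (fun u => RInt (f u) c X) a b - RInt G c X) c d (2 * K)); [lra|lra|].
  intros x y Hx Hy.
  assert (Hs : forall u, a <= u <= b -> ex_RInt (f u) x y)
   by (intros u Hu; apply (ex_RInt_sub (f u) c d); auto; lra).
  assert (Hs0 : forall u, a <= u <= b -> ex_RInt (f u) c x)
   by (intros u Hu; apply (ex_RInt_sub (f u) c d); auto; lra).
  assert (HG1 : ex_RInt G x y) by (apply (ex_RInt_sub G c d); auto; lra).
  assert (HG0 : ex_RInt G c x) by (apply (ex_RInt_sub G c d); auto; lra).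
  assert (Hxy : ex_RInt (fun u => RInt (f u) x y) a b).
  { apply (ex_RInt_extR (fun u => RInt (f u) c y - RInt (f u) c x)); auto.
    - intros u Hu; rewrite <- (RInt_ChaslesR (f u) c x y) by (try apply Hs0; try apply Hs; lra); ring.
    - apply ex_RInt_minusR; apply H3; lra. }
  assert (E1 : RInt (fun u => RInt (f u) c y) a b =
     RInt (fun u => RInt (f u) c x) a b + RInt (fun u => RInt (f u) x y) a b).
  { rewrite <- RInt_plusR by (auto; apply H3; lra).
    apply RInt_extR; auto; intros u Hu; symmetry; apply RInt_ChaslesR; [apply Hs0|apply Hs]; lra. }
  rewrite E1, <- (RInt_ChaslesR G c x y) by auto.
  replace (RInt (fun u => RInt (f u) c x) a b + RInt (fun u => RInt (f u) x y) a b -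
     (RInt G c x + RInt G x y) - (RInt (fun u => RInt (f u) c x) a b - RInt G c x))
   with ((RInt (fun u => RInt (f u) x y) a b - (y - x) * G x) - (RInt G x y - (y - x) * G x)) by ring.
  assert (B1 : Rabs (RInt G x y - (y - x) * G x) <= K * (y - x) ^ 2).
  { rewrite <- RInt_constR, <- RInt_minusR by (auto; apply ex_RInt_const).
    replace (K * (y - x) ^ 2) with ((y - x) * (K * (y - x))) by ring.
    apply RInt_const_bound; [lra|apply ex_RInt_minusR; [auto|apply ex_RInt_const]|].
    intros t Ht; eapply Rle_trans; [apply HL; lra|apply Rmult_le_compat_l; lra]. }
  assert (B2 : Rabs (RInt (fun u => RInt (f u) x y) a b - (y - x) * G x) <= K * (y - x) ^ 2).
  { destruct (H x y Hx Hy) as (w & Hw1 & Hw2 & Hw3).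
    unfold G; rewrite <- RInt_scalR by (apply H2; lra).
    rewrite <- RInt_minusR by (auto; apply ex_RInt_scalR; apply H2; lra).
    eapply Rle_trans with (RInt (fun u => (y - x) * w u) a b).
    - apply RInt_abs_le; auto.
      + apply ex_RInt_minusR; auto; apply ex_RInt_scalR, H2; lra.
      + now apply ex_RInt_scalR.
      + intros u Hu.
        rewrite <- RInt_constR, <- RInt_minusR by (try apply ex_RInt_const; apply Hs; lra).
        apply RInt_const_bound; [lra|apply ex_RInt_minusR; [apply Hs; lra|apply ex_RInt_const]|].
        intros t Ht; apply Hw3; lra.
    - rewrite RInt_scalR by auto.
      replace (K * (y - x) ^ 2) with ((y - x) * (K * (y - x))) by ring.
      apply Rmult_le_compat_l; [lra|easy]. }
  eapply Rle_trans; [apply Rabs_triang|]; rewrite Rabs_Ropp; lra. }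
assert (E0 : RInt (fun u => RInt (f u) c c) a b = 0).
{ rewrite (RInt_extR _ (fun _ => 0)); auto.
  - rewrite RInt_constR; apply Rmult_0_r.
  - intros u _; exact (RInt_point c (f u)). }
assert (E2 : RInt G c c = 0) by exact (RInt_point c G).
lra.
Qed.

(** * Limits with a rate, and elementary primitives *)

(** Cauchy's criterion with a rate: the bound [e x] on all later increments passes to the limit, so
    every improper integral comes with its truncation error. *)
Lemma tail_limit (F e : R -> R) :
  (forall x y, 1 <= x <= y -> Rabs (F y - F x) <= e x) ->
  (forall eps, 0 < eps -> exists X, 1 <= X /\ e X < eps) ->
  exists l, forall x, 1 <= x -> Rabs (F x - l) <= e x.
Proof.
intros H1 H2.
destruct (Rcomplete.R_complete (fun n => F (INR n + 1))) as [l Hl].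
{ intros eps Heps; destruct (H2 (eps / 2)) as (X & HX & He); [lra|].
  destruct (INR_unbounded X) as [N HN]; exists N; intros n m Hn Hm; unfold R_dist.
  apply le_INR in Hn, Hm.
  assert (A1 : Rabs (F (INR n + 1) - F X) <= e X) by (apply H1; lra).
  assert (A2 : Rabs (F (INR m + 1) - F X) <= e X) by (apply H1; lra).
  apply Rabs_le_between in A1, A2; apply Rabs_def1; lra. }
exists l; intros x Hx; apply Rnot_lt_le; intros Hlt.
destruct (Hl (Rabs (F x - l) - e x)) as [N HN]; [lra|].
destruct (INR_unbounded x) as [N' HN'].
specialize (HN (max N N') ltac:(lia)); unfold R_dist in HN.
assert (A : INR N' <= INR (max N N')) by (apply le_INR; lia).
assert (A1 : Rabs (F (INR (max N N') + 1) - F x) <= e x) by (apply H1; lra).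
assert (Rabs (F x - l) <= Rabs (F (INR (max N N') + 1) - F x) + Rabs (F (INR (max N N') + 1) - l)); [|lra].
replace (F x - l) with (- (F (INR (max N N') + 1) - F x) + (F (INR (max N N') + 1) - l)) by ring.
eapply Rle_trans; [apply Rabs_triang|]; rewrite Rabs_Ropp; lra.
Qed.

Lemma inv_lt_eps K eps : 0 <= K -> 0 < eps -> exists X, 1 <= X /\ K * / X < eps.
Proof.
intros HK He; exists (K / eps + 1).
assert (0 <= K / eps) by (apply Rmult_le_pos; [easy|apply Rlt_le, Rinv_0_lt_compat; lra]).
split; [lra|]; apply (Rmult_lt_reg_r (K / eps + 1)); [lra|].
rewrite Rmult_assoc, Rinv_l by lra.
replace (eps * (K / eps + 1)) with (K + eps) by (field; lra); lra.
Qed.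

Lemma continuous_of_ex_derive (f : R -> R) (x : R) : ex_derive f x -> continuous f x.
Proof. exact (ex_derive_continuous f x). Qed.

Ltac auto_cont := apply continuous_of_ex_derive; auto_derive.

Ltac sqrt_facts x H := let K := fresh in let K' := fresh in
  pose proof (sqrt_lt_R0 x H) as K; pose proof (sqrt_sqrt x (Rlt_le _ _ H)) as K'.

Ltac sqrt_elim x := generalize dependent (sqrt x);
  let s := fresh "s" in let K := fresh in let K' := fresh in
  intros s K K'; try (subst x; assert (s <> 0) by lra).

Lemma is_derive_inv_sqrt x : 0 < x -> is_derive (fun x => -2 / sqrt x) x (/ (x * sqrt x)).
Proof.
intros Hx; sqrt_facts x Hx; auto_derive; [repeat split; lra|].
sqrt_elim x; field; easy.
Qed.

Lemma continuous_inv32 x : 0 < x -> continuous (fun x => / (x * sqrt x)) x.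
Proof.
intros Hx; sqrt_facts x Hx; auto_cont; repeat split; try lra.
apply Rgt_not_eq, Rmult_lt_0_compat; lra.
Qed.

Lemma is_derive_2sqrt x : 0 < x -> is_derive (fun x => 2 * sqrt x) x (/ sqrt x).
Proof.
intros Hx; sqrt_facts x Hx; auto_derive; [repeat split; lra|]; field; lra.
Qed.

Lemma continuous_inv_sqrt x : 0 < x -> continuous (fun x => / sqrt x) x.
Proof.
intros Hx; sqrt_facts x Hx; auto_cont; repeat split; lra.
Qed.

Lemma continuous_cos_ln t p x : 0 < x -> continuous (fun x => cos (t * ln x + p)) x.
Proof. intros Hx; auto_cont; lra. Qed.

Lemma frac_le x : 0 <= x -> frac_part x <= x.
Proof.
intros Hx; destruct (Rlt_le_dec x 1) as [H|H].
- rewrite (frac_eq 0); simpl; lra.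
- pose proof (frac_bounds x); lra.
Qed.

Lemma frac_small x : 0 <= x < 1 -> frac_part x = x.
Proof. intros H; rewrite (frac_eq 0); simpl; lra. Qed.

(** * The Mellin transform of the fractional part on the critical line *)

(** The phase [p] replaces complex numbers: with [s = 1/2 + i t] this is the real part of
    [{x} x^(-s-1)] for [p = 0] and its imaginary part for [p = PI / 2]. *)
Definition mellin_frac t p x := frac_part x * (/ (x * sqrt x) * cos (t * ln x + p)).

Lemma PC_mellin_frac t p : PC (mellin_frac t p).
Proof.
apply PC_mult; [apply PC_frac|]; apply PC_mult; apply PC_cont; intros.
- now apply continuous_inv32.
- now apply continuous_cos_ln.
Qed.

Lemma ex_mellin_frac t p a b : 0 < a -> a <= b -> ex_RInt (mellin_frac t p) a b.
Proof. intros; apply PC_ex_RInt; auto; apply PC_mellin_frac. Qed.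

Lemma inv32_pos x : 0 < x -> 0 < / (x * sqrt x).
Proof. intros Hx; sqrt_facts x Hx; now apply Rinv_0_lt_compat, Rmult_lt_0_compat. Qed.

Lemma mellin_frac_bound_large t p x : 0 < x -> Rabs (mellin_frac t p x) <= / (x * sqrt x).
Proof.
intros Hx; unfold mellin_frac; rewrite !Rabs_mult.
pose proof (frac_bounds x); pose proof (inv32_pos x Hx).
rewrite (Rabs_pos_eq (frac_part x)), (Rabs_pos_eq (/ _)) by lra.
assert (Rabs (cos (t * ln x + p)) <= 1) by (apply Rabs_le, COS_bound).
pose proof (Rabs_pos (cos (t * ln x + p))).
assert (/ (x * sqrt x) * Rabs (cos (t * ln x + p)) <= / (x * sqrt x)) by nra.
assert (0 <= / (x * sqrt x) * Rabs (cos (t * ln x + p))) by nra.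
nra.
Qed.

Lemma frac_inv32 x : 0 < x -> frac_part x * / (x * sqrt x) <= / sqrt x.
Proof.
intros Hx; sqrt_facts x Hx; pose proof (frac_le x (Rlt_le _ _ Hx)).
replace (/ sqrt x) with (x * / (x * sqrt x)) by (field; lra).
apply Rmult_le_compat_r; [apply Rlt_le, inv32_pos|]; easy.
Qed.

Lemma mellin_frac_bound_small t p x : 0 < x -> Rabs (mellin_frac t p x) <= / sqrt x.
Proof.
intros Hx; unfold mellin_frac; rewrite <- Rmult_assoc, Rabs_mult.
pose proof (frac_bounds x); pose proof (inv32_pos x Hx).
assert (0 <= frac_part x * / (x * sqrt x)) by nra.
rewrite Rabs_pos_eq by easy.
assert (Rabs (cos (t * ln x + p)) <= 1) by (apply Rabs_le, COS_bound).
pose proof (Rabs_pos (cos (t * ln x + p))).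
pose proof (frac_inv32 x Hx); nra.
Qed.

Definition mellin_int t p a b : R := RInt (mellin_frac t p) a b.

Lemma mellin_int_large t p a b : 0 < a -> a <= b -> Rabs (mellin_int t p a b) <= 2 / sqrt a.
Proof.
intros Ha Hab.
eapply Rle_trans.
- apply (RInt_abs_le_derive _ (fun x => -2 / sqrt x) (fun x => / (x * sqrt x))); auto.
  + now apply ex_mellin_frac.
  + intros; apply is_derive_inv_sqrt; lra.
  + intros; apply continuous_inv32; lra.
  + intros; apply mellin_frac_bound_large; lra.
- assert (0 < sqrt b) by (apply sqrt_lt_R0; lra).
  assert (0 < / sqrt b) by now apply Rinv_0_lt_compat.
  unfold Rdiv; lra.
Qed.

Lemma mellin_int_small t p a b : 0 < a -> a <= b -> Rabs (mellin_int t p a b) <= 2 * sqrt b.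
Proof.
intros Ha Hab.
eapply Rle_trans.
- apply (RInt_abs_le_derive _ (fun x => 2 * sqrt x) (fun x => / sqrt x)); auto.
  + now apply ex_mellin_frac.
  + intros; apply is_derive_2sqrt; lra.
  + intros; apply continuous_inv_sqrt; lra.
  + intros; apply mellin_frac_bound_small; lra.
- pose proof (sqrt_pos a); lra.
Qed.

Lemma inv_sqrt_small eps : 0 < eps -> exists X, 1 <= X /\ 2 / sqrt X < eps.
Proof.
intros He; exists ((2 / eps + 1) ^ 2).
assert (0 < 2 / eps) by (apply Rdiv_lt_0_compat; lra).
split; [nra|]; rewrite sqrt_pow2 by lra.
apply (Rmult_lt_reg_r (2 / eps + 1)); [lra|].
replace (2 / (2 / eps + 1) * (2 / eps + 1)) with 2 by (field; lra).
replace (eps * (2 / eps + 1)) with (2 + eps) by (field; lra); lra.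
Qed.

(** From [{x} < 1] the integrand is at most [x^(-3/2)], from [{x} <= x] at most [x^(-1/2)]; the
    first bound is integrable at infinity, the second at 0. The end 0 is treated as a tail at
    infinity in the reciprocal of the lower limit. *)
Lemma mellin_int_limit t p : exists l, forall a b, 0 < a <= 1 -> 1 <= b ->
  Rabs (mellin_int t p a b - l) <= 2 * sqrt a + 2 / sqrt b.
Proof.
destruct (tail_limit (fun b => mellin_int t p 1 b) (fun x => 2 / sqrt x)) as [l1 Hl1].
{ intros x y Hxy; unfold mellin_int.
  rewrite <- (RInt_ChaslesR _ 1 x y) by (apply ex_mellin_frac; lra).
  replace (_ + _ - _) with (mellin_int t p x y) by (unfold mellin_int; rring).
  apply mellin_int_large; lra. }
{ apply inv_sqrt_small. }
destruct (tail_limit (fun b => mellin_int t p (/ b) 1) (fun x => 2 / sqrt x)) as [l2 Hl2].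
{ intros x y Hxy; unfold mellin_int.
  assert (0 < / y) by (apply Rinv_0_lt_compat; lra).
  assert (/ y <= / x) by (apply Rinv_le_contravar; lra).
  assert (/ x <= 1) by (rewrite <- Rinv_1; apply Rinv_le_contravar; lra).
  rewrite <- (RInt_ChaslesR _ (/ y) (/ x) 1) by (apply ex_mellin_frac; lra).
  replace (_ + _ - _) with (mellin_int t p (/ y) (/ x)) by (unfold mellin_int; rring).
  replace (2 / sqrt x) with (2 * sqrt (/ x)) by (rewrite sqrt_inv; reflexivity).
  apply mellin_int_small; lra. }
{ apply inv_sqrt_small. }
exists (l1 + l2); intros a b Ha Hb; unfold mellin_int.
rewrite <- (RInt_ChaslesR _ a 1 b) by (apply ex_mellin_frac; lra).
specialize (Hl1 b Hb); specialize (Hl2 (/ a)).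
rewrite Rinv_inv, sqrt_inv in Hl2.
assert (1 <= / a) by (rewrite <- Rinv_1; apply Rinv_le_contravar; lra).
specialize (Hl2 H); replace (2 / / sqrt a) with (2 * sqrt a) in Hl2
 by (sqrt_facts a (proj1 Ha); field; lra).
unfold mellin_int in *.
replace (_ + _ - _) with ((RInt (mellin_frac t p) a 1 - l2) + (RInt (mellin_frac t p) 1 b - l1)) by ring.
eapply Rle_trans; [apply Rabs_triang|]; lra.
Qed.

(** The improper integral over the half-line: [mellin t 0] and [mellin t (PI / 2)] are the real and
    imaginary parts of [- zeta(s) / s] at [s = 1/2 + i t]. The truncation error itself serves as the
    defining property. *)
Definition mellin t p : R := epsilon (inhabits 0) (fun l => forall a b, 0 < a <= 1 -> 1 <= b ->
  Rabs (mellin_int t p a b - l) <= 2 * sqrt a + 2 / sqrt b).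

Lemma mellin_spec t p a b : 0 < a <= 1 -> 1 <= b ->
  Rabs (mellin_int t p a b - mellin t p) <= 2 * sqrt a + 2 / sqrt b.
Proof.
exact (epsilon_spec (inhabits 0) (fun l => forall a b, 0 < a <= 1 -> 1 <= b ->
  Rabs (mellin_int t p a b - l) <= 2 * sqrt a + 2 / sqrt b) (mellin_int_limit t p) a b).
Qed.

Lemma mellin_lim t p : is_lim_seq (fun n => mellin_int t p (/ INR (S n)) (INR (S n))) (mellin t p).
Proof.
apply is_lim_seq_eps; intros eps Heps.
destruct (inv_sqrt_small (eps / 2)) as (X & HX & He); [lra|].
destruct (INR_unbounded X) as [N HN]; exists N; intros n Hn.
apply le_INR in Hn; rewrite S_INR.
assert (0 < INR n + 1) by lra.
assert (0 < / (INR n + 1)) by now apply Rinv_0_lt_compat.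
assert (/ (INR n + 1) <= 1) by (rewrite <- Rinv_1; apply Rinv_le_contravar; lra).
eapply Rle_lt_trans; [apply mellin_spec; lra|].
rewrite sqrt_inv.
assert (/ sqrt (INR n + 1) <= / sqrt X).
{ apply Rinv_le_contravar; [apply sqrt_lt_R0; lra|apply sqrt_le_1; lra]. }
unfold Rdiv in *; lra.
Qed.

(** The addition formula for the cosine holds for the truncated integrals and survives the limit, so
    that two phases determine all others. *)
Lemma mellin_phase t p : mellin t p = cos p * mellin t 0 + sin p * mellin t (PI / 2).
Proof.
pose proof (is_lim_seq_unique _ _ (mellin_lim t p)) as E.
cut (Lim_seq (fun n => mellin_int t p (/ INR (S n)) (INR (S n))) =
  Finite (cos p * mellin t 0 + sin p * mellin t (PI / 2))).
{ intros E'; rewrite E in E'; now injection E'. }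
apply is_lim_seq_unique.
apply (is_lim_seq_ext (fun n => cos p * mellin_int t 0 (/ INR (S n)) (INR (S n)) +
  sin p * mellin_int t (PI / 2) (/ INR (S n)) (INR (S n)))).
- intros n.
  assert (1 <= INR (S n)) by (rewrite S_INR; pose proof (pos_INR n); lra).
  assert (0 < / INR (S n)) by (apply Rinv_0_lt_compat; lra).
  assert (/ INR (S n) <= 1) by (rewrite <- Rinv_1; apply Rinv_le_contravar; lra).
  unfold mellin_int.
  assert (He : forall p, ex_RInt (mellin_frac t p) (/ INR (S n)) (INR (S n)))
   by (intros; apply ex_mellin_frac; lra).
  rewrite <- RInt_lin2 by apply He.
  apply RInt_extR; [lra|]; intros x _; unfold mellin_frac.
  rewrite Rplus_0_r, !cos_plus, sin_PI2, cos_PI2; ring.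
- apply (is_lim_seq_plus' (fun n => cos p * mellin_int t 0 (/ INR (S n)) (INR (S n)))
   (fun n => sin p * mellin_int t (PI / 2) (/ INR (S n)) (INR (S n)))).
  + apply (is_lim_seq_scal_l (fun n => mellin_int t 0 (/ INR (S n)) (INR (S n))) (cos p) (mellin t 0)).
    apply mellin_lim.
  + apply (is_lim_seq_scal_l (fun n => mellin_int t (PI / 2) (/ INR (S n)) (INR (S n))) (sin p) (mellin t (PI / 2))).
    apply mellin_lim.
Qed.

(** Differentiating in [t] brings down a factor [ln x], and [{x} x^(-3/2) |ln x|] has mass at most 4
    on either side of 1; the primitives used are [sqrt x (4 - 2 ln x)] and
    [- (2 ln x + 4) / sqrt x]. *)
Lemma mellin_int_Lipschitz p a b s t : 0 < a <= 1 -> 1 <= b ->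
  Rabs (mellin_int t p a b - mellin_int s p a b) <= 8 * Rabs (t - s).
Proof.
intros Ha Hb; unfold mellin_int.
assert (He : forall t a b, 0 < a -> a <= b -> ex_RInt (mellin_frac t p) a b)
 by (intros; now apply ex_mellin_frac).
rewrite <- RInt_minusR by (apply He; lra).
assert (He' : forall a b, 0 < a -> a <= b ->
  ex_RInt (fun x => mellin_frac t p x - mellin_frac s p x) a b)
 by (intros; now apply ex_RInt_minusR; apply He).
assert (Hp : forall x, 0 < x -> Rabs (mellin_frac t p x - mellin_frac s p x) <=
  frac_part x * / (x * sqrt x) * Rabs (ln x) * Rabs (t - s)).
{ intros x Hx; unfold mellin_frac.
  replace (_ - _) with ((frac_part x * / (x * sqrt x)) * (cos (t * ln x + p) - cos (s * ln x + p))) by ring.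
  pose proof (frac_bounds x); pose proof (inv32_pos x Hx).
  assert (0 <= frac_part x * / (x * sqrt x)) by nra.
  rewrite Rabs_mult, (Rabs_pos_eq (frac_part x * _)), (Rmult_assoc _ (Rabs (ln x))) by easy; apply Rmult_le_compat_l; [easy|].
  rewrite <- Rabs_mult.
  replace (ln x * (t - s)) with ((t * ln x + p) - (s * ln x + p)) by ring.
  destruct (MVT_gen cos (s * ln x + p) (t * ln x + p) (fun x => - sin x)) as (c & _ & E).
  - intros; auto_derive; auto; ring.
  - intros; apply derivable_continuous_pt, derivable_pt_cos.
  - rewrite E, Rabs_mult, Rabs_Ropp.
    assert (Rabs (sin c) <= 1) by (apply Rabs_le, SIN_bound).
    pose proof (Rabs_pos (t * ln x + p - (s * ln x + p))); nra. }
rewrite <- (RInt_ChaslesR _ a 1 b) by (apply He'; lra).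
eapply Rle_trans; [apply Rabs_triang|].
assert (B1 : Rabs (RInt (fun x => mellin_frac t p x - mellin_frac s p x) a 1) <= 4 * Rabs (t - s)).
{ eapply Rle_trans.
  - apply (RInt_abs_le_derive _ (fun x => Rabs (t - s) * (sqrt x * (4 - 2 * ln x)))
      (fun x => Rabs (t - s) * (- ln x / sqrt x))); [lra|apply He'; lra| | |].
    + intros x Hx; assert (Hx0 : 0 < x) by lra; sqrt_facts x Hx0.
      auto_derive; [repeat split; lra|]; sqrt_elim x; field; easy.
    + intros x Hx; assert (Hx0 : 0 < x) by lra; sqrt_facts x Hx0.
      auto_cont; repeat split; lra.
    + intros x Hx; eapply Rle_trans; [apply Hp; lra|].
      rewrite (Rmult_comm _ (Rabs (t - s))); apply Rmult_le_compat_l; [apply Rabs_pos|].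
      assert (ln x <= 0) by (rewrite <- ln_1; apply Rlt_le, ln_increasing; lra).
      rewrite Rabs_left1 by easy; unfold Rdiv; rewrite (Rmult_comm (- ln x)).
      apply Rmult_le_compat_r; [lra|apply frac_inv32; lra].
  - rewrite sqrt_1, ln_1.
    assert (ln a <= 0).
    { destruct (Req_dec a 1) as [->|Ha1]; [rewrite ln_1; lra|].
      rewrite <- ln_1; apply Rlt_le, ln_increasing; lra. }
    pose proof (sqrt_pos a); pose proof (Rabs_pos (t - s)).
    assert (0 <= sqrt a * (4 - 2 * ln a)) by (apply Rmult_le_pos; lra).
    assert (0 <= Rabs (t - s) * (sqrt a * (4 - 2 * ln a))) by now apply Rmult_le_pos.
    lra. }
assert (B2 : Rabs (RInt (fun x => mellin_frac t p x - mellin_frac s p x) 1 b) <= 4 * Rabs (t - s)).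
{ eapply Rle_trans.
  - apply (RInt_abs_le_derive _ (fun x => Rabs (t - s) * (- (2 * ln x + 4) / sqrt x))
      (fun x => Rabs (t - s) * (ln x / (x * sqrt x)))); [lra|apply He'; lra| | |].
    + intros x Hx; assert (Hx0 : 0 < x) by lra; sqrt_facts x Hx0.
      auto_derive; [repeat split; lra|]; sqrt_elim x; field; easy.
    + intros x Hx; assert (Hx0 : 0 < x) by lra; sqrt_facts x Hx0.
      auto_cont; repeat split; try lra.
      apply Rgt_not_eq, Rmult_lt_0_compat; lra.
    + intros x Hx; eapply Rle_trans; [apply Hp; lra|].
      rewrite (Rmult_comm _ (Rabs (t - s))); apply Rmult_le_compat_l; [apply Rabs_pos|].
      assert (0 <= ln x) by (rewrite <- ln_1; apply Rlt_le, ln_increasing; lra).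
      rewrite Rabs_pos_eq by easy; unfold Rdiv; rewrite (Rmult_comm (ln x)).
      apply Rmult_le_compat_r; [lra|].
      pose proof (frac_bounds x); pose proof (inv32_pos x ltac:(lra)); nra.
  - rewrite sqrt_1, ln_1.
    assert (0 <= ln b).
    { destruct (Req_dec b 1) as [->|Ha1]; [rewrite ln_1; lra|].
      rewrite <- ln_1; apply Rlt_le, ln_increasing; lra. }
    pose proof (sqrt_lt_R0 b ltac:(lra)); pose proof (Rabs_pos (t - s)).
    assert (0 <= (2 * ln b + 4) / sqrt b) by (apply Rmult_le_pos; [lra|apply Rlt_le, Rinv_0_lt_compat; lra]).
    assert (0 <= Rabs (t - s) * ((2 * ln b + 4) / sqrt b)) by now apply Rmult_le_pos.
    replace (- (2 * ln b + 4) / sqrt b) with (- ((2 * ln b + 4) / sqrt b)) by (unfold Rdiv; ring).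
    lra. }
lra.
Qed.

Lemma mellin_Lipschitz p s t : Rabs (mellin t p - mellin s p) <= 8 * Rabs (t - s).
Proof.
assert (H : Rbar_le (Rabs (mellin t p - mellin s p)) (8 * Rabs (t - s))); [|exact H].
apply (is_lim_seq_le (fun n => Rabs (mellin_int t p (/ INR (S n)) (INR (S n)) -
  mellin_int s p (/ INR (S n)) (INR (S n)))) (fun _ => 8 * Rabs (t - s))).
- intros n; assert (1 <= INR (S n)) by (rewrite S_INR; pose proof (pos_INR n); lra).
  apply mellin_int_Lipschitz; [|easy].
  split; [apply Rinv_0_lt_compat; lra|rewrite <- Rinv_1; apply Rinv_le_contravar; lra].
- apply (is_lim_seq_abs _ (Finite (mellin t p - mellin s p))).
  apply is_lim_seq_minus'; apply mellin_lim.
- apply is_lim_seq_const.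
Qed.

Lemma continuous_mellin p t : continuous (fun t => mellin t p) t.
Proof.
apply continuity_pt_filterlim; intros e He; exists (e / 8); split; [lra|].
intros y [_ Hy]; simpl in *; unfold R_dist in *.
eapply Rle_lt_trans; [apply mellin_Lipschitz|]; lra.
Qed.

(** Comparison with the empty integral truncated at [a = b = 1], where the error bound equals 4. *)
Lemma mellin_bound t p : Rabs (mellin t p) <= 4.
Proof.
assert (H : Rabs (mellin_int t p 1 1 - mellin t p) <= 2 * sqrt 1 + 2 / sqrt 1) by (apply mellin_spec; lra).
unfold mellin_int in H; rewrite (RInt_point 1 (mellin_frac t p)), sqrt_1 in H.
change zero with 0 in H; rewrite Rminus_0_l, Rabs_Ropp in H; lra.
Qed.

(** * The alternating series and the function [Z2] *)

Definition eta_term t p (m : nat) := (-1) ^ m / sqrt (INR (S m)) * cos (t * ln (INR (S m)) + p).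

(* minus the derivative of [x ^ (-1/2) cos (t ln x + p)] *)
Definition eta_kernel t p x :=
  / (x * sqrt x) * (/ 2 * cos (t * ln x + p) + t * sin (t * ln x + p)).

Lemma continuous_eta_kernel t p x : 0 < x -> continuous (eta_kernel t p) x.
Proof.
intros Hx; unfold eta_kernel; sqrt_facts x Hx; auto_cont; repeat split; try lra.
apply Rgt_not_eq, Rmult_lt_0_compat; lra.
Qed.

(** The integer part of [x] modulo 2, that is, the partial sums of the alternating signs. Writing it
    with two dilates of the fractional part is the real-variable form of the factor
    [1 - 2^(1-s)]. *)
Definition parity x := 2 * frac_part (/ 2 * x) - frac_part x.

Lemma parity_small x : 0 <= x < 1 -> parity x = 0.
Proof. intros H; unfold parity; rewrite !frac_small; lra. Qed.

Lemma parity_odd (j : nat) x : 2 * INR j + 1 <= x < 2 * INR j + 2 -> parity x = 1.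
Proof.
intros H; unfold parity.
assert (E : IZR (Z.of_nat j) = INR j) by now rewrite INR_IZR_INZ.
rewrite (frac_eq (Z.of_nat j)), (frac_eq (2 * Z.of_nat j + 1)); rewrite ?plus_IZR, ?mult_IZR, ?E; simpl; lra.
Qed.

Lemma parity_even (j : nat) x : 2 * INR j + 2 <= x < 2 * INR j + 3 -> parity x = 0.
Proof.
intros H; unfold parity.
assert (E : IZR (Z.of_nat j) = INR j) by now rewrite INR_IZR_INZ.
rewrite (frac_eq (Z.of_nat j + 1)), (frac_eq (2 * Z.of_nat j + 2)); rewrite ?plus_IZR, ?mult_IZR, ?E; simpl; lra.
Qed.

Lemma PC_frac_kernel t p : PC (fun x => frac_part x * eta_kernel t p x).
Proof. apply PC_mult; [apply PC_frac|apply PC_cont; intros; now apply continuous_eta_kernel]. Qed.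

Lemma PC_half_kernel t p : PC (fun x => frac_part (/ 2 * x) * eta_kernel t p x).
Proof.
apply PC_mult; [apply (PC_scale frac_part); [lra|apply PC_frac]|].
apply PC_cont; intros; now apply continuous_eta_kernel.
Qed.

Lemma PC_parity_kernel t p : PC (fun x => parity x * eta_kernel t p x).
Proof.
apply (PC_ext (fun x => 2 * (frac_part (/ 2 * x) * eta_kernel t p x) - frac_part x * eta_kernel t p x)).
- intros x _; unfold parity; ring.
- apply PC_minus; [apply PC_mult; [apply PC_const|apply PC_half_kernel]|apply PC_frac_kernel].
Qed.

Lemma eta_pair t p (k : nat) : let x := 2 * INR k + 1 in
  eta_term t p (2 * k) + eta_term t p (S (2 * k)) = RInt (eta_kernel t p) x (x + 1).
Proof.
intros x; pose proof (pos_INR k).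
rewrite (RInt_FTC (fun x => - (cos (t * ln x + p) / sqrt x))); [| unfold x; lra| |].
- unfold eta_term; rewrite !S_INR, mult_INR; change (INR 2) with (1 + 1).
  replace ((1 + 1) * INR k + 1) with x by (unfold x; ring).
  replace ((-1) ^ S (2 * k)) with (-1) by (rewrite <- tech_pow_Rmult, pow_1_even; ring).
  rewrite pow_1_even; unfold Rdiv; ring.
- intros y Hy; assert (Hy0 : 0 < y) by (unfold x in Hy; lra).
  unfold eta_kernel; pose proof (sqrt_lt_R0 y Hy0); pose proof (sqrt_sqrt y (Rlt_le _ _ Hy0)).
  auto_derive; [repeat split; lra|]; generalize (cos (t * ln y + p)), (sin (t * ln y + p)); intros.
  sqrt_elim y; field; easy.
- intros y Hy; apply continuous_eta_kernel; unfold x in Hy; lra.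
Qed.

(** Abel summation: terms taken in pairs are the integrals of the kernel over the intervals on which
    [parity] equals 1. *)
Lemma eta_partial_sum t p K :
  sum_f_R0 (eta_term t p) (S (2 * K)) = RInt (fun x => parity x * eta_kernel t p x) 1 (2 * INR K + 2).
Proof.
assert (Hex : forall a b, 0 < a -> a <= b -> ex_RInt (fun x => parity x * eta_kernel t p x) a b).
{ intros; apply PC_ex_RInt; auto; apply PC_parity_kernel. }
assert (Hodd : forall k, RInt (fun x => parity x * eta_kernel t p x) (2 * INR k + 1) (2 * INR k + 2) =
  eta_term t p (2 * k) + eta_term t p (S (2 * k))).
{ intros k; rewrite eta_pair; replace (2 * INR k + 1 + 1) with (2 * INR k + 2) by ring.
  apply RInt_extR; [lra|]; intros x Hx; rewrite (parity_odd k) by lra; ring. }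
induction K.
- change (sum_f_R0 (eta_term t p) (S (2 * 0))) with (eta_term t p (2 * 0) + eta_term t p (S (2 * 0))); rewrite <- (Hodd 0%nat); simpl INR; f_equal; ring.
- replace (S (2 * S K)) with (S (S (S (2 * K)))) by lia; rewrite 2!tech5, IHK.
  assert (0 <= INR K) by apply pos_INR.
  rewrite S_INR.
  replace (2 * (INR K + 1) + 2) with (2 * INR K + 4) by ring.
  rewrite <- (RInt_ChaslesR _ 1 (2 * INR K + 2) (2 * INR K + 4)) by (apply Hex; lra).
  rewrite <- (RInt_ChaslesR _ (2 * INR K + 2) (2 * INR K + 3) (2 * INR K + 4)) by (apply Hex; lra).
  rewrite (RInt_extR _ (fun _ => 0) (2 * INR K + 2) (2 * INR K + 3)); [|lra|].
  2:{ intros x Hx; rewrite (parity_even K) by lra; ring. }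
  rewrite RInt_constR.
  specialize (Hodd (S K)); rewrite S_INR in Hodd.
  replace (2 * (INR K + 1) + 1) with (2 * INR K + 3) in Hodd by ring.
  replace (2 * (INR K + 1) + 2) with (2 * INR K + 4) in Hodd by ring.
  rewrite Hodd; replace (2 * S K)%nat with (S (S (2 * K))) by lia; ring.
Qed.

(** The bracket in the kernel is multiplication by [s = 1/2 + i t], a factor [i] being a shift of
    the phase by [PI / 2]. *)
Lemma frac_kernel_mellin t p a b : 0 < a -> a <= b ->
  RInt (fun x => frac_part x * eta_kernel t p x) a b =
  / 2 * mellin_int t p a b + t * mellin_int t (p - PI / 2) a b.
Proof.
intros Ha Hab; unfold mellin_int.
rewrite <- RInt_lin2 by now apply ex_mellin_frac.
apply RInt_extR; [easy|]; intros x _; unfold mellin_frac, eta_kernel.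
replace (t * ln x + (p - PI / 2)) with ((t * ln x + p) - PI / 2) by ring.
rewrite (cos_minus (t * ln x + p)), cos_PI2, sin_PI2; ring.
Qed.

(** The substitution [x = 2 y] turns the dilation into the factor [2^(1-s)], of modulus [sqrt 2] and
    phase [t ln 2]. *)
Lemma half_kernel_mellin t p a b : 0 < a -> a <= b ->
  RInt (fun x => 2 * (frac_part (/ 2 * x) * eta_kernel t p x)) a b =
  sqrt 2 * RInt (fun x => frac_part x * eta_kernel t (t * ln 2 + p) x) (/ 2 * a) (/ 2 * b).
Proof.
intros Ha Hab.
assert (Hex : ex_RInt (fun x => 2 * (frac_part (/ 2 * x) * eta_kernel t p x)) a b).
{ apply PC_ex_RInt; auto; apply PC_mult; [apply PC_const|apply PC_half_kernel]. }
transitivity (RInt (fun y => 2 * (2 * (frac_part (/ 2 * (2 * y + 0)) * eta_kernel t p (2 * y + 0)))) (/ 2 * a) (/ 2 * b)).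
{ symmetry.
  assert (E : forall x, 2 * (/ 2 * x) + 0 = x) by (intros; field).
  rewrite (RInt_comp_lin (fun x => 2 * (frac_part (/ 2 * x) * eta_kernel t p x)) 2 0); rewrite !E; [reflexivity|easy]. }
rewrite <- RInt_scalR.
2:{ apply PC_ex_RInt; try lra; apply PC_frac_kernel. }
apply RInt_extR; [lra|]; intros y Hy; assert (Hy0 : 0 < y) by lra.
rewrite Rplus_0_r; replace (/ 2 * (2 * y)) with y by field.
unfold eta_kernel; rewrite ln_mult, sqrt_mult by lra.
replace (t * (ln 2 + ln y) + p) with (t * ln y + (t * ln 2 + p)) by ring.
pose proof (sqrt_lt_R0 y Hy0); pose proof (sqrt_lt_R0 2 ltac:(lra)).
assert (E : sqrt 2 * sqrt 2 = 2) by (apply sqrt_sqrt; lra).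
assert (E' : / (2 * y * (sqrt 2 * sqrt y)) = / 4 * sqrt 2 * / (y * sqrt y)).
{ replace (2 * y * (sqrt 2 * sqrt y)) with (sqrt 2 * sqrt 2 * sqrt 2 * (y * sqrt y)) by (rewrite E; ring).
  replace 4 with (sqrt 2 * sqrt 2 * (sqrt 2 * sqrt 2)) by (rewrite E; ring); field; lra. }
rewrite E'; field; lra.
Qed.

(** The real part of [e^(-ip) (2^(1-s) - 1) s M], where [M = - zeta(s) / s]; thus of
    [e^(-ip) (1 - 2^(1-s)) zeta(s)]. *)
Definition eta_limit t p := sqrt 2 * (/ 2 * mellin t (t * ln 2 + p) + t * mellin t (t * ln 2 + p - PI / 2)) -
  (/ 2 * mellin t p + t * mellin t (p - PI / 2)).

Lemma eta_partial_sum_mellin t p K : let a := / INR (S K) in let b := INR (S K) in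
  sum_f_R0 (eta_term t p) (S (2 * K)) =
  sqrt 2 * (/ 2 * mellin_int t (t * ln 2 + p) (/ 2 * a) b + t * mellin_int t (t * ln 2 + p - PI / 2) (/ 2 * a) b) -
  (/ 2 * mellin_int t p a (2 * b) + t * mellin_int t (p - PI / 2) a (2 * b)).
Proof.
intros a b.
assert (Hb : 1 <= b) by (unfold b; rewrite S_INR; pose proof (pos_INR K); lra).
assert (Ha : 0 < a) by (apply Rinv_0_lt_compat; fold b; lra).
assert (Ha' : a <= 1) by (rewrite <- Rinv_1; apply Rinv_le_contravar; fold b; lra).
rewrite eta_partial_sum.
assert (Hex : forall a b, 0 < a -> a <= b -> ex_RInt (fun x => parity x * eta_kernel t p x) a b).
{ intros; apply PC_ex_RInt; auto; apply PC_parity_kernel. }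
replace (2 * INR K + 2) with (2 * b) by (unfold b; rewrite S_INR; ring).
(* [parity] vanishes on [[0, 1)], so the lower limit may be moved down to [a]; after this the two
   dilates can be separated into Mellin integrals that have limits. *)
transitivity (RInt (fun x => parity x * eta_kernel t p x) a (2 * b)).
{ rewrite <- (RInt_ChaslesR _ a 1 (2 * b)) by (apply Hex; lra).
  rewrite (RInt_extR _ (fun _ => 0) a 1); [|lra|].
  2:{ intros x Hx; rewrite parity_small by lra; ring. }
  rewrite RInt_constR; rring. }
rewrite (RInt_extR _ (fun x => 2 * (frac_part (/ 2 * x) * eta_kernel t p x) - frac_part x * eta_kernel t p x)); [|lra|].
2:{ intros x _; unfold parity; ring. }
rewrite RInt_minusR.
2:{ apply PC_ex_RInt; try lra; apply PC_mult; [apply PC_const|apply PC_half_kernel]. }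
2:{ apply PC_ex_RInt; try lra; apply PC_frac_kernel. }
rewrite half_kernel_mellin, !frac_kernel_mellin by lra.
replace (/ 2 * (2 * b)) with b by field; reflexivity.
Qed.

Lemma Un_cv_even_odd (u : nat -> R) (l : R) :
  is_lim_seq (fun n => sum_f_R0 u (S (2 * n))) l -> is_lim_seq u 0 ->
  Un_cv (fun n => sum_f_R0 u n) l.
Proof.
intros H1 H2 eps He.
destruct (proj1 (is_lim_seq_eps _ _) H1 (eps / 2) ltac:(lra)) as [N1 HN1].
destruct (proj1 (is_lim_seq_eps _ _) H2 (eps / 2) ltac:(lra)) as [N2 HN2].
exists (2 * N1 + N2 + 2)%nat; intros n Hn; unfold R_dist.
destruct (Nat.Even_or_Odd n) as [[m Hm]|[m Hm]].
- assert (Hm' : n = S (S (2 * (m - 1)))) by lia.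
  rewrite Hm', tech5.
  specialize (HN1 (m - 1)%nat ltac:(lia)); specialize (HN2 (S (S (2 * (m - 1)))) ltac:(lia)).
  rewrite Rminus_0_r in HN2.
  replace (_ + _ - _) with ((sum_f_R0 u (S (2 * (m - 1))) - l) + u (S (S (2 * (m - 1))))) by ring.
  eapply Rle_lt_trans; [apply Rabs_triang|].
  lra.
- replace n with (S (2 * m)) by lia.
  specialize (HN1 m ltac:(lia)); lra.
Qed.

Lemma mellin_lim_gen t p (a b : nat -> R) : (forall n, 0 < a n <= 1) -> (forall n, 1 <= b n) ->
  is_lim_seq a 0 -> is_lim_seq b p_infty -> is_lim_seq (fun n => mellin_int t p (a n) (b n)) (mellin t p).
Proof.
intros Ha Hb Hla Hlb.
assert (H0 : is_lim_seq (fun n => 2 * sqrt (a n) + 2 / sqrt (b n)) 0).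
{ replace (Finite 0) with (Finite (2 * sqrt 0 + 2 * sqrt 0)) by (rewrite sqrt_0; f_equal; ring).
  apply (is_lim_seq_plus' (fun n => 2 * sqrt (a n)) (fun n => 2 / sqrt (b n))).
  - apply (is_lim_seq_scal_l (fun n => sqrt (a n)) 2 (sqrt 0)).
    apply (is_lim_seq_continuous sqrt); [apply continuity_pt_sqrt; lra|easy].
  - apply (is_lim_seq_ext (fun n => 2 * sqrt (/ b n))).
    { intros n; rewrite sqrt_inv; reflexivity. }
    apply (is_lim_seq_scal_l (fun n => sqrt (/ b n)) 2 (sqrt 0)).
    apply (is_lim_seq_continuous sqrt); [apply continuity_pt_sqrt; lra|].
    apply (is_lim_seq_inv b p_infty); easy. }
apply is_lim_seq_eps; intros eps Heps; destruct (proj1 (is_lim_seq_eps _ _) H0 eps Heps) as [N HN].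
exists N; intros n Hn; specialize (HN n Hn); rewrite Rminus_0_r in HN.
eapply Rle_lt_trans; [now apply mellin_spec|]; eapply Rle_lt_trans; [apply Rle_abs|]; easy.
Qed.

Lemma eta_cv t p : Un_cv (fun N => sum_f_R0 (eta_term t p) N) (eta_limit t p).
Proof.
assert (HS : forall K, 1 <= INR (S K)) by (intros; rewrite S_INR; pose proof (pos_INR K); lra).
assert (HS' : forall K, 0 < / INR (S K) <= 1).
{ intros K; specialize (HS K); split; [apply Rinv_0_lt_compat; lra|rewrite <- Rinv_1; apply Rinv_le_contravar; lra]. }
assert (HI : is_lim_seq (fun n => INR (S n)) p_infty) by (apply (is_lim_seq_incr_1 INR); apply is_lim_seq_INR).
assert (HI' : is_lim_seq (fun n => / INR (S n)) 0) by (apply (is_lim_seq_inv _ p_infty); easy).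
apply Un_cv_even_odd.
- apply (is_lim_seq_ext _ _ _ (fun K => eq_sym (eta_partial_sum_mellin t p K))); cbv zeta.
  assert (L : forall q s, is_lim_seq (fun K => / 2 * mellin_int t q (/ 2 * / INR (S K)) (INR (S K)) +
      s * mellin_int t (q - PI / 2) (/ 2 * / INR (S K)) (INR (S K)))
      (/ 2 * mellin t q + s * mellin t (q - PI / 2))).
  { intros q s; apply is_lim_seq_plus'.
    - apply (is_lim_seq_scal_l (fun K => mellin_int t q (/ 2 * / INR (S K)) (INR (S K))) (/ 2) (mellin t q)).
      apply mellin_lim_gen; auto; [intros n; specialize (HS' n); lra|].
      replace (Finite 0) with (Rbar_mult (/ 2) 0) by (simpl; f_equal; ring); now apply is_lim_seq_scal_l.
    - apply (is_lim_seq_scal_l (fun K => mellin_int t (q - PI / 2) (/ 2 * / INR (S K)) (INR (S K))) s (mellin t (q - PI / 2))).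
      apply mellin_lim_gen; auto; [intros n; specialize (HS' n); lra|].
      replace (Finite 0) with (Rbar_mult (/ 2) 0) by (simpl; f_equal; ring); now apply is_lim_seq_scal_l. }
  assert (L' : forall q s, is_lim_seq (fun K => / 2 * mellin_int t q (/ INR (S K)) (2 * INR (S K)) +
      s * mellin_int t (q - PI / 2) (/ INR (S K)) (2 * INR (S K)))
      (/ 2 * mellin t q + s * mellin t (q - PI / 2))).
  { assert (H2 : is_lim_seq (fun n => 2 * INR (S n)) p_infty).
    { apply (is_lim_seq_le_p_loc (fun n => INR (S n))); [exists 0%nat; intros n _; specialize (HS n); lra|easy]. }
    assert (H2' : forall n, 1 <= 2 * INR (S n)) by (intros n; specialize (HS n); lra).
    intros q s; apply is_lim_seq_plus'.
    - apply (is_lim_seq_scal_l (fun K => mellin_int t q (/ INR (S K)) (2 * INR (S K))) (/ 2) (mellin t q)).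
      now apply mellin_lim_gen.
    - apply (is_lim_seq_scal_l (fun K => mellin_int t (q - PI / 2) (/ INR (S K)) (2 * INR (S K))) s (mellin t (q - PI / 2))).
      now apply mellin_lim_gen. }
  apply is_lim_seq_minus'; [|apply L'].
  apply (is_lim_seq_scal_l _ (sqrt 2) (Finite _)); apply L.
- apply is_lim_seq_eps; intros eps Heps.
  destruct (inv_sqrt_small eps) as (X & HX & He); [easy|].
  destruct (INR_unbounded X) as [N HN]; exists N; intros n Hn.
  apply le_INR in Hn; rewrite Rminus_0_r.
  unfold eta_term; unfold Rdiv; rewrite !Rabs_mult, pow_1_abs.
  assert (H1 : X <= INR (S n)) by (rewrite S_INR; lra).
  assert (0 < sqrt X) by (apply sqrt_lt_R0; lra).
  assert (sqrt X <= sqrt (INR (S n))) by (apply sqrt_le_1; lra).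
  assert (0 < / sqrt (INR (S n))) by (apply Rinv_0_lt_compat; lra).
  assert (/ sqrt (INR (S n)) <= / sqrt X) by (apply Rinv_le_contravar; lra).
  rewrite (Rabs_pos_eq (/ _)) by lra.
  assert (Rabs (cos (t * ln (INR (S n)) + p)) <= 1) by (apply Rabs_le, COS_bound).
  pose proof (Rabs_pos (cos (t * ln (INR (S n)) + p))).
  unfold Rdiv in He; nra.
Qed.

Lemma seq_lim_eq u l : Un_cv u l -> seq_lim u = l.
Proof.
intros H; apply (UL_sequence u); [|easy].
exact (epsilon_spec (inhabits 0) (fun l => Un_cv u l) (ex_intro _ l H)).
Qed.

Lemma Un_cv_extR (u v : nat -> R) l : (forall n, u n = v n) -> Un_cv u l -> Un_cv v l.
Proof.
intros E H eps He; destruct (H eps He) as [N HN]; exists N; intros n Hn; rewrite <- E; auto.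
Qed.

Lemma eta_re_eq t : eta_re t = eta_limit t 0.
Proof.
apply seq_lim_eq; apply (Un_cv_extR (fun N => sum_f_R0 (eta_term t 0) N)); [|apply eta_cv].
intros n; apply sum_eq; intros i _; unfold eta_term; now rewrite Rplus_0_r.
Qed.

Lemma eta_im_eq t : eta_im t = eta_limit t (PI / 2).
Proof.
apply seq_lim_eq; apply (Un_cv_extR (fun N => sum_f_R0 (eta_term t (PI / 2)) N)); [|apply eta_cv].
intros n; apply sum_eq; intros i _; unfold eta_term; rewrite cos_plus, cos_PI2, sin_PI2; ring.
Qed.

Definition mellin_sq t := mellin t 0 ^ 2 + mellin t (PI / 2) ^ 2.

Lemma sqrt2_bound : sqrt 2 < 3 / 2.
Proof. apply Rsqr_incrst_0; try lra; [rewrite Rsqr_sqrt by lra; unfold Rsqr; lra|apply sqrt_pos]. Qed.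

(** Squared moduli in [eta(s) = (1 - 2^(1-s)) zeta(s)] and [zeta(s) = - s M]: the factor
    [|1 - 2^(1-s)|^2] is the denominator of [Z2], and [|s|^2 = 1/4 + t^2]. *)
Lemma Z2_mellin t : Z2 t = (/ 4 + t ^ 2) * mellin_sq t.
Proof.
unfold Z2; rewrite eta_re_eq, eta_im_eq.
assert (Hp : 0 < 3 - 2 * sqrt 2 * cos (t * ln 2)).
{ destruct (COS_bound (t * ln 2)); pose proof sqrt2_bound; pose proof (sqrt_pos 2); nra. }
apply (Rmult_eq_reg_r (3 - 2 * sqrt 2 * cos (t * ln 2))); [|lra].
unfold Rdiv; rewrite Rmult_assoc, Rinv_l, Rmult_1_r by lra.
unfold eta_limit, mellin_sq.
assert (E0 : forall q, mellin t (q - PI / 2) = sin q * mellin t 0 - cos q * mellin t (PI / 2)).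
{ intros q; rewrite (mellin_phase t (q - PI / 2)), cos_minus, sin_minus, cos_PI2, sin_PI2; ring. }
change (PI * / 2) with (PI / 2); rewrite !E0, (mellin_phase t (t * ln 2 + 0)), (mellin_phase t (t * ln 2 + PI / 2)), !Rplus_0_r.
rewrite cos_plus, sin_plus, cos_PI2, sin_PI2, cos_0, sin_0.
assert (E1 : sin (t * ln 2) ^ 2 = 1 - cos (t * ln 2) ^ 2)
 by (pose proof (sin2_cos2 (t * ln 2)) as E; unfold Rsqr in E; lra).
assert (E2 : sqrt 2 ^ 2 = 2) by (simpl; rewrite Rmult_1_r, sqrt_sqrt; lra).
generalize dependent (cos (t * ln 2)); generalize dependent (sin (t * ln 2)).
generalize dependent (sqrt 2); generalize (mellin t 0), (mellin t (PI / 2)).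
intros x y w Ew s c _ Es.
(* With [w = sqrt 2] and [c + i s] the unit number of argument [t ln 2], the first factor is
   [|w (c - i s) - 1|^2]. *)
transitivity ((w ^ 2 * (s ^ 2 + c ^ 2) + 1 - 2 * w * c) * (/ 4 + t ^ 2) * (x ^ 2 + y ^ 2)); [field|].
rewrite Ew, Es; ring.
Qed.

Lemma continuous_mellin_sq t : continuous mellin_sq t.
Proof.
unfold mellin_sq; apply (continuous_plus (fun t => mellin t 0 ^ 2) (fun t => mellin t (PI / 2) ^ 2));
 simpl; repeat (apply (continuous_mult (K := R_AbsRing)); [apply continuous_mellin|]); apply continuous_const.
Qed.

Lemma mellin_sq_ge0 t : 0 <= mellin_sq t.
Proof. unfold mellin_sq; apply Rplus_le_le_0_compat; apply pow2_ge_0. Qed.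

Lemma continuous_Z2 t : continuous Z2 t.
Proof.
apply (continuous_ext (fun t => (/ 4 + t ^ 2) * mellin_sq t)).
- intros; now rewrite Z2_mellin.
- apply (continuous_mult (fun t => / 4 + t ^ 2) mellin_sq); [|apply continuous_mellin_sq].
  auto_cont; auto.
Qed.

Lemma Z2_ge0 t : 0 <= Z2 t.
Proof. rewrite Z2_mellin; apply Rmult_le_pos; [nra|apply mellin_sq_ge0]. Qed.

(** * Oscillation of dilated fractional parts *)

Lemma mvt_bound (f df : R -> R) a b K : a <= b ->
  (forall x, a <= x <= b -> is_derive f x (df x)) ->
  (forall x, a <= x <= b -> Rabs (df x) <= K) -> Rabs (f b - f a) <= K * (b - a).
Proof.
intros Hab H1 H2.
destruct (MVT_gen f a b df) as (c & Hc & E).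
- intros x; rewrite Rmin_left, Rmax_right by easy; intros; apply H1; lra.
- intros x; rewrite Rmin_left, Rmax_right by easy; intros.
  apply continuity_pt_filterlim, continuous_of_ex_derive; exists (df x); now apply H1.
- rewrite Rmin_left, Rmax_right in Hc by easy.
  rewrite E, Rabs_mult, (Rabs_pos_eq (b - a)) by lra.
  apply Rmult_le_compat_r; [lra|now apply H2].
Qed.

Lemma cos_Lipschitz a b : Rabs (cos a - cos b) <= Rabs (a - b).
Proof.
assert (H : forall x y, x <= y -> Rabs (cos y - cos x) <= 1 * (y - x)).
{ intros x y Hxy; apply (mvt_bound cos (fun x => - sin x)); auto.
  - intros; auto_derive; auto; ring.
  - intros; rewrite Rabs_Ropp; apply Rabs_le, SIN_bound. }
destruct (Rle_dec a b) as [Hab|Hab].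
- specialize (H a b Hab); rewrite Rabs_minus_sym, (Rabs_minus_sym a), (Rabs_pos_eq (b - a)) by lra; lra.
- specialize (H b a ltac:(lra)); rewrite (Rabs_pos_eq (a - b)) by lra; lra.
Qed.

Lemma continuous_RInt_PC f a x : PC f -> 0 < a -> 0 < x -> continuous (fun x => RInt f a x) x.
Proof.
intros Hf Ha Hx; apply (continuous_RInt_1 f a x).
exists (mkposreal x Hx); intros y Hy.
assert (Hy0 : 0 < y).
{ change (Rabs (y - x) < x) in Hy; apply Rabs_def2 in Hy; lra. }
apply (RInt_correct (V := R_CompleteNormedModule)).
destruct (Rle_dec a y); [now apply PC_ex_RInt|apply ex_RInt_swap, PC_ex_RInt; auto; lra].
Qed.

(** Product rule: the oscillation of [f] is weighted by the bound of [h], the bound of [f] by the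
    Lipschitz constant of [h]. *)
Lemma osc_bound_mult (f : R -> R -> R) (h : R -> R) a b c d K M B L : a <= b -> 0 <= M -> 0 <= B ->
  osc_bound f a b c d K ->
  (forall u t, a <= u <= b -> c <= t <= d -> Rabs (f u t) <= M) ->
  (forall t, c <= t <= d -> Rabs (h t) <= B) ->
  (forall s t, c <= s <= t -> t <= d -> Rabs (h t - h s) <= L * (t - s)) -> 0 <= L ->
  osc_bound (fun u t => f u t * h t) a b c d (B * K + (b - a) * M * L).
Proof.
intros Hab HM HB Hf HfM HhB HhL HL t1 t2 H1 H2.
destruct (Hf t1 t2 H1 H2) as (w & Hw1 & Hw2 & Hw3).
exists (fun u => B * w u + M * (L * (t2 - t1))); split; [|split].
- apply ex_RInt_plusR; [now apply ex_RInt_scalR|apply ex_RInt_const].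
- rewrite RInt_plusR by (try apply ex_RInt_const; now apply ex_RInt_scalR).
  rewrite RInt_scalR, RInt_constR by easy.
  apply (Rmult_le_compat_l B) in Hw2; [|easy].
  replace ((B * K + (b - a) * M * L) * (t2 - t1)) with (B * (K * (t2 - t1)) + (b - a) * (M * (L * (t2 - t1)))) by ring.
  lra.
- intros u s Hu Hs.
  replace (f u s * h s - f u t1 * h t1) with ((f u s - f u t1) * h s + f u t1 * (h s - h t1)) by ring.
  eapply Rle_trans; [apply Rabs_triang|]; rewrite !Rabs_mult; apply Rplus_le_compat.
  + rewrite Rmult_comm; apply Rmult_le_compat; try apply Rabs_pos; [apply HhB; lra|now apply Hw3].
  + apply Rmult_le_compat; try apply Rabs_pos; [apply HfM; lra|].
    eapply Rle_trans; [apply HhL; lra|apply Rmult_le_compat_l; lra].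
Qed.

Lemma RInt_frac_scale t a b : 0 < t -> 0 < a -> a <= b ->
  t * RInt (fun u => frac_part (t * u)) a b = RInt frac_part (t * a) (t * b).
Proof.
intros Ht Ha Hab.
rewrite <- RInt_scalR by (apply PC_ex_RInt; auto; apply (PC_scale frac_part); auto; apply PC_frac).
rewrite <- (Rplus_0_r (t * a)), <- (Rplus_0_r (t * b)).
rewrite <- (RInt_comp_lin frac_part t 0 a b).
- apply RInt_extR; auto; intros; rewrite Rplus_0_r; reflexivity.
- rewrite !Rplus_0_r; apply PC_ex_RInt; [apply PC_frac|now apply Rmult_lt_0_compat|].
  apply Rmult_le_compat_l; lra.
Qed.

(** Pointwise the two fractional parts may differ by almost 1. After scaling, their integrals run
    over [[t1 a, t1 b]] and [[t2 a, t2 b]], which differ only near the ends, by lengths proportional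
    to [t2 - t1]. *)
Lemma RInt_frac_shift t1 t2 a b : 0 < a -> a <= b -> 0 < t1 -> t1 <= t2 ->
  RInt (fun u => frac_part (t1 * u) - frac_part (t2 * u)) a b <= 2 * b / t1 * (t2 - t1).
Proof.
intros Ha Hab H1 H2.
assert (Hex : forall t, 0 < t -> ex_RInt (fun u => frac_part (t * u)) a b).
{ intros; apply PC_ex_RInt; auto; apply (PC_scale frac_part); auto; apply PC_frac. }
assert (Hf : forall x y, 0 < x -> x <= y -> ex_RInt frac_part x y) by (intros; apply PC_ex_RInt; auto; apply PC_frac).
assert (Hf1 : forall x y, 0 < x -> x <= y -> 0 <= RInt frac_part x y <= y - x).
{ intros x y Hx Hxy; split.
  - apply RInt_ge_0; auto; intros; apply frac_bounds.
  - replace (y - x) with (RInt (fun _ => 1) x y) by (rewrite RInt_constR; apply Rmult_1_r).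
    apply RInt_le; auto; [apply ex_RInt_const|]; intros z _; pose proof (frac_bounds z); lra. }
rewrite RInt_minusR by (apply Hex; lra).
assert (E1 := RInt_frac_scale t1 a b H1 Ha Hab).
assert (E2 := RInt_frac_scale t2 a b ltac:(lra) Ha Hab).
assert (B2 : 0 <= RInt (fun u => frac_part (t2 * u)) a b <= b - a).
{ split.
  - apply RInt_ge_0; auto; [apply Hex; lra|]; intros; apply frac_bounds.
  - replace (b - a) with (RInt (fun _ => 1) a b) by (rewrite RInt_constR; apply Rmult_1_r).
    apply RInt_le; auto; [apply Hex; lra|apply ex_RInt_const|]; intros z _; pose proof (frac_bounds (t2 * z)); lra. }
assert (A1 : 0 < t1 * a) by now apply Rmult_lt_0_compat.
assert (A2 : t1 * a <= t2 * a) by (apply Rmult_le_compat_r; lra).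
assert (A3 : t1 * b <= t2 * b) by (apply Rmult_le_compat_r; lra).
assert (A4 : t2 * a <= t2 * b) by (apply Rmult_le_compat_l; lra).
assert (A5 : t1 * a <= t1 * b) by (apply Rmult_le_compat_l; lra).
assert (E3 : RInt frac_part (t1 * a) (t1 * b) - RInt frac_part (t2 * a) (t2 * b) <= (t2 - t1) * a).
{ assert (C1 : RInt frac_part (t1 * a) (t2 * a) + RInt frac_part (t2 * a) (t2 * b) =
               RInt frac_part (t1 * a) (t1 * b) + RInt frac_part (t1 * b) (t2 * b)).
  { rewrite !RInt_ChaslesR; auto; apply Hf; lra. }
  destruct (Hf1 (t1 * a) (t2 * a)); auto; destruct (Hf1 (t1 * b) (t2 * b)); auto; lra. }
revert E1 E2 B2 E3; rint_atoms; intros E1 E2 B2 E3.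
apply (Rmult_le_reg_l t1); [easy|].
replace (t1 * (2 * b / t1 * (t2 - t1))) with (2 * b * (t2 - t1)) by (field; lra).
nra.
Qed.

(** * The multiplicative autocorrelation of the fractional part *)

Definition frac_weight x := frac_part x * / x ^ 2.

Lemma continuous_inv_sq x : 0 < x -> continuous (fun x => / x ^ 2) x.
Proof.
intros Hx; auto_cont; repeat split.
apply Rgt_not_eq; nra.
Qed.

Lemma PC_frac_weight : PC frac_weight.
Proof. apply PC_mult; [apply PC_frac|apply PC_cont, continuous_inv_sq]. Qed.

Lemma PC_frac_scale l : 0 < l -> PC (fun x => frac_part (l * x)).
Proof. intros; apply (PC_scale frac_part); auto; apply PC_frac. Qed.

Definition frac_corr N l : R := RInt (fun x => frac_weight x * frac_part (l * x)) (/ N) N.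

Lemma frac_weight_bound N x : 1 <= N -> / N <= x -> 0 <= frac_weight x <= N ^ 2.
Proof.
intros HN Hx; unfold frac_weight.
assert (0 < / N) by (apply Rinv_0_lt_compat; lra).
assert (H1 : 0 < / x ^ 2) by (apply Rinv_0_lt_compat; nra).
assert (H2 : / x ^ 2 <= N ^ 2).
{ replace (N ^ 2) with (/ (/ N) ^ 2) by (field; lra); apply Rinv_le_contravar; [nra|apply pow_incr; lra]. }
pose proof (frac_bounds x); nra.
Qed.

Lemma frac_sub_le y z : y <= z -> frac_part z - frac_part y <= z - y.
Proof.
intros Hyz.
rewrite (Rplus_Int_part_frac_part y) at 2; rewrite (Rplus_Int_part_frac_part z) at 2.
assert (IZR (Int_part y) <= IZR (Int_part z)).
{ apply IZR_le; destruct (base_Int_part y), (base_Int_part z).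
  apply Z.lt_succ_r, lt_IZR; rewrite succ_IZR; lra. }
lra.
Qed.

(** A fractional part rises with slope at most 1 and falls only by jumps. Hence for [s] in
    [[t1, t2]] the deviation of [{s x}] from [{t1 x}] is at most [2 N (t2 - t1) + {t1 x} - {t2 x}],
    and the last difference is small in the mean over [x]. *)
Lemma frac_corr_osc N c d : 1 <= N -> 0 < c ->
  exists K, 0 <= K /\ osc_bound (fun x l => frac_weight x * frac_part (l * x)) (/ N) N c d K.
Proof.
intros HN Hc.
assert (HN0 : 0 < / N) by (apply Rinv_0_lt_compat; lra).
assert (HN1 : / N <= 1) by (rewrite <- Rinv_1; apply Rinv_le_contravar; lra).
assert (HN2 : 0 <= N ^ 2) by nra.
assert (HcI : 0 < / c) by now apply Rinv_0_lt_compat.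
exists (N ^ 2 * (2 * N * N + 2 * N * / c)); split.
{ apply Rmult_le_pos; [easy|]; nra. }
intros t1 t2 H1 H2.
exists (fun x => N ^ 2 * (2 * N * (t2 - t1) + (frac_part (t1 * x) - frac_part (t2 * x)))).
assert (Hex : ex_RInt (fun x => frac_part (t1 * x) - frac_part (t2 * x)) (/ N) N).
{ apply PC_ex_RInt; [|easy|lra]; apply PC_minus; apply PC_frac_scale; lra. }
split; [|split].
- apply ex_RInt_scalR, ex_RInt_plusR; [apply ex_RInt_const|easy].
- rewrite RInt_scalR, RInt_plusR, RInt_constR; auto; try apply ex_RInt_const.
  2:{ apply ex_RInt_plusR; [apply ex_RInt_const|easy]. }
  assert (B := RInt_frac_shift t1 t2 (/ N) N HN0 ltac:(lra) ltac:(lra) ltac:(lra)).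
  rewrite (Rmult_assoc (N ^ 2)); apply Rmult_le_compat_l; [easy|].
  assert (2 * N / t1 * (t2 - t1) <= 2 * N * / c * (t2 - t1)).
  { apply Rmult_le_compat_r; [lra|]; apply Rmult_le_compat_l; [lra|].
    apply Rinv_le_contravar; lra. }
  assert ((N - / N) * (2 * N * (t2 - t1)) <= N * (2 * N * (t2 - t1))).
  { apply Rmult_le_compat_r; [|lra]; apply Rmult_le_pos; lra. }
  lra.
- intros x s Hx Hs.
  destruct (frac_weight_bound N x HN ltac:(lra)) as [Hq1 Hq2].
  rewrite <- Rmult_minus_distr_l, Rabs_mult, Rabs_pos_eq by easy.
  assert (B1 := frac_sub_le (t1 * x) (s * x) ltac:(apply Rmult_le_compat_r; lra)).
  assert (B2 := frac_sub_le (s * x) (t2 * x) ltac:(apply Rmult_le_compat_r; lra)).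
  assert (B3 : (t2 - t1) * x <= N * (t2 - t1)) by (rewrite Rmult_comm; apply Rmult_le_compat_r; lra).
  assert (B4 : 0 <= (t2 - t1) * x) by (apply Rmult_le_pos; lra).
  assert (B5 : (s - t1) * x <= (t2 - t1) * x) by (apply Rmult_le_compat_r; lra).
  assert (B6 : 0 <= (s - t1) * x) by (apply Rmult_le_pos; lra).
  assert (B7 : Rabs (frac_part (s * x) - frac_part (t1 * x)) <=
    2 * N * (t2 - t1) + (frac_part (t1 * x) - frac_part (t2 * x))) by (apply Rabs_le; lra).
  apply Rmult_le_compat; try easy; apply Rabs_pos.
Qed.

Lemma PC_frac_corr_integrand l : 0 < l -> PC (fun x => frac_weight x * frac_part (l * x)).
Proof. intros; apply PC_mult; [apply PC_frac_weight|now apply PC_frac_scale]. Qed.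

Lemma ex_frac_corr N l : 1 <= N -> 0 < l -> ex_RInt (fun x => frac_weight x * frac_part (l * x)) (/ N) N.
Proof.
intros HN Hl; apply PC_ex_RInt; [now apply PC_frac_corr_integrand|apply Rinv_0_lt_compat; lra|].
apply Rle_trans with 1; [rewrite <- Rinv_1; apply Rinv_le_contravar; lra|easy].
Qed.

Lemma continuous_of_Lipschitz (f : R -> R) x d K : 0 < d ->
  (forall y z, x - d <= y <= z -> z <= x + d -> Rabs (f z - f y) <= K * (z - y)) -> continuous f x.
Proof.
intros Hd H; apply continuity_pt_filterlim; intros e He.
assert (HK : 0 < Rabs K + 1) by (pose proof (Rabs_pos K); lra).
exists (Rmin d (e / (Rabs K + 1))); split; [apply Rmin_pos; [easy|now apply Rdiv_lt_0_compat]|].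
intros y [_ Hy]; simpl in *; unfold R_dist in *.
assert (Hy1 := Rlt_le_trans _ _ _ Hy (Rmin_l _ _)); assert (Hy2 := Rlt_le_trans _ _ _ Hy (Rmin_r _ _)).
assert (B : Rabs (f y - f x) <= K * Rabs (y - x)).
{ apply Rabs_def2 in Hy1; destruct (Rle_dec x y).
  - rewrite (Rabs_pos_eq (y - x)) by lra; apply H; lra.
  - rewrite Rabs_minus_sym, (Rabs_minus_sym y), (Rabs_pos_eq (x - y)) by lra; apply H; lra. }
apply (Rmult_lt_compat_l (Rabs K + 1)) in Hy2; [|easy].
replace ((Rabs K + 1) * (e / (Rabs K + 1))) with e in Hy2 by (field; lra).
pose proof (Rabs_pos (y - x)); pose proof (Rle_abs K); nra.
Qed.

Lemma continuous_frac_corr N l : 1 <= N -> 0 < l -> continuous (frac_corr N) l.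
Proof.
intros HN Hl.
destruct (frac_corr_osc N (l - l / 2) (l + l / 2) HN) as (K & HK & Ho); [lra|].
assert (/ N <= N).
{ apply Rle_trans with 1; [rewrite <- Rinv_1; apply Rinv_le_contravar; lra|easy]. }
apply (continuous_of_Lipschitz _ l (l / 2) K); [lra|].
apply osc_bound_ex_RInt; auto; [lra|]; intros; apply ex_frac_corr; lra.
Qed.

Definition mellin_kernel t l := / (l * sqrt l) * cos (t * ln l).

Lemma continuous_mellin_kernel t l : 0 < l -> continuous (mellin_kernel t) l.
Proof.
intros Hl; unfold mellin_kernel; sqrt_facts l Hl; auto_cont; repeat split; try lra.
apply Rgt_not_eq, Rmult_lt_0_compat; lra.
Qed.

Lemma mellin_kernel_bound t c l : 0 < c -> c <= l -> Rabs (mellin_kernel t l) <= / (c * sqrt c).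
Proof.
intros Hc Hl; unfold mellin_kernel; rewrite Rabs_mult.
rewrite Rabs_pos_eq by (apply Rlt_le, inv32_pos; lra).
assert (Rabs (cos (t * ln l)) <= 1) by (apply Rabs_le, COS_bound).
assert (/ (l * sqrt l) <= / (c * sqrt c)).
{ sqrt_facts c Hc; apply Rinv_le_contravar; [now apply Rmult_lt_0_compat|].
  apply Rmult_le_compat; try lra; apply sqrt_le_1; lra. }
pose proof (inv32_pos l ltac:(lra)); pose proof (Rabs_pos (cos (t * ln l))); nra.
Qed.

Lemma mellin_kernel_Lipschitz t c d : 0 < c -> exists L, 0 <= L /\
  forall x y, c <= x <= y -> y <= d -> Rabs (mellin_kernel t y - mellin_kernel t x) <= L * (y - x).
Proof.
intros Hc; sqrt_facts c Hc.
assert (Hp : 0 < / (c * (c * sqrt c))) by (apply Rinv_0_lt_compat; repeat apply Rmult_lt_0_compat; lra).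
exists (/ (c * (c * sqrt c)) * (3 / 2 + Rabs t)); split.
{ apply Rmult_le_pos; [lra|]; pose proof (Rabs_pos t); lra. }
intros x y Hx Hy.
apply (mvt_bound _ (fun l => - / (l * (l * sqrt l)) * (3 / 2 * cos (t * ln l) + t * sin (t * ln l)))); [lra| |].
- intros l Hl; assert (Hl0 : 0 < l) by lra; unfold mellin_kernel.
  pose proof (sqrt_lt_R0 l Hl0); pose proof (sqrt_sqrt l (Rlt_le _ _ Hl0)).
  auto_derive; [repeat split; try lra; apply Rgt_not_eq, Rmult_lt_0_compat; lra|].
  generalize (cos (t * ln l)), (sin (t * ln l)); intros; sqrt_elim l; field; easy.
- intros l Hl; rewrite Rabs_mult, Rabs_Ropp.
  assert (Hl0 : 0 < l) by lra; sqrt_facts l Hl0.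
  rewrite Rabs_pos_eq by (apply Rlt_le, Rinv_0_lt_compat; repeat apply Rmult_lt_0_compat; lra).
  apply Rmult_le_compat.
  + apply Rlt_le, Rinv_0_lt_compat; repeat apply Rmult_lt_0_compat; lra.
  + apply Rabs_pos.
  + apply Rinv_le_contravar; [repeat apply Rmult_lt_0_compat; lra|].
    assert (sqrt c <= sqrt l) by (apply sqrt_le_1; lra).
    repeat apply Rmult_le_compat; try lra; apply Rmult_le_pos; lra.
  + eapply Rle_trans; [apply Rabs_triang|]; rewrite !Rabs_mult.
    rewrite (Rabs_pos_eq (3 / 2)) by lra.
    assert (Rabs (cos (t * ln l)) <= 1) by (apply Rabs_le, COS_bound).
    assert (Rabs (sin (t * ln l)) <= 1) by (apply Rabs_le, SIN_bound).
    pose proof (Rabs_pos t); pose proof (Rabs_pos (cos (t * ln l))); pose proof (Rabs_pos (sin (t * ln l))); nra.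
Qed.

(** The substitution [y = l x] turns the dilation by [x] into the phase [- t ln x]. *)
Lemma RInt_kernel_frac t x a b : 0 < x -> 0 < a -> a <= b ->
  RInt (fun l => frac_part (l * x) * mellin_kernel t l) a b =
  sqrt x * mellin_int t (- (t * ln x)) (x * a) (x * b).
Proof.
intros Hx Ha Hab; unfold mellin_int.
assert (0 < x * a) by now apply Rmult_lt_0_compat.
assert (x * a <= x * b) by (apply Rmult_le_compat_l; lra).
rewrite <- RInt_scalR by now apply ex_mellin_frac.
rewrite <- (Rplus_0_r (x * a)), <- (Rplus_0_r (x * b)).
rewrite <- (RInt_comp_lin (fun y => sqrt x * mellin_frac t (- (t * ln x)) y) x 0 a b).
2:{ rewrite !Rplus_0_r; now apply ex_RInt_scalR, ex_mellin_frac. }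
apply RInt_extR; [easy|]; intros l Hl; assert (Hl0 : 0 < l) by lra.
change (scal x ?z) with (x * z); rewrite Rplus_0_r; unfold mellin_frac, mellin_kernel.
rewrite ln_mult, sqrt_mult by lra.
replace (t * (ln x + ln l) + - (t * ln x)) with (t * ln l) by ring.
rewrite (Rmult_comm l x).
generalize (frac_part (x * l)), (cos (t * ln l)); intros.
sqrt_facts x Hx; sqrt_facts l Hl0; field; repeat split; lra.
Qed.

Lemma ex_kernel_frac t x a b : 0 < x -> 0 < a -> a <= b ->
  ex_RInt (fun l => frac_part (l * x) * mellin_kernel t l) a b.
Proof.
intros Hx Ha Hab; apply PC_ex_RInt; auto; apply PC_mult.
- apply (PC_ext (fun l => frac_part (x * l))); [intros; now rewrite Rmult_comm|now apply PC_frac_scale].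
- apply PC_cont; intros; now apply continuous_mellin_kernel.
Qed.

Lemma mellin_int_phase t p a b : 0 < a -> a <= b ->
  mellin_int t p a b = cos p * mellin_int t 0 a b + sin p * mellin_int t (PI / 2) a b.
Proof.
intros Ha Hab; unfold mellin_int.
rewrite <- RInt_lin2 by now apply ex_mellin_frac.
apply RInt_extR; [lra|]; intros x _; unfold mellin_frac.
rewrite Rplus_0_r, !cos_plus, sin_PI2, cos_PI2; ring.
Qed.

Lemma continuous_mellin_int_scale t p a b x : 0 < a -> a <= b -> 0 < x ->
  continuous (fun x => mellin_int t p (x * a) (x * b)) x.
Proof.
intros Ha Hab Hx.
assert (Hex : forall y z, 0 < y -> 0 < z -> ex_RInt (mellin_frac t p) y z).
{ intros y z Hy Hz; destruct (Rle_dec y z); [now apply ex_mellin_frac|].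
  apply ex_RInt_swap, ex_mellin_frac; lra. }
assert (HC : forall c, 0 < c -> continuous (fun x => RInt (mellin_frac t p) 1 (x * c)) x).
{ intros c Hc; apply (continuous_comp (fun x => x * c) (fun y => RInt (mellin_frac t p) 1 y)).
  - auto_cont; auto.
  - apply continuous_RInt_PC; [apply PC_mellin_frac|lra|now apply Rmult_lt_0_compat]. }
assert (HD : continuous (fun x => RInt (mellin_frac t p) 1 (x * b) - RInt (mellin_frac t p) 1 (x * a)) x)
 by (apply (continuous_minus (fun x => RInt (mellin_frac t p) 1 (x * b)) (fun x => RInt (mellin_frac t p) 1 (x * a))); apply HC; lra).
apply (continuous_ext_loc _ (fun x => RInt (mellin_frac t p) 1 (x * b) - RInt (mellin_frac t p) 1 (x * a))); [|exact HD].
exists (mkposreal x Hx); intros y Hy.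
assert (Hy0 : 0 < y) by (change (Rabs (y - x) < x) in Hy; apply Rabs_def2 in Hy; lra).
unfold mellin_int.
rewrite <- (RInt_ChaslesR (mellin_frac t p) 1 (y * a) (y * b)) by (apply Hex; try apply Rmult_lt_0_compat; lra).
rring.
Qed.

Lemma inv_square_bounds N : 1 <= N -> 0 < / N <= 1 /\ 0 < / N ^ 2 <= / N /\ N <= N ^ 2.
Proof.
intros HN; assert (0 < / N) by (apply Rinv_0_lt_compat; lra).
assert (/ N <= 1) by (rewrite <- Rinv_1; apply Rinv_le_contravar; lra).
rewrite <- pow_inv; repeat split; nra.
Qed.

Lemma mellin_int_weight_bound N : 1 <= N ->
  RInt (fun x => frac_part x * / (x * sqrt x)) (/ N) N <= 4.
Proof.
intros HN; destruct (inv_square_bounds N HN) as (H1 & _ & _).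
rewrite (RInt_extR _ (mellin_frac 0 0)); [|lra|].
2:{ intros x _; unfold mellin_frac; rewrite Rmult_0_l, Rplus_0_r, cos_0; ring. }
rewrite <- (RInt_ChaslesR _ (/ N) 1 N) by (apply ex_mellin_frac; lra).
assert (B1 := mellin_int_small 0 0 (/ N) 1 ltac:(lra) ltac:(lra)).
assert (B2 := mellin_int_large 0 0 1 N ltac:(lra) ltac:(lra)).
rewrite sqrt_1 in B1, B2; apply Rabs_le_between in B1, B2; unfold mellin_int in B1, B2; lra.
Qed.

(** The Mellin transform of an autocorrelation is a squared modulus. After the exchange of integrals
    the inner one, over [l], is a truncated Mellin integral with phase [- t ln x]; its limit leaves
    [mellin t 0] and [mellin t (PI / 2)] as coefficients of two further truncated integrals. The
    window [[N^(-2), N^2]] for [l] is so wide that [l x] covers [[1/N, N]] for every [x] in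
    [[1/N, N]]. *)
Lemma mellin_sq_corr t N : 1 <= N ->
  Rabs (RInt (fun l => frac_corr N l * mellin_kernel t l) (/ N ^ 2) (N ^ 2) - mellin_sq t) <= 48 / sqrt N.
Proof.
intros HN; destruct (inv_square_bounds N HN) as (HN1 & HN2 & HN3).
set (c := / N ^ 2) in *; set (d := N ^ 2) in *.
assert (HsN : 0 < sqrt N) by (apply sqrt_lt_R0; lra).
assert (HisN : 0 < / sqrt N) by now apply Rinv_0_lt_compat.
pose (f := fun x l => (frac_weight x * frac_part (l * x)) * mellin_kernel t l).
assert (Ef : forall x X, / N <= x -> c <= X -> RInt (f x) c X =
   frac_part x * / (x * sqrt x) * mellin_int t (- (t * ln x)) (x * c) (x * X)).
{ intros x X Hx HX; assert (Hx0 : 0 < x) by lra.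
  rewrite (RInt_extR (f x) (fun l => frac_weight x * (frac_part (l * x) * mellin_kernel t l))); [|easy|].
  2:{ intros; unfold f; ring. }
  rewrite RInt_scalR by (apply ex_kernel_frac; lra).
  rewrite RInt_kernel_frac by lra.
  rewrite <- Rmult_assoc; f_equal; unfold frac_weight.
  sqrt_facts x Hx0; generalize (frac_part x); intros; sqrt_elim x; field; easy. }
assert (PCm : forall X, c <= X -> PC (fun x => frac_part x * / (x * sqrt x) * mellin_int t (- (t * ln x)) (x * c) (x * X))).
{ intros X HX; apply PC_mult.
  - apply PC_mult; [apply PC_frac|apply PC_cont, continuous_inv32].
  - apply (PC_ext (fun x => cos (- (t * ln x)) * mellin_int t 0 (x * c) (x * X) +
      sin (- (t * ln x)) * mellin_int t (PI / 2) (x * c) (x * X))).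
    { intros x Hx; symmetry; apply mellin_int_phase; [apply Rmult_lt_0_compat; lra|apply Rmult_le_compat_l; lra]. }
    assert (HM : forall p, PC (fun x => mellin_int t p (x * c) (x * X)))
     by (intros p; apply PC_cont; intros x Hx; apply continuous_mellin_int_scale; lra).
    apply PC_plus; (apply PC_mult; [apply PC_cont; intros x Hx|apply HM]);
     auto_cont; lra. }
assert (Hsw : RInt (fun x => RInt (f x) c d) (/ N) N = RInt (fun l => RInt (fun x => f x l) (/ N) N) c d).
{ destruct (frac_corr_osc N c d HN ltac:(lra)) as (K & HK & Ho).
  destruct (mellin_kernel_Lipschitz t c d ltac:(lra)) as (L & HL & HkL).
  assert (HB : 0 <= / (c * sqrt c)) by (apply Rlt_le, inv32_pos; lra).
  apply (RInt_RInt_swap f (/ N) N c d (/ (c * sqrt c) * K + (N - / N) * N ^ 2 * L)); try lra.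
  - apply Rplus_le_le_0_compat; [now apply Rmult_le_pos|].
    apply Rmult_le_pos; [apply Rmult_le_pos; [lra|apply pow2_ge_0]|easy].
  - intros x Hx; apply (ex_RInt_extR (fun l => frac_weight x * (frac_part (l * x) * mellin_kernel t l))); [lra| |].
    { intros; unfold f; ring. }
    apply ex_RInt_scalR, ex_kernel_frac; lra.
  - intros l Hl; apply PC_ex_RInt; try lra; apply PC_mult; [apply PC_frac_corr_integrand; lra|apply PC_const].
  - intros X HX; apply (ex_RInt_extR (fun x => frac_part x * / (x * sqrt x) * mellin_int t (- (t * ln x)) (x * c) (x * X))); [lra| |].
    { intros x Hx; symmetry; apply Ef; lra. }
    apply PC_ex_RInt; try lra; apply PCm; lra.
  - apply (osc_bound_mult _ (mellin_kernel t)); auto; try lra.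
    + apply pow2_ge_0.
    + intros x l Hx Hl; destruct (frac_weight_bound N x HN ltac:(lra)); pose proof (frac_bounds (l * x)).
      rewrite Rabs_pos_eq; nra.
    + intros l Hl; apply mellin_kernel_bound; lra. }
replace (RInt (fun l => frac_corr N l * mellin_kernel t l) c d) with (RInt (fun x => RInt (f x) c d) (/ N) N).
2:{ rewrite Hsw; apply RInt_extR; [lra|]; intros l Hl; unfold f, frac_corr.
  rewrite (Rmult_comm (RInt _ _ _)), <- RInt_scalR by (apply ex_frac_corr; lra).
  apply RInt_extR; [lra|]; intros; ring. }
rewrite (RInt_extR _ (fun x => frac_part x * / (x * sqrt x) * mellin_int t (- (t * ln x)) (x * c) (x * d))); [|lra|].
2:{ intros x Hx; apply Ef; lra. }
set (M0 := mellin t 0); set (M1 := mellin t (PI / 2)).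
assert (E1 : RInt (fun x => frac_part x * / (x * sqrt x) * mellin t (- (t * ln x))) (/ N) N =
  M0 * mellin_int t 0 (/ N) N + M1 * mellin_int t (PI / 2) (/ N) N).
{ unfold mellin_int; rewrite <- RInt_lin2 by (apply ex_mellin_frac; lra).
  apply RInt_extR; [lra|]; intros x _; rewrite mellin_phase; unfold mellin_frac; fold M0 M1.
  rewrite cos_neg, sin_neg, Rplus_0_r, cos_plus, cos_PI2, sin_PI2; ring. }
assert (PCmel : PC (fun x => frac_part x * / (x * sqrt x) * mellin t (- (t * ln x)))).
{ apply PC_mult; [apply PC_mult; [apply PC_frac|apply PC_cont, continuous_inv32]|].
  apply (PC_ext (fun x => cos (- (t * ln x)) * M0 + sin (- (t * ln x)) * M1)).
  { intros; symmetry; apply mellin_phase. }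
  apply PC_cont; intros x Hx; auto_cont; repeat split; lra. }
assert (B1 : Rabs (RInt (fun x => frac_part x * / (x * sqrt x) * mellin_int t (- (t * ln x)) (x * c) (x * d)) (/ N) N -
   RInt (fun x => frac_part x * / (x * sqrt x) * mellin t (- (t * ln x))) (/ N) N) <= 16 / sqrt N).
{ assert (PCw : PC (fun x => frac_part x * / (x * sqrt x))) by (apply PC_mult; [apply PC_frac|apply PC_cont, continuous_inv32]).
  rewrite <- RInt_minusR by (apply PC_ex_RInt; try apply PCm; try apply PCmel; lra).
  apply Rle_trans with (RInt (fun x => 4 / sqrt N * (frac_part x * / (x * sqrt x))) (/ N) N).
  - apply RInt_abs_le; [lra| | |].
    + apply PC_ex_RInt; try lra; apply PC_minus; [apply PCm; lra|apply PCmel].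
    + apply PC_ex_RInt; try lra; apply PC_mult; [apply PC_const|apply PCw].
    + intros x Hx; rewrite <- Rmult_minus_distr_l, Rabs_mult.
      pose proof (frac_bounds x); pose proof (inv32_pos x ltac:(lra)).
      rewrite Rabs_pos_eq by nra; rewrite Rmult_comm; apply Rmult_le_compat_r; [nra|].
      assert (Hxc : x * c <= / N).
      { apply Rle_trans with (N * c); [apply Rmult_le_compat_r; lra|unfold c, d; right; field; lra]. }
      assert (Hxd : N <= x * d).
      { apply Rle_trans with (/ N * d); [unfold d; right; field; lra|apply Rmult_le_compat_r; lra]. }
      assert (0 < x * c) by (apply Rmult_lt_0_compat; lra).
      eapply Rle_trans; [apply mellin_spec; lra|].
      assert (sqrt (x * c) <= / sqrt N) by (rewrite <- sqrt_inv; apply sqrt_le_1; lra).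
      assert (/ sqrt (x * d) <= / sqrt N) by (apply Rinv_le_contravar; [easy|apply sqrt_le_1; lra]).
      unfold Rdiv; lra.
  - rewrite RInt_scalR by (apply PC_ex_RInt; try apply PCw; lra).
    pose proof (mellin_int_weight_bound N HN).
    replace (16 / sqrt N) with (4 / sqrt N * 4) by (field; lra).
    apply Rmult_le_compat_l; [unfold Rdiv; lra|easy]. }
rewrite E1 in B1.
assert (S : forall p, Rabs (mellin_int t p (/ N) N - mellin t p) <= 4 / sqrt N).
{ intros p; eapply Rle_trans; [apply mellin_spec; lra|]; rewrite sqrt_inv; right; field; lra. }
assert (S0 : Rabs (M0 * (mellin_int t 0 (/ N) N - M0)) <= 4 * (4 / sqrt N)).
{ rewrite Rabs_mult; apply Rmult_le_compat; try apply Rabs_pos; [apply mellin_bound|apply S]. }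
assert (S1 : Rabs (M1 * (mellin_int t (PI / 2) (/ N) N - M1)) <= 4 * (4 / sqrt N)).
{ rewrite Rabs_mult; apply Rmult_le_compat; try apply Rabs_pos; [apply mellin_bound|apply S]. }
apply Rabs_le_between in B1, S0, S1; apply Rabs_le.
unfold mellin_sq; fold M0 M1; unfold Rdiv in *; nra.
Qed.

(** * Plancherel for the weight [(A - t)^2 / 2] *)

Definition spline A t := (A - t) ^ 2 / 2.
Definition spline_cos A X tau : R := RInt (fun t => spline A t * cos (t * tau)) 0 X.
Definition spline_hat A tau : R := spline_cos A A tau.

Lemma continuous_spline_cos_integrand A tau t : continuous (fun t => spline A t * cos (t * tau)) t.
Proof. apply continuous_of_ex_derive; unfold spline; auto_derive; auto. Qed.

Lemma ex_spline_cos A tau a b : ex_RInt (fun t => spline A t * cos (t * tau)) a b.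
Proof. apply ex_RInt_everywhere; intros; apply continuous_spline_cos_integrand. Qed.

Lemma spline_bound A t : 0 <= t <= A -> 0 <= spline A t <= A ^ 2 / 2.
Proof. unfold spline; intros; split; nra. Qed.

Lemma continuous_spline_cos A X tau : 0 <= X <= A -> continuous (spline_cos A X) tau.
Proof.
intros HX; apply (continuous_of_Lipschitz _ tau 1 (A ^ 2 / 2 * A * X)); [lra|].
intros y z Hy Hz; unfold spline_cos.
rewrite <- RInt_minusR by apply ex_spline_cos.
replace (A ^ 2 / 2 * A * X * (z - y)) with ((X - 0) * (A ^ 2 / 2 * (A * (z - y)))) by ring.
apply RInt_const_bound; [lra|apply ex_RInt_minusR; apply ex_spline_cos|].
intros t Ht; rewrite <- Rmult_minus_distr_l, Rabs_mult.
destruct (spline_bound A t ltac:(lra)).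
rewrite (Rabs_pos_eq (spline A t)) by easy.
apply Rmult_le_compat; try lra; [apply Rabs_pos|].
eapply Rle_trans; [apply cos_Lipschitz|].
rewrite <- Rmult_minus_distr_l, Rabs_mult, !Rabs_pos_eq by lra; apply Rmult_le_compat_r; lra.
Qed.

Lemma continuous_spline_hat A tau : 0 <= A -> continuous (spline_hat A) tau.
Proof. intros HA; refine (continuous_spline_cos A A tau _); lra. Qed.

Lemma spline_cos_Lipschitz A tau s t : 0 <= s -> s <= t -> t <= A ->
  Rabs (spline A t * cos (t * tau) - spline A s * cos (s * tau)) <= (A + A ^ 2 / 2 * Rabs tau) * (t - s).
Proof.
intros Hs Hst HA.
replace (_ - _) with ((spline A t - spline A s) * cos (t * tau) + spline A s * (cos (t * tau) - cos (s * tau))) by ring.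
eapply Rle_trans; [apply Rabs_triang|]; rewrite !Rabs_mult, Rmult_plus_distr_r.
destruct (spline_bound A s ltac:(lra)).
apply Rplus_le_compat.
- rewrite <- (Rmult_1_r (A * (t - s))); apply Rmult_le_compat; try apply Rabs_pos; [|apply Rabs_le, COS_bound].
  unfold spline; replace ((A - t) ^ 2 / 2 - (A - s) ^ 2 / 2) with (- ((t - s) * (A - (s + t) / 2))) by field.
  rewrite Rabs_Ropp, Rabs_pos_eq by (apply Rmult_le_pos; lra).
  rewrite Rmult_comm; apply Rmult_le_compat_r; lra.
- rewrite Rmult_assoc; apply Rmult_le_compat; try apply Rabs_pos; [rewrite Rabs_pos_eq; lra|].
  eapply Rle_trans; [apply cos_Lipschitz|].
  rewrite <- Rmult_minus_distr_r, Rabs_mult, (Rabs_pos_eq (t - s)) by lra; lra.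
Qed.

(** The approximation of [mellin_sq] is integrated over [[0, A]] against the spline, which is at
    most [A^2 / 2] there, and the integrals over [t] and [l] are exchanged. *)
Lemma spline_corr A N : 0 <= A -> 1 <= N ->
  Rabs (RInt (fun t => spline A t * mellin_sq t) 0 A -
    RInt (fun l => frac_corr N l * / (l * sqrt l) * spline_hat A (ln l)) (/ N ^ 2) (N ^ 2)) <=
  24 * A ^ 3 / sqrt N.
Proof.
intros HA HN; destruct (inv_square_bounds N HN) as (HN1 & HN2 & HN3).
set (c := / N ^ 2) in *; set (d := N ^ 2) in *.
assert (HsN : 0 < sqrt N) by (apply sqrt_lt_R0; lra).
pose (g := fun l => frac_corr N l * / (l * sqrt l)).
assert (Cg : forall l, 0 < l -> continuous g l).
{ intros l Hl; apply (continuous_mult (frac_corr N) (fun l => / (l * sqrt l))).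
  - now apply continuous_frac_corr.
  - now apply continuous_inv32. }
assert (Cs : forall X l, 0 <= X <= A -> 0 < l -> continuous (fun l => spline_cos A X (ln l)) l).
{ intros X l HX Hl; apply (continuous_comp ln (spline_cos A X)); [|now apply continuous_spline_cos].
  auto_cont; lra. }
pose (f := fun l t => g l * (spline A t * cos (t * ln l))).
assert (PCf : forall t, PC (fun l => f l t)).
{ intros t; apply PC_mult; apply PC_cont; [exact Cg|]; intros l Hl; auto_cont; lra. }
assert (Ef : forall l X, RInt (f l) 0 X = g l * spline_cos A X (ln l)).
{ intros l X; unfold f; rewrite RInt_scalR by apply ex_spline_cos; reflexivity. }
assert (Hsw : RInt (fun l => RInt (f l) 0 A) c d = RInt (fun t => RInt (fun l => f l t) c d) 0 A /\
  ex_RInt (fun t => RInt (fun l => f l t) c d) 0 A).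
{ assert (PCw : PC (fun l => Rabs (g l) * (A + A ^ 2 / 2 * Rabs (ln l)))).
  { apply PC_mult; [apply PC_abs, PC_cont, Cg|]; apply PC_plus; [apply PC_const|].
    apply PC_mult; [apply PC_const|]; apply PC_abs, PC_cont; intros.
    auto_cont; lra. }
  assert (Hw0 : forall l, 0 <= Rabs (g l) * (A + A ^ 2 / 2 * Rabs (ln l))).
  { intros l; apply Rmult_le_pos; [apply Rabs_pos|]; pose proof (Rabs_pos (ln l)); pose proof (pow2_ge_0 A); nra. }
  assert (Ho : osc_bound f c d 0 A (RInt (fun l => Rabs (g l) * (A + A ^ 2 / 2 * Rabs (ln l))) c d)).
  { intros t1 t2 H1 H2; exists (fun l => (t2 - t1) * (Rabs (g l) * (A + A ^ 2 / 2 * Rabs (ln l)))); split; [|split].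
    - apply ex_RInt_scalR, PC_ex_RInt; auto; lra.
    - rewrite RInt_scalR by (apply PC_ex_RInt; auto; lra); right; rring.
    - intros l s Hl Hs; unfold f; rewrite <- Rmult_minus_distr_l, Rabs_mult.
      replace ((t2 - t1) * (Rabs (g l) * (A + A ^ 2 / 2 * Rabs (ln l)))) with
       (Rabs (g l) * ((A + A ^ 2 / 2 * Rabs (ln l)) * (t2 - t1))) by ring.
      apply Rmult_le_compat_l; [apply Rabs_pos|].
      eapply Rle_trans; [apply spline_cos_Lipschitz; lra|].
      apply Rmult_le_compat_l; [|lra].
      pose proof (Rabs_pos (ln l)); pose proof (pow2_ge_0 A); nra. }
  assert (HK : 0 <= RInt (fun l => Rabs (g l) * (A + A ^ 2 / 2 * Rabs (ln l))) c d).
  { apply RInt_ge_0; [lra|apply PC_ex_RInt; auto; lra|]; intros; apply Hw0. }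
  split.
  - apply (RInt_RInt_swap f c d 0 A _ ltac:(lra) ltac:(lra) HK); auto.
    + intros l _; apply ex_RInt_scalR, ex_spline_cos.
    + intros t _; apply PC_ex_RInt; auto; lra.
    + intros X HX; apply (ex_RInt_extR (fun l => g l * spline_cos A X (ln l))); [lra|intros; symmetry; apply Ef|].
      apply PC_ex_RInt; try lra; apply PC_mult; apply PC_cont; auto.
  - apply (osc_bound_ex_RInt f c d 0 A (RInt (fun l => Rabs (g l) * (A + A ^ 2 / 2 * Rabs (ln l))) c d)); auto; try lra.
    intros t _; apply PC_ex_RInt; auto; lra. }
destruct Hsw as [Hsw Hex].
rewrite (RInt_extR (fun l => frac_corr N l * / (l * sqrt l) * spline_hat A (ln l)) (fun l => RInt (f l) 0 A)); [|lra|].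
2:{ intros l _; rewrite Ef; reflexivity. }
rewrite Hsw.
assert (Hex' : ex_RInt (fun t => spline A t * mellin_sq t) 0 A).
{ apply ex_RInt_cont; auto; intros t _; apply (continuous_mult (spline A) mellin_sq); [|apply continuous_mellin_sq].
  apply continuous_of_ex_derive; unfold spline; auto_derive; auto. }
rewrite <- RInt_minusR by easy.
replace (24 * A ^ 3 / sqrt N) with ((A - 0) * (A ^ 2 / 2 * (48 / sqrt N))) by (field; lra).
apply RInt_const_bound; [easy|now apply ex_RInt_minusR|].
intros t Ht.
assert (E : RInt (fun l => f l t) c d = spline A t * RInt (fun l => frac_corr N l * mellin_kernel t l) c d).
{ rewrite <- RInt_scalR.
  - apply RInt_extR; [lra|]; intros l _; unfold f, g, mellin_kernel; ring.
  - apply PC_ex_RInt; try lra; apply PC_mult; apply PC_cont; intros; [now apply continuous_frac_corr|now apply continuous_mellin_kernel]. }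
rewrite E, <- Rmult_minus_distr_l, Rabs_mult.
destruct (spline_bound A t ltac:(lra)).
rewrite (Rabs_pos_eq (spline A t)) by easy.
apply Rmult_le_compat; try lra; [apply Rabs_pos|].
rewrite Rabs_minus_sym; now apply mellin_sq_corr.
Qed.

(** * The autocorrelation in the logarithmic variable *)

(** Up to the cut-off at [N = exp m], the autocorrelation of [{x} / sqrt x] with respect to [dx / x]
    in the additive variable [tau = ln l]. The factor [exp (- tau / 2)] is what makes it even, apart
    from the cut-off. *)
Definition log_corr m tau := exp (- tau / 2) * frac_corr (exp m) (exp tau).

Lemma exp_ge_1 m : 0 <= m -> 1 <= exp m.
Proof.
intros [H|<-]; [|rewrite exp_0; lra]; rewrite <- exp_0; now apply Rlt_le, exp_increasing.
Qed.

Lemma continuous_log_corr m tau : 0 <= m -> continuous (log_corr m) tau.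
Proof.
intros Hm; apply (continuous_mult (fun tau => exp (- tau / 2)) (fun tau => frac_corr (exp m) (exp tau))).
- auto_cont; auto.
- apply (continuous_comp exp (frac_corr (exp m))).
  + auto_cont; auto.
  + apply continuous_frac_corr; [now apply exp_ge_1|apply exp_pos].
Qed.

Lemma sqrt_exp x : sqrt (exp x) = exp (x / 2).
Proof.
rewrite <- (sqrt_pow2 (exp (x / 2))) by (apply Rlt_le, exp_pos).
f_equal; simpl; rewrite Rmult_1_r, <- exp_plus; f_equal; field.
Qed.

Lemma spline_log_corr A m : 0 <= A -> 0 <= m ->
  Rabs (RInt (fun t => spline A t * mellin_sq t) 0 A -
    RInt (fun tau => log_corr m tau * spline_hat A tau) (- (2 * m)) (2 * m)) <= 24 * A ^ 3 * exp (- m / 2).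
Proof.
intros HA Hm; assert (HN := exp_ge_1 m Hm).
assert (E : RInt (fun tau => log_corr m tau * spline_hat A tau) (- (2 * m)) (2 * m) =
  RInt (fun l => frac_corr (exp m) l * / (l * sqrt l) * spline_hat A (ln l)) (/ exp m ^ 2) (exp m ^ 2)).
{ assert (E2 : exp m ^ 2 = exp (2 * m)) by (simpl; rewrite Rmult_1_r, <- exp_plus; f_equal; ring).
  rewrite E2, <- exp_Ropp.
  rewrite <- (RInt_comp (fun l => frac_corr (exp m) l * / (l * sqrt l) * spline_hat A (ln l)) exp exp).
  - apply RInt_extR; [lra|]; intros tau _.
    change (scal ?x ?y) with (x * y); rewrite ln_exp, sqrt_exp; unfold log_corr.
    replace (- tau / 2) with (- (tau / 2)) by field; rewrite exp_Ropp.
    pose proof (exp_pos tau); pose proof (exp_pos (tau / 2)); field; lra.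
  - intros tau _; pose proof (exp_pos tau).
    apply (continuous_mult (fun l => frac_corr (exp m) l * / (l * sqrt l)) (fun l => spline_hat A (ln l))).
    + apply (continuous_mult (frac_corr (exp m)) (fun l => / (l * sqrt l))); [now apply continuous_frac_corr|now apply continuous_inv32].
    + apply (continuous_comp ln (spline_hat A)); [|now apply continuous_spline_hat].
      auto_cont; exact H.
  - intros tau _; split; [auto_derive; auto; ring|auto_cont; auto]. }
rewrite E.
replace (24 * A ^ 3 * exp (- m / 2)) with (24 * A ^ 3 / sqrt (exp m)).
- now apply spline_corr.
- rewrite sqrt_exp; replace (- m / 2) with (- (m / 2)) by field; now rewrite exp_Ropp.
Qed.

(** * Variance of the number of integers in an interval *)

Lemma PC_shift f b : 0 <= b -> PC f -> PC (fun x => f (x + b)).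
Proof.
intros Hb Hf p Hp.
destruct (Hf (p + b)) as (d & Hd & f1 & f2 & Hc & Hl & Hr); [lra|].
exists d; split; [easy|].
exists (fun x => f1 (x + b)), (fun x => f2 (x + b)); split; [|split].
- intros x Hx.
  assert (Hx' : Rabs (x + b - (p + b)) < d) by (replace (x + b - (p + b)) with (x - p) by ring; easy).
  assert (continuous (fun x => x + b) x) by (auto_cont; auto).
  split; [apply (continuous_comp (fun x => x + b) f1)|apply (continuous_comp (fun x => x + b) f2)]; auto; now apply Hc.
- intros x Hx; apply Hl; lra.
- intros x Hx; apply Hr; lra.
Qed.

Lemma RInt_frac_period a : 0 < a -> RInt frac_part a (a + 1) = / 2.
Proof.
intros Ha; destruct (base_Int_part a) as [H1 H2]; set (k := Int_part a) in *.
rewrite <- (RInt_ChaslesR _ a (IZR k + 1) (a + 1)) by (apply PC_ex_RInt; try apply PC_frac; lra).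
rewrite (RInt_extR _ (fun x => x - IZR k) a), (RInt_extR _ (fun x => x - (IZR k + 1)) (IZR k + 1)); try lra.
2:{ intros x Hx; rewrite (frac_eq (k + 1)); rewrite plus_IZR; lra. }
2:{ intros x Hx; apply frac_eq; lra. }
rewrite (RInt_FTC (fun x => (x - IZR k) ^ 2 / 2)); [|lra| |].
2:{ intros; auto_derive; auto; field. }
2:{ intros; auto_cont; auto. }
rewrite (RInt_FTC (fun x => (x - (IZR k + 1)) ^ 2 / 2)); [|lra| |].
2:{ intros; auto_derive; auto; field. }
2:{ intros; auto_cont; auto. }
rfield.
Qed.

Lemma RInt_frac_shift_period (n : nat) b : (1 <= n)%nat -> 0 <= b ->
  RInt (fun x => frac_part (x + b)) (INR n) (INR n + 1) = / 2.
Proof.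
intros Hn Hb; apply le_INR in Hn; simpl in Hn.
rewrite <- (RInt_frac_period (INR n + b)) by lra.
replace (INR n + b) with (1 * INR n + b) by ring.
replace (1 * INR n + b + 1) with (1 * (INR n + 1) + b) by ring.
rewrite <- (RInt_comp_lin frac_part 1 b).
- apply RInt_extR; [lra|]; intros x _; change (scal 1 ?z) with (1 * z); now rewrite !Rmult_1_l.
- apply PC_ex_RInt; try apply PC_frac; lra.
Qed.

(* The variance of the number of integers in a random interval of length [y]. *)
Definition interval_var y := frac_part y * (1 - frac_part y).

Lemma PC_interval_var : PC interval_var.
Proof. apply PC_mult; [apply PC_frac|apply PC_minus; [apply PC_const|apply PC_frac]]. Qed.

Lemma interval_var_bound y : 0 <= interval_var y <= 1.
Proof. unfold interval_var; pose proof (frac_bounds y); split; nra. Qed.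

(** With [th] the fractional part of [b], the difference equals [th] until [x + b] passes an
    integer, at [INR n + 1 - th], and [th - 1] afterwards. *)
Lemma RInt_interval_var (n : nat) b : (1 <= n)%nat -> 0 <= b ->
  RInt (fun x => (frac_part (x + b) - frac_part x) ^ 2) (INR n) (INR n + 1) = interval_var b.
Proof.
intros Hn Hb; apply le_INR in Hn; simpl in Hn.
unfold interval_var; pose proof (frac_bounds b) as Hth.
destruct (base_Int_part b) as [Hk1 Hk2].
pose proof (Rplus_Int_part_frac_part b) as Eb.
set (k := Int_part b) in *; set (th := frac_part b) in *.
assert (En : IZR (Z.of_nat n) = INR n) by now rewrite INR_IZR_INZ.
assert (PCd : PC (fun x => (frac_part (x + b) - frac_part x) ^ 2)).
{ apply PC_pow, PC_minus; [apply (PC_shift frac_part); auto; apply PC_frac|apply PC_frac]. }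
rewrite <- (RInt_ChaslesR _ (INR n) (INR n + 1 - th) (INR n + 1)) by (apply PC_ex_RInt; auto; lra).
rewrite (RInt_extR _ (fun _ => th ^ 2) (INR n)), (RInt_extR _ (fun _ => (th - 1) ^ 2) (INR n + 1 - th)); try lra.
- rewrite !RInt_constR; rring.
- intros x Hx; rewrite (frac_eq (Z.of_nat n + k + 1) (x + b)), (frac_eq (Z.of_nat n) x);
   rewrite ?plus_IZR, ?En; try lra.
  f_equal; lra.
- intros x Hx; rewrite (frac_eq (Z.of_nat n + k) (x + b)), (frac_eq (Z.of_nat n) x);
   rewrite ?plus_IZR, ?En; try lra.
  f_equal; lra.
Qed.

(* Moving the length of the interval within [[b1, b2]] changes the number of integers by at most
   the number of integers gained from [b1] to [b2], whose mean over a period is [b2 - b1]. *)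
Lemma interval_var_perturb (n : nat) (b : R -> R) b1 b2 : (1 <= n)%nat -> 0 <= b1 ->
  PC (fun x => frac_part (x + b x)) ->
  (forall x, INR n < x < INR n + 1 -> b1 <= b x <= b2) ->
  Rabs (RInt (fun x => (frac_part (x + b x) - frac_part x) ^ 2) (INR n) (INR n + 1) - interval_var b1) <=
  4 * (b2 - b1).
Proof.
intros Hn Hb1 Hpc Hb.
assert (Hn1 := Hn); apply le_INR in Hn1; simpl in Hn1.
assert (Hb12 : b1 <= b2) by (specialize (Hb (INR n + / 2)); lra).
rewrite <- (RInt_interval_var n b1) by easy.
assert (PCs : forall c, 0 <= c -> PC (fun x => frac_part (x + c))) by (intros; apply (PC_shift frac_part); auto; apply PC_frac).
assert (PC1 : PC (fun x => (frac_part (x + b x) - frac_part x) ^ 2)) by (apply PC_pow, PC_minus; [easy|apply PC_frac]).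
assert (PC2 : PC (fun x => (frac_part (x + b1) - frac_part x) ^ 2)) by (apply PC_pow, PC_minus; [auto|apply PC_frac]).
assert (Hex : forall f, PC f -> ex_RInt f (INR n) (INR n + 1)) by (intros; apply PC_ex_RInt; auto; lra).
rewrite <- RInt_minusR by auto.
apply Rle_trans with (RInt (fun x => 2 * (2 * (b2 - b1) + (frac_part (x + b1) - frac_part (x + b2)))) (INR n) (INR n + 1)).
- apply RInt_abs_le; [lra| | |].
  + apply ex_RInt_minusR; auto.
  + apply Hex, PC_mult; [apply PC_const|]; apply PC_plus; [apply PC_const|]; apply PC_minus; apply PCs; lra.
  + intros x Hx; specialize (Hb x Hx).
    replace (_ - _) with ((frac_part (x + b x) - frac_part (x + b1)) *
      ((frac_part (x + b x) - frac_part x) + (frac_part (x + b1) - frac_part x))) by ring.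
    pose proof (frac_bounds x); pose proof (frac_bounds (x + b x)); pose proof (frac_bounds (x + b1)).
    pose proof (frac_sub_le (x + b1) (x + b x) ltac:(lra)).
    pose proof (frac_sub_le (x + b x) (x + b2) ltac:(lra)).
    rewrite Rabs_mult, Rmult_comm; apply Rmult_le_compat; try apply Rabs_pos; apply Rabs_le; lra.
- assert (PC3 : PC (fun x => frac_part (x + b1) - frac_part (x + b2))) by (apply PC_minus; apply PCs; lra).
  rewrite RInt_scalR by (apply Hex, PC_plus; [apply PC_const|exact PC3]).
  rewrite RInt_plusR; [|apply ex_RInt_const|apply Hex; exact PC3].
  rewrite RInt_constR, RInt_minusR by (apply Hex, PCs; lra).
  rewrite !RInt_frac_shift_period by (auto; lra); lra.
Qed.

Definition frac_diff_sq l x := (frac_part (l * x) - frac_part x) ^ 2 * / x ^ 2.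

Lemma PC_inv_sq : PC (fun x => / x ^ 2).
Proof. apply PC_cont, continuous_inv_sq. Qed.

Lemma PC_frac_diff_sq l : 0 < l -> PC (frac_diff_sq l).
Proof.
intros; apply PC_mult; [|apply PC_inv_sq]; apply PC_pow, PC_minus; [now apply PC_frac_scale|apply PC_frac].
Qed.

Lemma cell_weight_replace (n : nat) (f : R -> R) : (1 <= n)%nat -> PC f ->
  (forall x, 0 <= f x <= 1) ->
  Rabs (RInt (fun x => f x * / x ^ 2) (INR n) (INR n + 1) - RInt f (INR n) (INR n + 1) * / INR n ^ 2) <= 2 * / INR n ^ 3.
Proof.
intros Hn Hf Hb; apply le_INR in Hn; simpl in Hn.
assert (PC1 : PC (fun x => f x * / x ^ 2)) by (apply PC_mult; [easy|apply PC_inv_sq]).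
assert (Hex1 : ex_RInt (fun x => f x * / x ^ 2) (INR n) (INR n + 1)) by (apply PC_ex_RInt; auto; lra).
assert (Hex2 : ex_RInt (fun x => / INR n ^ 2 * f x) (INR n) (INR n + 1)) by (apply ex_RInt_scalR, PC_ex_RInt; auto; lra).
rewrite Rmult_comm, <- RInt_scalR, <- RInt_minusR; [|exact Hex1|exact Hex2|apply PC_ex_RInt; auto; lra].
replace (2 * / INR n ^ 3) with ((INR n + 1 - INR n) * (2 * / INR n ^ 3)) by ring.
apply RInt_const_bound; [lra| |].
- apply ex_RInt_minusR; [exact Hex1|exact Hex2].
- intros x Hx; replace (_ - _) with (- (f x * (/ INR n ^ 2 - / x ^ 2))) by ring.
  assert (0 < INR n ^ 2) by nra; assert (0 < x ^ 2) by nra.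
  assert (A1 : / x ^ 2 <= / INR n ^ 2) by (apply Rinv_le_contravar; nra).
  assert (A2 : / INR n ^ 2 - / x ^ 2 <= 2 * / INR n ^ 3).
  { apply Rle_trans with (/ INR n ^ 2 - / (INR n + 1) ^ 2).
    - apply Rplus_le_compat_l, Ropp_le_contravar, Rinv_le_contravar; [easy|]; apply pow_incr; lra.
    - apply (Rmult_le_reg_r (INR n ^ 3 * (INR n + 1) ^ 2)); [apply Rmult_lt_0_compat; apply pow_lt; lra|].
      replace ((/ INR n ^ 2 - / (INR n + 1) ^ 2) * (INR n ^ 3 * (INR n + 1) ^ 2)) with (INR n * (2 * INR n + 1)) by (field; lra).
      replace (2 * / INR n ^ 3 * (INR n ^ 3 * (INR n + 1) ^ 2)) with (2 * (INR n + 1) ^ 2) by (field; lra).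
      nra. }
  rewrite Rabs_Ropp; specialize (Hb x).
  rewrite Rabs_pos_eq by (apply Rmult_le_pos; lra).
  apply Rle_trans with (1 * (/ INR n ^ 2 - / x ^ 2)); [apply Rmult_le_compat_r; lra|lra].
Qed.

(** Over one cell the length [al x] changes by [al] only, so the mean square of the increment and
    the mean of the variance are both within [4 al] of the variance at length [al n]. Freezing the
    weight [1 / x^2] costs [2 / n^3] for each. *)
Lemma frac_diff_cell al (n : nat) : 0 < al -> (1 <= n)%nat ->
  Rabs (RInt (fun x => frac_diff_sq (1 + al) x - interval_var (al * x) * / x ^ 2) (INR n) (INR n + 1)) <=
  8 * al * / INR n ^ 2 + 4 * / INR n ^ 3.
Proof.
intros Ha Hn; assert (Hn1 := Hn); apply le_INR in Hn1; simpl in Hn1.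
assert (PC1 : PC (fun x => (frac_part ((1 + al) * x) - frac_part x) ^ 2)).
{ apply PC_pow, PC_minus; [apply PC_frac_scale; lra|apply PC_frac]. }
assert (PC2 : PC (fun x => interval_var (al * x))) by (apply (PC_scale interval_var); auto; apply PC_interval_var).
rewrite RInt_minusR; try (apply PC_ex_RInt; try lra).
2:{ apply PC_frac_diff_sq; lra. }
2:{ apply PC_mult; [easy|apply PC_inv_sq]. }
assert (B1 := cell_weight_replace n _ Hn PC1).
assert (B2 := cell_weight_replace n _ Hn PC2 (fun x => interval_var_bound (al * x))).
assert (D1 : forall x, 0 <= (frac_part ((1 + al) * x) - frac_part x) ^ 2 <= 1).
{ intros x; pose proof (frac_bounds x); pose proof (frac_bounds ((1 + al) * x)); split; [apply pow2_ge_0|nra]. }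
specialize (B1 D1).
assert (Hin : 0 < / INR n ^ 2) by (apply Rinv_0_lt_compat; nra).
assert (B3 : Rabs (RInt (fun x => (frac_part ((1 + al) * x) - frac_part x) ^ 2) (INR n) (INR n + 1) - interval_var (al * INR n)) <= 4 * al).
{ rewrite (RInt_extR _ (fun x => (frac_part (x + al * x) - frac_part x) ^ 2)); [|lra|].
  2:{ intros; do 3 f_equal; ring. }
  replace (4 * al) with (4 * (al * (INR n + 1) - al * INR n)) by ring.
  apply interval_var_perturb; auto; [nra| |].
  - apply (PC_ext (fun x => frac_part ((1 + al) * x))); [intros; f_equal; ring|apply PC_frac_scale; lra].
  - intros; split; apply Rmult_le_compat_l; lra. }
assert (B4 : Rabs (RInt (fun x => interval_var (al * x)) (INR n) (INR n + 1) - interval_var (al * INR n)) <= 4 * al).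
{ replace (interval_var (al * INR n)) with (RInt (fun _ => interval_var (al * INR n)) (INR n) (INR n + 1))
   by (rewrite RInt_constR; change (@eq R ((INR n + 1 - INR n) * interval_var (al * INR n)) (interval_var (al * INR n))); ring).
  rewrite <- RInt_minusR; [|apply PC_ex_RInt; auto; lra|apply ex_RInt_const].
  replace (4 * al) with ((INR n + 1 - INR n) * (4 * al)) by ring.
  apply RInt_const_bound; [lra|apply ex_RInt_minusR; [apply PC_ex_RInt; auto; lra|apply ex_RInt_const]|].
  intros x Hx; rewrite <- (RInt_interval_var n (al * x)) by (auto; nra).
  apply Rle_trans with (4 * (al * x - al * INR n)); [|nra].
  apply (interval_var_perturb n (fun _ => al * x)); auto; [nra|apply (PC_shift frac_part); [nra|apply PC_frac]|].
  intros; nra. }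
revert B1 B2 B3 B4; unfold frac_diff_sq.
generalize (interval_var (al * INR n)); intros v; rint_atoms; intros B1 B2 B3 B4.
set (q := / INR n ^ 2) in *; set (q3 := / INR n ^ 3) in *.
apply Rabs_le_between in B1, B2, B3, B4; apply Rabs_le; split; nra.
Qed.

(** The cell errors are summed with [1 / n^2] replaced by the telescoping [1 / (n - 1) - 1 / n]; the
    cubic terms are reduced to quadratic ones by a factor [1 / P]. *)
Lemma frac_diff_tail al (P n : nat) : 0 < al -> (2 <= P)%nat -> (P <= n)%nat ->
  Rabs (RInt (fun x => frac_diff_sq (1 + al) x - interval_var (al * x) * / x ^ 2) (INR P) (INR n)) <=
  (8 * al + 4 / INR P) * (/ (INR P - 1) - / (INR n - 1)).
Proof.
intros Ha HP Hn.
assert (PCd : PC (fun x => frac_diff_sq (1 + al) x - interval_var (al * x) * / x ^ 2)).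
{ apply PC_minus; [apply PC_frac_diff_sq; lra|]; apply PC_mult; [|apply PC_inv_sq].
  apply (PC_scale interval_var); auto; apply PC_interval_var. }
assert (HP' : 2 <= INR P) by (apply le_INR in HP; simpl in HP; lra).
induction Hn.
- rewrite (RInt_point (INR P) _); change zero with 0; rewrite Rabs_R0; lra.
- rewrite S_INR; apply le_INR in Hn as Hn'.
  rewrite <- (RInt_ChaslesR _ (INR P) (INR m) (INR m + 1)) by (apply PC_ex_RInt; auto; lra).
  eapply Rle_trans; [apply Rabs_triang|].
  assert (B := frac_diff_cell al m Ha ltac:(lia)).
  replace (INR m + 1 - 1) with (INR m) by ring.
  assert (A1 : / INR m ^ 2 <= / (INR m - 1) - / INR m).
  { replace (/ (INR m - 1) - / INR m) with (/ ((INR m - 1) * INR m)) by (field; lra).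
    apply Rinv_le_contravar; nra. }
  assert (A2 : / INR m ^ 3 <= / INR P * / INR m ^ 2).
  { replace (/ INR m ^ 3) with (/ INR m * / INR m ^ 2) by (field; lra).
    apply Rmult_le_compat_r; [apply Rlt_le, Rinv_0_lt_compat; nra|apply Rinv_le_contravar; lra]. }
  assert (A3 : 0 < / INR P) by (apply Rinv_0_lt_compat; lra).
  unfold Rdiv in *; set (q := / INR m ^ 2) in *.
  assert (0 <= q) by (apply Rlt_le, Rinv_0_lt_compat; nra).
  nra.
Qed.

(** * Mean square of the increment under a small dilation *)

Fixpoint harmonic (n : nat) : R := match n with O => 0 | S k => harmonic k + / INR (S k) end.

Lemma ln_le_sub x : 0 < x -> ln x <= x - 1.
Proof.
intros Hx; destruct (Rle_lt_or_eq_dec 0 x) as [_|]; [lra| |lra].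
rewrite <- (ln_exp (x - 1)); apply ln_le; [easy|].
pose proof (exp_ineq1_le (x - 1)); lra.
Qed.

Lemma ln_ge_inv x : 0 < x -> 1 - / x <= ln x.
Proof.
intros Hx; assert (0 < / x) by now apply Rinv_0_lt_compat.
pose proof (ln_le_sub (/ x) H); rewrite ln_Rinv in H0 by easy; lra.
Qed.

(** Each step of [harmonic n - ln n] is a decrease of at most [1 / n - 1 / (n + 1)], so the limit,
    Euler's constant, is approached with error at most [1 / n]. *)
Lemma harmonic_ln : exists g, forall n, (1 <= n)%nat -> Rabs (harmonic n - ln (INR n) - g) <= / INR n.
Proof.
assert (Hstep : forall n, (1 <= n)%nat -> 0 <= (harmonic n - ln (INR n)) - (harmonic (S n) - ln (INR (S n))) <= / INR n - / INR (S n)).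
{ intros n Hn; apply le_INR in Hn; simpl INR in Hn.
  change (harmonic (S n)) with (harmonic n + / INR (S n)); rewrite S_INR.
  assert (E : ln (INR n + 1) - ln (INR n) = ln ((INR n + 1) / INR n)) by (rewrite ln_div; lra).
  assert (Hq : 0 < (INR n + 1) / INR n) by (apply Rdiv_lt_0_compat; lra).
  pose proof (ln_le_sub _ Hq) as A1; pose proof (ln_ge_inv _ Hq) as A2.
  replace ((INR n + 1) / INR n - 1) with (/ INR n) in A1 by (field; lra).
  replace (1 - / ((INR n + 1) / INR n)) with (/ (INR n + 1)) in A2 by (field; lra).
  lra. }
assert (Hdiff : forall n k, (1 <= n)%nat ->
  0 <= (harmonic n - ln (INR n)) - (harmonic (n + k) - ln (INR (n + k))) <= / INR n - / INR (n + k)).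
{ intros n k Hn; induction k; [rewrite Nat.add_0_r; lra|].
  replace (n + S k)%nat with (S (n + k)) by lia; specialize (Hstep (n + k)%nat ltac:(lia)); lra. }
destruct (Rcomplete.R_complete (fun n => harmonic (S n) - ln (INR (S n)))) as [g Hg].
{ intros eps He; destruct (INR_unbounded (/ eps)) as [N HN]; exists N.
  assert (Hsm : forall n, (N <= n)%nat -> / INR (S n) < eps).
  { intros n Hn; rewrite <- (Rinv_inv eps); apply le_INR in Hn; rewrite S_INR.
    assert (0 < / eps) by (apply Rinv_0_lt_compat; lra).
    apply Rinv_lt_contravar; [apply Rmult_lt_0_compat; lra|lra]. }
  assert (HH : forall n m, (N <= n)%nat -> (n <= m)%nat -> Rabs (harmonic (S n) - ln (INR (S n)) - (harmonic (S m) - ln (INR (S m)))) < eps).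
  { intros n m Hn Hm; specialize (Hdiff (S n) (m - n)%nat ltac:(lia)).
    replace (S n + (m - n))%nat with (S m) in Hdiff by lia.
    specialize (Hsm n Hn); assert (0 < / INR (S m)) by (apply Rinv_0_lt_compat, lt_0_INR; lia).
    apply Rabs_def1; lra. }
  intros n m Hn Hm; unfold R_dist; destruct (Nat.le_ge_cases n m); [now apply HH|].
  rewrite Rabs_minus_sym; now apply HH. }
exists g; intros n Hn; apply Rnot_lt_le; intros Hlt.
destruct (Hg (Rabs (harmonic n - ln (INR n) - g) - / INR n)) as [N HN]; [lra|].
specialize (HN (n + N)%nat ltac:(lia)); unfold R_dist in HN.
specialize (Hdiff n (S N) Hn); replace (n + S N)%nat with (S (n + N)) in Hdiff by lia.
assert (0 < / INR (S (n + N))) by (apply Rinv_0_lt_compat, lt_0_INR; lia).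
apply Rabs_def2 in HN.
unfold Rabs in HN, Hlt; destruct (Rcase_abs (harmonic n - ln (INR n) - g)); lra.
Qed.

(** On the unit before [n] the integer part of [(1 + al) x] changes once, at [n / (1 + al)]: the
    increment of the fractional part is [al x] before and [al x - 1] after. The assumption
    [al n <= 1] excludes a second integer. The lower end [a] is free so that the first cell may
    start at the cut-off. *)
Lemma frac_diff_cell_exact al (n : nat) a : 0 < al -> (1 <= n)%nat -> al * INR n <= 1 ->
  0 < a -> INR n - 1 <= a -> a <= INR n / (1 + al) ->
  RInt (frac_diff_sq (1 + al)) a (INR n) = al ^ 2 * (INR n - a) + al / INR n - 2 * al * ln (1 + al).
Proof.
intros Hal Hn1 Haln Ha Ha1 Ha2; assert (Hn : 1 <= INR n) by (apply le_INR in Hn1; now simpl in Hn1).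
assert (En : IZR (Z.of_nat n) = INR n) by now rewrite INR_IZR_INZ.
assert (Hc : INR n / (1 + al) < INR n).
{ apply (Rmult_lt_reg_r (1 + al)); [lra|]; unfold Rdiv; rewrite Rmult_assoc, Rinv_l by lra; nra. }
assert (Hk : forall x, x < INR n / (1 + al) -> (1 + al) * x < INR n).
{ intros x Hx; apply (Rmult_lt_compat_l (1 + al)) in Hx; [|lra].
  replace ((1 + al) * (INR n / (1 + al))) with (INR n) in Hx by (field; lra); easy. }
assert (Hk' : forall x, INR n / (1 + al) < x -> INR n < (1 + al) * x).
{ intros x Hx; apply (Rmult_lt_compat_l (1 + al)) in Hx; [|lra].
  replace ((1 + al) * (INR n / (1 + al))) with (INR n) in Hx by (field; lra); easy. }
rewrite <- (RInt_ChaslesR _ a (INR n / (1 + al)) (INR n)) by (apply PC_ex_RInt; try (apply PC_frac_diff_sq); lra).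
rewrite (RInt_extR _ (fun _ => al ^ 2) a); [|easy|].
2:{ intros x Hx; unfold frac_diff_sq; specialize (Hk x ltac:(lra)).
  rewrite (frac_eq (Z.of_nat n - 1) x), (frac_eq (Z.of_nat n - 1)); rewrite ?minus_IZR, ?En; try nra.
  field; nra. }
rewrite RInt_constR.
rewrite (RInt_extR _ (fun x => / x ^ 2 - 2 * al / x + al ^ 2) (INR n / (1 + al))); [|lra|].
2:{ intros x Hx; unfold frac_diff_sq; specialize (Hk' x ltac:(lra)).
  rewrite (frac_eq (Z.of_nat n - 1) x), (frac_eq (Z.of_nat n)); rewrite ?minus_IZR, ?En; try nra.
  field; nra. }
rewrite (RInt_FTC (fun x => - / x - 2 * al * ln x + al ^ 2 * x)); [|lra| |].
- rewrite ln_div by lra; rfield; lra.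
- intros x Hx; auto_derive; [repeat split; lra|]; field; lra.
- intros x Hx; auto_cont; repeat split; nra.
Qed.

(** Summation over cells. The terms [al / n] add up to [al] times a harmonic sum, which yields
    [- al ln al] once [P] is about [1 / al]. *)
Lemma frac_diff_exact al N (P : nat) : 0 < al -> (1 <= P)%nat -> al * INR P <= 1 -> 1 + al <= N ->
  RInt (frac_diff_sq (1 + al)) (/ N) (INR P) =
  al ^ 2 * (INR P - / N) + al * harmonic P - 2 * al * INR P * ln (1 + al).
Proof.
intros Hal HP HaP HN.
assert (HN0 : 0 < / N) by (apply Rinv_0_lt_compat; lra).
assert (HN1 : / N <= 1) by (rewrite <- Rinv_1; apply Rinv_le_contravar; lra).
induction HP.
- rewrite (frac_diff_cell_exact al 1); simpl INR; try lra; try lia.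
  + simpl harmonic; rewrite Rplus_0_l, Rinv_1; simpl INR; rfield; lra.
  + simpl in HaP; lra.
  + unfold Rdiv; rewrite Rmult_1_l; apply Rinv_le_contravar; lra.
- assert (Hm : 1 <= INR m) by (apply le_INR in HP; now simpl in HP).
  rewrite S_INR in HaP.
  rewrite <- (RInt_ChaslesR _ (/ N) (INR m) (INR (S m))).
  2,3: apply PC_ex_RInt; try (apply PC_frac_diff_sq); rewrite ?S_INR; lra.
  rewrite IHHP by lra.
  rewrite (frac_diff_cell_exact al (S m) (INR m)); rewrite ?S_INR; try lra; try lia.
  + change (harmonic (S m)) with (harmonic m + / INR (S m)); rewrite S_INR; rfield; lra.
  + apply (Rmult_le_reg_r (1 + al)); [lra|]; unfold Rdiv; rewrite Rmult_assoc, Rinv_l by lra; nra.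
Qed.

Lemma interval_var_tail : exists c, forall X, 1 <= X ->
  Rabs (RInt (fun y => interval_var y * / y ^ 2) 1 X - c) <= / X.
Proof.
assert (PCi : PC (fun y => interval_var y * / y ^ 2)) by (apply PC_mult; [apply PC_interval_var|apply PC_inv_sq]).
apply (tail_limit (fun X => RInt (fun y => interval_var y * / y ^ 2) 1 X) (fun x => / x)).
- intros x y Hxy; rewrite <- (RInt_ChaslesR _ 1 x y) by (apply PC_ex_RInt; auto; lra).
  replace (_ + _ - _) with (RInt (fun y => interval_var y * / y ^ 2) x y) by rring.
  apply Rle_trans with (- / y - - / x).
  + apply (RInt_abs_le_derive _ (fun x => - / x) (fun x => / x ^ 2)); [lra|apply PC_ex_RInt; auto; lra| | |].
    * intros z Hz; auto_derive; [lra|field; lra].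
    * intros z Hz; apply continuous_inv_sq; lra.
    * intros z Hz; destruct (interval_var_bound z).
      assert (0 < / z ^ 2) by (apply Rinv_0_lt_compat; nra).
      rewrite Rabs_pos_eq; nra.
  + assert (0 < / y) by (apply Rinv_0_lt_compat; lra); lra.
- intros eps He; destruct (inv_lt_eps 1 eps) as (X & HX & H); try lra; exists X; lra.
Qed.

Lemma RInt_interval_var_scale al a b : 0 < al -> 0 < a -> a <= b ->
  RInt (fun x => interval_var (al * x) * / x ^ 2) a b = al * RInt (fun y => interval_var y * / y ^ 2) (al * a) (al * b).
Proof.
intros Hal Ha Hab.
assert (PCi : PC (fun y => interval_var y * / y ^ 2)) by (apply PC_mult; [apply PC_interval_var|apply PC_inv_sq]).
assert (Hex : ex_RInt (fun y => interval_var y * / y ^ 2) (al * a) (al * b)).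
{ apply PC_ex_RInt; auto; [now apply Rmult_lt_0_compat|apply Rmult_le_compat_l; lra]. }
rewrite <- RInt_scalR by easy.
rewrite <- (Rplus_0_r (al * a)), <- (Rplus_0_r (al * b)).
rewrite <- (RInt_comp_lin (fun y => al * (interval_var y * / y ^ 2)) al 0).
- apply RInt_extR; auto; intros x Hx; change (scal al ?z) with (al * z); rewrite Rplus_0_r; field; lra.
- rewrite !Rplus_0_r; now apply ex_RInt_scalR.
Qed.

(* Up to [x = 1 / al] the interval [(x, (1 + al) x]] holds at most one integer and everything is explicit;
   beyond, the count is averaged over unit cells. *)
Lemma frac_diff_asymp : exists c, forall al (n : nat), 0 < al <= / 2 -> / al ^ 2 <= INR n ->
  Rabs (RInt (frac_diff_sq (1 + al)) (/ INR n) (INR n) - al * (c - ln al)) <= 100 * al ^ 2.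
Proof.
destruct harmonic_ln as [g Hg]; destruct interval_var_tail as [c Hc].
(* [g] is the constant of the harmonic sum, [-1] comes from [al^2 P - 2 al P ln (1 + al)], which is
   close to [al - 2 al], and [c] is the integral of [interval_var y / y^2] over [y >= 1]. *)
exists (g - 1 + c); intros al n Hal Hn.
assert (Hia : 2 <= / al).
{ rewrite <- (Rinv_inv 2); apply Rinv_le_contravar; lra. }
assert (Hinv : al * / al = 1) by (field; lra).
assert (Hn4 : / al * / al <= INR n) by (replace (/ al * / al) with (/ al ^ 2) by (field; lra); easy).
(* The integer part of [1 / al], so that [al P] lies in [[1 - al, 1]]. *)
set (P := Z.to_nat (Int_part (/ al))).
destruct (base_Int_part (/ al)) as [HI1 HI2].
assert (HP0 : (1 <= Int_part (/ al))%Z).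
{ apply Z.lt_succ_r with (n := 1%Z); apply lt_IZR; rewrite succ_IZR; simpl; lra. }
assert (HPI : INR P = IZR (Int_part (/ al))).
{ unfold P; rewrite INR_IZR_INZ, Z2Nat.id by lia; easy. }
assert (HP1 : INR P <= / al) by lra.
assert (HP2 : / al < INR P + 1) by lra.
assert (HP : (2 <= P)%nat).
{ apply INR_lt with (n := 1%nat); simpl; lra. }
assert (HP3 : 2 <= INR P) by (apply le_INR in HP; simpl in HP; lra).
assert (HaP1 : al * INR P <= 1) by nra.
assert (HaP2 : 1 - al <= al * INR P) by nra.
assert (HPn : (P <= n)%nat) by (apply INR_le; nra).
assert (HPn' : INR P <= INR n) by now apply le_INR.
assert (Hn0 : 4 <= INR n) by nra.
assert (Hin : 0 < / INR n) by (apply Rinv_0_lt_compat; lra).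
assert (Hin2 : / INR n <= al ^ 2).
{ rewrite <- (Rinv_inv (al ^ 2)); apply Rinv_le_contravar; [apply Rinv_0_lt_compat; nra|easy]. }
assert (HinP : / INR P <= 2 * al).
{ apply (Rmult_le_reg_r (INR P)); [lra|]; rewrite Rinv_l by lra; nra. }
assert (HinP0 : 0 < / INR P) by (apply Rinv_0_lt_compat; lra).
assert (PCi : PC (fun y => interval_var y * / y ^ 2)) by (apply PC_mult; [apply PC_interval_var|apply PC_inv_sq]).
assert (PCs : PC (fun x => interval_var (al * x) * / x ^ 2)).
{ apply PC_mult; [apply (PC_scale interval_var); [lra|apply PC_interval_var]|apply PC_inv_sq]. }
assert (PCd : PC (frac_diff_sq (1 + al))) by (apply PC_frac_diff_sq; lra).
rewrite <- (RInt_ChaslesR _ (/ INR n) (INR P) (INR n)) by (apply PC_ex_RInt; auto; nra).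
rewrite (frac_diff_exact al (INR n) P) by (try lra; lia).
assert (BT := frac_diff_tail al P n ltac:(lra) HP HPn).
rewrite RInt_minusR in BT; [|apply PC_ex_RInt; auto; lra|apply PC_ex_RInt; auto; lra].
assert (BT' : (8 * al + 4 / INR P) * (/ (INR P - 1) - / (INR n - 1)) <= 64 * al ^ 2).
{ assert (0 < / (INR n - 1)) by (apply Rinv_0_lt_compat; lra).
  assert (/ (INR P - 1) <= 4 * al).
  { apply Rle_trans with (2 * / INR P); [|lra].
    apply (Rmult_le_reg_r (INR P * (INR P - 1))); [nra|].
    replace (/ (INR P - 1) * (INR P * (INR P - 1))) with (INR P) by (field; lra).
    replace (2 * / INR P * (INR P * (INR P - 1))) with (2 * (INR P - 1)) by (field; lra); lra. }
  assert (0 < / (INR P - 1)) by (apply Rinv_0_lt_compat; lra).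
  unfold Rdiv; apply Rle_trans with ((16 * al) * (4 * al)); [|lra].
  apply Rle_trans with ((8 * al + 4 * / INR P) * (4 * al)); [apply Rmult_le_compat_l; lra|apply Rmult_le_compat_r; lra]. }
rewrite RInt_interval_var_scale in BT by lra.
assert (Han : 1 <= al * INR n).
{ apply Rle_trans with (al * (/ al * / al)); [nra|apply Rmult_le_compat_l; lra]. }
rewrite <- (RInt_ChaslesR _ (al * INR P) 1 (al * INR n)) in BT by (apply PC_ex_RInt; auto; lra).
assert (Bc := Hc (al * INR n) Han).
assert (Hian : / (al * INR n) <= al).
{ rewrite <- (Rinv_inv al) at 2; apply Rinv_le_contravar; [lra|].
  apply (Rmult_le_compat_l al) in Hn4; [|lra]; nra. }
assert (Bm : Rabs (RInt (fun y => interval_var y * / y ^ 2) (al * INR P) 1) <= (1 - al * INR P) * 4).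
{ apply RInt_const_bound; [easy|apply PC_ex_RInt; auto; lra|].
  intros y Hy; destruct (interval_var_bound y).
  assert (0 < / y ^ 2) by (apply Rinv_0_lt_compat; nra).
  assert (/ y ^ 2 <= 4) by (replace 4 with (/ (/ 2) ^ 2) by field; apply Rinv_le_contravar; nra).
  rewrite Rabs_pos_eq; nra. }
assert (Bh := Hg P ltac:(lia)).
assert (HlnP : ln (INR P) = ln (al * INR P) - ln al) by (rewrite ln_mult; lra).
assert (Bl1 := ln_le_sub (al * INR P) ltac:(lra)).
assert (Bl2 := ln_ge_inv (al * INR P) ltac:(lra)).
assert (Bl3 : / (al * INR P) <= 1 + 2 * al).
{ apply (Rmult_le_reg_r (al * INR P)); [lra|]; rewrite Rinv_l by lra; nra. }
assert (Ba1 := ln_le_sub (1 + al) ltac:(lra)).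
assert (Ba2 := ln_ge_inv (1 + al) ltac:(lra)).
assert (Ba3 : / (1 + al) <= 1 - al + al ^ 2).
{ apply (Rmult_le_reg_r (1 + al)); [lra|]; rewrite Rinv_l by lra; nra. }
revert BT Bc Bm Bh; rewrite HlnP; rint_atoms; intros BT Bc Bm Bh.
apply Rabs_le_between in BT, Bc, Bm, Bh.
set (u := al * INR P) in *; set (La := ln (1 + al)) in *; set (Lu := ln u) in *; set (La0 := ln al) in *.
replace (al ^ 2 * (INR P - / INR n) + al * harmonic P - 2 * al * INR P * La) with
 (al * u - al ^ 2 * / INR n + al * harmonic P - 2 * u * La) by (unfold u; ring).
assert (E1 : Rabs (al * u - al) <= al ^ 2) by (apply Rabs_le; nra).
assert (E2 : Rabs (2 * u * La - 2 * al) <= 4 * al ^ 2).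
{ replace (2 * u * La - 2 * al) with (2 * u * (La - al) + 2 * (u - 1) * al) by ring.
  apply Rabs_le; assert (- al ^ 2 <= La - al <= 0) by lra; nra. }
assert (E3 : Rabs (al * harmonic P - al * (g - La0)) <= 4 * al ^ 2).
{ replace (al * harmonic P - al * (g - La0)) with (al * ((harmonic P - (Lu - La0) - g) + Lu)) by ring.
  rewrite Rabs_mult, (Rabs_pos_eq al) by lra.
  replace (4 * al ^ 2) with (al * (4 * al)) by ring; apply Rmult_le_compat_l; [lra|]; apply Rabs_le; lra. }
assert (E4 : 0 <= al ^ 2 * / INR n <= al ^ 2).
{ assert (/ INR n <= 1) by nra; split; [apply Rmult_le_pos; nra|nra]. }
apply Rabs_le_between in E1, E2, E3.
match type of BT with _ <= ?A - al * (?B + ?D) <= _ =>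
 assert (E5 : Rabs (al * (B + D) - al * c) <= 5 * al ^ 2) end.
{ rewrite <- Rmult_minus_distr_l, Rabs_mult, (Rabs_pos_eq al) by lra.
  replace (5 * al ^ 2) with (al * (5 * al)) by ring; apply Rmult_le_compat_l; [lra|]; apply Rabs_le; lra. }
apply Rabs_le_between in E5; apply Rabs_le; nra.
Qed.

(** * Expansion of the logarithmic autocorrelation at 0 *)

Definition frac_sq x := frac_part x ^ 2 * / x ^ 2.

Lemma PC_frac_sq : PC frac_sq.
Proof. apply PC_mult; [apply PC_pow, PC_frac|apply PC_inv_sq]. Qed.

Lemma ex_frac_sq a b : 0 < a -> a <= b -> ex_RInt frac_sq a b.
Proof. intros; apply PC_ex_RInt; auto; apply PC_frac_sq. Qed.

Lemma frac_sq_bound x : 0 < x -> 0 <= frac_sq x <= 1 /\ frac_sq x <= / x ^ 2.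
Proof.
intros Hx; unfold frac_sq; pose proof (frac_bounds x); pose proof (frac_le x ltac:(lra)).
assert (0 < / x ^ 2) by (apply Rinv_0_lt_compat; nra).
assert (E : x ^ 2 * / x ^ 2 = 1) by (field; lra).
assert (frac_part x ^ 2 <= x ^ 2) by nra.
assert (0 <= frac_part x ^ 2 <= 1) by nra.
repeat split; nra.
Qed.

Lemma RInt_bound_inv_sq f a b : 0 < a -> a <= b -> ex_RInt f a b ->
  (forall x, a < x < b -> Rabs (f x) <= / x ^ 2) -> Rabs (RInt f a b) <= / a - / b.
Proof.
intros Ha Hab Hex Hf.
replace (/ a - / b) with (- / b - - / a) by ring.
apply (RInt_abs_le_derive _ (fun x => - / x) (fun x => / x ^ 2)); auto.
- intros x Hx; auto_derive; [lra|field; lra].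
- intros x Hx; apply continuous_inv_sq; lra.
Qed.

Lemma frac_sq_large a b : 0 < a -> a <= b -> 0 <= RInt frac_sq a b <= / a.
Proof.
intros Ha Hab; assert (Hex := ex_frac_sq a b Ha Hab).
assert (B := RInt_bound_inv_sq frac_sq a b Ha Hab Hex).
assert (0 < / b) by (apply Rinv_0_lt_compat; lra).
split.
- apply RInt_ge_0; auto; intros x Hx; apply frac_sq_bound; lra.
- apply Rle_trans with (/ a - / b); [|lra].
  eapply Rle_trans; [apply Rle_abs|apply B].
  intros x Hx; destruct (frac_sq_bound x) as [[? ?] ?]; [lra|]; rewrite Rabs_pos_eq; easy.
Qed.

Lemma frac_sq_small a b : 0 < a -> a <= b -> 0 <= RInt frac_sq a b <= b - a.
Proof.
intros Ha Hab; assert (Hex := ex_frac_sq a b Ha Hab); split.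
- apply RInt_ge_0; auto; intros x Hx; apply frac_sq_bound; lra.
- rewrite <- (Rmult_1_r (b - a)); eapply Rle_trans; [apply Rle_abs|].
  apply RInt_const_bound; auto.
  intros x Hx; destruct (frac_sq_bound x) as [[? ?] ?]; [lra|]; rewrite Rabs_pos_eq; easy.
Qed.

Lemma frac_sq_total a b : 0 < a -> a <= b -> 0 <= RInt frac_sq a b <= 2.
Proof.
intros Ha Hab.
destruct (Rle_dec b 1) as [Hb|Hb]; [pose proof (frac_sq_small a b Ha Hab); lra|].
destruct (Rle_dec 1 a) as [Ha1|Ha1].
- pose proof (frac_sq_large a b Ha Hab).
  assert (/ a <= 1) by (rewrite <- Rinv_1; apply Rinv_le_contravar; lra); lra.
- rewrite <- (RInt_ChaslesR _ a 1 b) by (apply ex_frac_sq; lra).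
  pose proof (frac_sq_small a 1 Ha ltac:(lra)); pose proof (frac_sq_large 1 b ltac:(lra) ltac:(lra)); lra.
Qed.

Lemma RInt_frac_sq_scale l a b : 0 < l -> 0 < a -> a <= b ->
  RInt (fun x => frac_part (l * x) ^ 2 * / x ^ 2) a b = l * RInt frac_sq (l * a) (l * b).
Proof.
intros Hl Ha Hab.
assert (Hex : ex_RInt frac_sq (l * a) (l * b)).
{ apply ex_frac_sq; [now apply Rmult_lt_0_compat|apply Rmult_le_compat_l; lra]. }
rewrite <- RInt_scalR by easy.
rewrite <- (Rplus_0_r (l * a)), <- (Rplus_0_r (l * b)).
rewrite <- (RInt_comp_lin (fun y => l * frac_sq y) l 0).
- apply RInt_extR; auto; intros x Hx; change (scal l ?z) with (l * z); rewrite Rplus_0_r; unfold frac_sq; field; lra.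
- rewrite !Rplus_0_r; now apply ex_RInt_scalR.
Qed.

Lemma PC_frac_sq_scale l : 0 < l -> PC (fun x => frac_part (l * x) ^ 2 * / x ^ 2).
Proof. intros; apply PC_mult; [now apply PC_pow, PC_frac_scale|apply PC_inv_sq]. Qed.

Lemma inv_le_self N : 1 <= N -> 0 < / N /\ / N <= 1.
Proof.
intros; split; [apply Rinv_0_lt_compat; lra|rewrite <- Rinv_1; apply Rinv_le_contravar; lra].
Qed.

Lemma frac_corr_1 N : 1 <= N -> frac_corr N 1 = RInt frac_sq (/ N) N.
Proof.
intros HN; destruct (inv_le_self N HN); unfold frac_corr; apply RInt_extR; [lra|].
intros x _; unfold frac_weight, frac_sq; rewrite Rmult_1_l; ring.
Qed.

(** Arithmetic-geometric mean: with [r^2 l = 1], the product [r {x} {l x}] is at most half of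
    [{x}^2 + r^2 {l x}^2], and the second square scales back to an integral of the same kind as the
    first. *)
Lemma log_corr_bound m tau : 0 <= m -> Rabs (log_corr m tau) <= 2.
Proof.
intros Hm; unfold log_corr; set (N := exp m); set (l := exp tau).
assert (HN : 1 <= N) by now apply exp_ge_1.
assert (Hl : 0 < l) by apply exp_pos.
destruct (inv_le_self N HN) as [HN1 HN2].
set (r := exp (- tau / 2)); assert (Hr : 0 < r) by apply exp_pos.
assert (Er : r * r * l = 1) by (unfold r, l; rewrite <- !exp_plus, <- exp_0; f_equal; field).
unfold frac_corr; rewrite <- RInt_scalR by now apply ex_frac_corr.
apply Rle_trans with (RInt (fun x => / 2 * frac_sq x + / 2 * (r * r * (frac_part (l * x) ^ 2 * / x ^ 2))) (/ N) N).
- assert (PC2 : PC (fun x => r * r * (frac_part (l * x) ^ 2 * / x ^ 2))) by (apply PC_mult; [apply PC_const|now apply PC_frac_sq_scale]).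
  apply RInt_abs_le; [lra| | |].
  + now apply ex_RInt_scalR, ex_frac_corr.
  + apply PC_ex_RInt; try lra; apply PC_plus; apply PC_mult; try apply PC_const; [apply PC_frac_sq|exact PC2].
  + intros x Hx; unfold frac_weight, frac_sq.
    pose proof (frac_bounds x); pose proof (frac_bounds (l * x)).
    assert (0 < / x ^ 2) by (apply Rinv_0_lt_compat; nra).
    set (p := frac_part x) in *; set (q := frac_part (l * x)) in *; set (w := / x ^ 2) in *.
    assert (0 <= p * q) by nra.
    rewrite Rabs_pos_eq by (replace (r * (p * w * q)) with (r * w * (p * q)) by ring; apply Rmult_le_pos; nra).
    assert (0 <= w * (p - r * q) ^ 2) by (apply Rmult_le_pos; [lra|apply pow2_ge_0]); nra.
- rewrite RInt_lin2.
  2:{ apply ex_frac_sq; lra. }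
  2:{ apply PC_ex_RInt; try lra; apply PC_mult; [apply PC_const|now apply PC_frac_sq_scale]. }
  rewrite RInt_scalR by (apply PC_ex_RInt; try lra; now apply PC_frac_sq_scale).
  rewrite RInt_frac_sq_scale by lra.
  rewrite <- Rmult_assoc with (r1 := r * r), Er.
  assert (0 < l * / N) by now apply Rmult_lt_0_compat.
  assert (l * / N <= l * N) by (apply Rmult_le_compat_l; lra).
  pose proof (frac_sq_total (/ N) N ltac:(lra) ltac:(lra)).
  pose proof (frac_sq_total (l * / N) (l * N) ltac:(lra) ltac:(lra)); lra.
Qed.

Lemma log_corr_0 m : log_corr m 0 = frac_corr (exp m) 1.
Proof. unfold log_corr; replace (- 0 / 2) with 0 by field; rewrite exp_0; ring. Qed.

Lemma log_corr_0_limit : exists I0, forall m, 0 <= m -> Rabs (log_corr m 0 - I0) <= 2 * exp (- m).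
Proof.
destruct (tail_limit (fun N => frac_corr N 1) (fun N => 2 * / N)) as [I0 HI].
- intros x y Hxy; rewrite !frac_corr_1 by lra.
  destruct (inv_le_self x ltac:(lra)); destruct (inv_le_self y ltac:(lra)).
  assert (/ y <= / x) by (apply Rinv_le_contravar; lra).
  rewrite <- (RInt_ChaslesR _ (/ y) (/ x) y), <- (RInt_ChaslesR _ (/ x) x y) by (apply ex_frac_sq; lra).
  pose proof (frac_sq_small (/ y) (/ x) ltac:(lra) ltac:(lra)).
  pose proof (frac_sq_large x y ltac:(lra) ltac:(lra)).
  apply Rabs_le; lra.
- intros eps He; apply (inv_lt_eps 2 eps); lra.
- exists I0; intros m Hm; rewrite log_corr_0, exp_Ropp; apply HI; now apply exp_ge_1.
Qed.

Lemma exp_1_lt_3 x : x <= 1 -> exp x <= 3.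
Proof.
intros Hx; apply Rle_trans with (exp 1); [|apply exp_le_3].
destruct (Req_dec x 1) as [->|]; [lra|apply Rlt_le, exp_increasing; lra].
Qed.

(** Without cut-off the substitution [x -> x / l] exchanges [l] and [1 / l] exactly. With it the
    window is displaced by the factor [l <= 3], and the two end pieces not shared by both windows
    contribute [O(1/N)]. *)
Lemma log_corr_even m tau : 2 <= m -> 0 <= tau <= 1 ->
  Rabs (log_corr m (- tau) - log_corr m tau) <= 6 * exp (- m).
Proof.
intros Hm Ht; unfold log_corr; set (N := exp m).
assert (HN : 3 <= N) by (unfold N; pose proof (exp_ineq1_le m); lra).
rewrite (exp_Ropp tau); replace (- - tau / 2) with (tau / 2) by field.
replace (- tau / 2) with (- (tau / 2)) by field; rewrite exp_Ropp, (exp_Ropp m); fold N.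
set (l := exp tau); set (s := exp (tau / 2)).
assert (Hl1 : 1 <= l) by (apply exp_ge_1; lra).
assert (Hl3 : l <= 3) by (apply exp_1_lt_3; lra).
assert (Hs1 : 1 <= s) by (apply exp_ge_1; lra).
assert (Hs3 : s <= 3) by (apply exp_1_lt_3; lra).
assert (Es : s * s = l) by (unfold s, l; rewrite <- exp_plus; f_equal; field).
destruct (inv_le_self N ltac:(lra)) as [HN1 HN2].
destruct (inv_le_self l Hl1) as [HL1 HL2].
assert (HlN : 0 < / l * / N) by now apply Rmult_lt_0_compat.
assert (HlN1 : / l * / N <= / N) by nra.
assert (HlN2 : 1 <= / l * N).
{ apply (Rmult_le_reg_l l); [lra|]; rewrite <- Rmult_assoc, Rinv_r by lra; lra. }
assert (HlN3 : / l * N <= N) by nra.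
set (F := fun x => frac_weight x * frac_part (l * x)).
assert (PCF : PC F) by (apply PC_frac_corr_integrand; lra).
assert (HexF : forall a b, 0 < a -> a <= b -> ex_RInt F a b) by (intros; now apply PC_ex_RInt).
assert (E1 : l * frac_corr N (/ l) = RInt F (/ l * / N) (/ l * N)).
{ unfold frac_corr.
  rewrite (RInt_extR _ (fun x => / l * (/ l * F (/ l * x + 0)))); [|lra|].
  - rewrite RInt_scalR, (RInt_comp_lin F (/ l) 0), !Rplus_0_r.
    + rewrite <- Rmult_assoc, Rinv_r, Rmult_1_l; [reflexivity|lra].
    + rewrite !Rplus_0_r; apply HexF; lra.
    + apply (ex_RInt_comp_lin F (/ l) 0); rewrite !Rplus_0_r; apply HexF; lra.
  - intros x Hx; unfold F, frac_weight; rewrite Rplus_0_r.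
    replace (l * (/ l * x)) with x by (field; lra); field; lra. }
assert (E2 : frac_corr N l = RInt F (/ N) N) by reflexivity.
assert (B1 : Rabs (RInt F (/ l * / N) (/ N)) <= (/ N - / l * / N) * 3).
{ apply RInt_const_bound; [easy|apply HexF; lra|].
  intros x Hx; unfold F, frac_weight.
  pose proof (frac_bounds x); pose proof (frac_bounds (l * x)).
  pose proof (frac_le x ltac:(lra)); pose proof (frac_le (l * x) ltac:(nra)).
  assert (0 < / x ^ 2) by (apply Rinv_0_lt_compat; nra).
  rewrite Rabs_pos_eq by (apply Rmult_le_pos; nra).
  apply Rle_trans with (x * / x ^ 2 * (l * x)).
  - apply Rmult_le_compat; nra.
  - replace (x * / x ^ 2 * (l * x)) with l by (field; lra); easy. }
assert (B2 : Rabs (RInt F (/ l * N) N) <= / (/ l * N) - / N).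
{ apply RInt_bound_inv_sq; [lra|lra|apply HexF; lra|].
  intros x Hx; unfold F, frac_weight.
  pose proof (frac_bounds x); pose proof (frac_bounds (l * x)).
  assert (0 < / x ^ 2) by (apply Rinv_0_lt_compat; nra).
  rewrite Rabs_pos_eq by (apply Rmult_le_pos; nra).
  replace (frac_part x * / x ^ 2 * frac_part (l * x)) with (/ x ^ 2 * (frac_part x * frac_part (l * x))) by ring.
  assert (0 <= frac_part x * frac_part (l * x) <= 1) by nra; nra. }
assert (E3 : l * frac_corr N (/ l) - frac_corr N l = RInt F (/ l * / N) (/ N) - RInt F (/ l * N) N).
{ rewrite E1, E2.
  assert (C : RInt F (/ l * / N) (/ l * N) + RInt F (/ l * N) N = RInt F (/ l * / N) (/ N) + RInt F (/ N) N).
  { rewrite !RInt_ChaslesR; auto; apply HexF; lra. }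
  revert C; rint_atoms; intros; lra. }
replace (s * frac_corr N (/ l) - / s * frac_corr N l) with (/ s * (l * frac_corr N (/ l) - frac_corr N l)) by (rewrite <- Es; field; lra).
rewrite E3; rewrite Rinv_mult, Rinv_inv in B2.
assert (0 < / s <= 1) by (split; [apply Rinv_0_lt_compat; lra|rewrite <- Rinv_1; apply Rinv_le_contravar; lra]).
rewrite Rabs_mult, (Rabs_pos_eq (/ s)) by lra.
revert B1 B2; rint_atoms; intros B1 B2; apply Rabs_le_between in B1, B2.
match goal with |- / s * Rabs ?z <= _ => assert (Rabs z <= 6 * / N); [apply Rabs_le; nra|pose proof (Rabs_pos z); nra] end.
Qed.

Lemma frac_diff_asymp_real : exists c, forall al N, 0 < al <= / 2 -> 2 <= N ->
  Rabs (RInt (frac_diff_sq (1 + al)) (/ N) N - al * (c - ln al)) <= 100 * al ^ 2 + 2 / N.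
Proof.
destruct frac_diff_asymp as [c Hc]; exists c; intros al N Hal HN.
destruct (INR_unbounded (Rmax N (/ al ^ 2))) as [n Hn].
pose proof (Rmax_l N (/ al ^ 2)); pose proof (Rmax_r N (/ al ^ 2)).
specialize (Hc al n Hal ltac:(lra)).
assert (PCd : PC (frac_diff_sq (1 + al))) by (apply PC_frac_diff_sq; lra).
assert (Hex : forall a b, 0 < a -> a <= b -> ex_RInt (frac_diff_sq (1 + al)) a b) by (intros; now apply PC_ex_RInt).
destruct (inv_le_self N ltac:(lra)) as [HN1 HN2].
assert (HN3 : / N <= / 2) by (apply Rinv_le_contravar; lra).
assert (Hn0 : 0 < / INR n) by (apply Rinv_0_lt_compat; lra).
assert (HnN : / INR n <= / N) by (apply Rinv_le_contravar; lra).
assert (B1 : Rabs (RInt (frac_diff_sq (1 + al)) (/ INR n) (/ N)) <= (/ N - / INR n) * 1).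
{ apply RInt_const_bound; [easy|apply Hex; lra|].
  intros x Hx; unfold frac_diff_sq; rewrite !frac_small by nra.
  replace (((1 + al) * x - x) ^ 2 * / x ^ 2) with (al ^ 2) by (field; lra).
  rewrite Rabs_pos_eq; nra. }
assert (B2 : Rabs (RInt (frac_diff_sq (1 + al)) N (INR n)) <= / N - / INR n).
{ apply RInt_bound_inv_sq; [lra|lra|apply Hex; lra|].
  intros x Hx; unfold frac_diff_sq.
  pose proof (frac_bounds x); pose proof (frac_bounds ((1 + al) * x)).
  assert (0 < / x ^ 2) by (apply Rinv_0_lt_compat; nra).
  assert (0 <= (frac_part ((1 + al) * x) - frac_part x) ^ 2 <= 1) by (split; [apply pow2_ge_0|nra]).
  rewrite Rabs_pos_eq by (apply Rmult_le_pos; lra); nra. }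
rewrite <- (RInt_ChaslesR _ (/ INR n) (/ N) (INR n)), <- (RInt_ChaslesR _ (/ N) N (INR n)) in Hc by (apply Hex; lra).
revert Hc B1 B2; rint_atoms; intros Hc B1 B2.
apply Rabs_le_between in Hc, B1, B2; apply Rabs_le; unfold Rdiv; split; nra.
Qed.

Lemma exp_minus_1_bounds tau : 0 < tau <= / 4 -> tau <= exp tau - 1 <= tau + 2 * tau ^ 2.
Proof.
intros Ht; pose proof (exp_ineq1_le tau); split; [lra|].
pose proof (exp_ineq1_le (- tau)) as H1; rewrite exp_Ropp in H1.
assert (E : exp tau * / exp tau = 1) by (apply Rinv_r; lra).
assert (exp tau * (1 - tau) <= 1) by nra.
nra.
Qed.

Lemma tau_ln_bound tau : 0 < tau <= 1 -> tau * Rabs (ln tau) <= 2 * sqrt tau.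
Proof.
intros Ht; assert (Ht0 : 0 < tau) by lra; sqrt_facts tau Ht0.
assert (E : ln tau = 2 * ln (sqrt tau)) by (rewrite <- H0 at 1; rewrite ln_mult by lra; ring).
assert (Hs : sqrt tau <= 1) by (rewrite <- sqrt_1; apply sqrt_le_1; lra).
pose proof (ln_ge_inv (sqrt tau) H); pose proof (ln_le_sub (sqrt tau) H).
rewrite E, Rabs_left1 by lra.
assert (E1 : sqrt tau * / sqrt tau = 1) by (apply Rinv_r; lra).
assert (B : - (2 * ln (sqrt tau)) <= 2 * / sqrt tau) by lra.
apply Rle_trans with (tau * (2 * / sqrt tau)); [apply Rmult_le_compat_l; lra|].
rewrite <- H0 at 1; nra.
Qed.

(** Polarization: [2 {x} {l x} = {x}^2 + {l x}^2 - ({l x} - {x})^2]. The integrals of the two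
    squares agree up to the factor [l], which produces [2 cosh (tau / 2) - 2], a quantity quadratic
    in [tau]; the displaced cut-off gives the error. *)
Lemma log_corr_expand m tau : 2 <= m -> 0 <= tau <= 1 ->
  Rabs (2 * log_corr m 0 - 2 * log_corr m tau -
    (exp (- tau / 2) * RInt (frac_diff_sq (exp tau)) (/ exp m) (exp m) -
     frac_corr (exp m) 1 * (exp (tau / 2) + exp (- tau / 2) - 2))) <= 9 * exp (- m).
Proof.
intros Hm Ht; rewrite log_corr_0; unfold log_corr; rewrite (exp_Ropp m).
set (N := exp m); set (l := exp tau).
assert (HN : 3 <= N) by (unfold N; pose proof (exp_ineq1_le m); lra).
replace (- tau / 2) with (- (tau / 2)) by field; rewrite exp_Ropp; set (s := exp (tau / 2)).
assert (Hl1 : 1 <= l) by (apply exp_ge_1; lra).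
assert (Hl3 : l <= 3) by (apply exp_1_lt_3; lra).
assert (Hs1 : 1 <= s) by (apply exp_ge_1; lra).
assert (Hs3 : s <= 3) by (apply exp_1_lt_3; lra).
assert (Es : s * s = l) by (unfold s, l; rewrite <- exp_plus; f_equal; field).
destruct (inv_le_self N ltac:(lra)) as [HN1 HN2].
assert (HNl : 0 < l * / N) by (apply Rmult_lt_0_compat; lra).
assert (HNl1 : / N <= l * / N) by nra.
assert (HNl2 : l * / N <= 1) by (apply (Rmult_le_reg_r N); [lra|]; rewrite Rmult_assoc, Rinv_l; lra).
assert (HNl3 : N <= l * N) by nra.
assert (E : 2 * frac_corr N l = RInt frac_sq (/ N) N + l * RInt frac_sq (l * / N) (l * N) - RInt (frac_diff_sq l) (/ N) N).
{ rewrite <- RInt_frac_sq_scale by lra.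
  rewrite <- RInt_plusR by (apply PC_ex_RInt; try apply PC_frac_sq; try (apply PC_frac_sq_scale); lra).
  rewrite <- RInt_minusR.
  2:{ apply PC_ex_RInt; try lra; apply PC_plus; [apply PC_frac_sq|apply PC_frac_sq_scale; lra]. }
  2:{ apply PC_ex_RInt; try lra; apply PC_frac_diff_sq; lra. }
  unfold frac_corr; rewrite <- RInt_scalR by (apply ex_frac_corr; lra).
  apply RInt_extR; [lra|]; intros x _; unfold frac_weight, frac_sq, frac_diff_sq; ring. }
rewrite frac_corr_1 by lra.
assert (C : RInt frac_sq (/ N) (l * / N) + RInt frac_sq (l * / N) (l * N) = RInt frac_sq (/ N) N + RInt frac_sq N (l * N)).
{ rewrite !RInt_ChaslesR; auto; apply ex_frac_sq; lra. }
assert (B1 := frac_sq_small (/ N) (l * / N) HN1 HNl1).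
assert (B2 := frac_sq_large N (l * N) ltac:(lra) HNl3).
assert (Hs : 0 < / s <= 1) by (split; [apply Rinv_0_lt_compat; lra|rewrite <- Rinv_1; apply Rinv_le_contravar; lra]).
assert (Es' : / s * l = s) by (rewrite <- Es; field; lra).
replace (2 * (/ s * frac_corr N l)) with (/ s * (2 * frac_corr N l)) by ring; rewrite E.
revert C B1 B2; rint_atoms; intros C B1 B2.
match goal with |- Rabs (2 * ?I - / s * (?I + l * ?J - ?V) - _) <= _ =>
  replace (2 * I - / s * (I + l * J - V) - (/ s * V - I * (s + / s - 2))) with (s * (I - J) - (/ s * l - s) * J) by ring;
  assert (B3 : - (3 * / N) <= I - J <= 3 * / N) by (split; nra) end.
rewrite Es', Rminus_diag; apply Rabs_le; split; nra.
Qed.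

(** The expansion is carried over from [al = exp tau - 1] to [tau]. The errors are of order
    [tau^2 |ln tau|], for which [tau sqrt tau] is a majorant free of logarithms. *)
Lemma log_corr_asymp : exists b C, 0 <= C /\ forall m tau, 2 <= m -> 0 < tau <= 1 ->
  Rabs (2 * log_corr m 0 - 2 * log_corr m tau - tau * (b - ln tau)) <= C * (tau * sqrt tau + exp (- m)).
Proof.
destruct frac_diff_asymp_real as [c Hc].
set (K := Rabs c); assert (HK : 0 <= K) by apply Rabs_pos.
exists c, (1000 + 100 * K); split; [lra|].
intros m tau Hm Ht; assert (Ht0 : 0 < tau) by lra.
pose proof (sqrt_lt_R0 tau Ht0) as Hs; pose proof (sqrt_sqrt tau ltac:(lra)) as Ess.
assert (Hs1 : sqrt tau <= 1) by (rewrite <- sqrt_1; apply sqrt_le_1; lra).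
pose proof (exp_pos (- m)) as He.
assert (HcK : - K <= c <= K) by (unfold K; split; [pose proof (Rle_abs (- c)); rewrite Rabs_Ropp in *; lra|apply Rle_abs]).
pose proof (tau_ln_bound tau Ht) as Hln.
assert (Hln0 : ln tau <= 0) by (pose proof (ln_le_sub tau Ht0); lra).
rewrite (Rabs_left1 (ln tau)) in Hln by easy.
(* Away from 0 the left side is bounded and [tau sqrt tau] exceeds [1/8], so a large constant
   suffices. *)
destruct (Rle_dec tau (/ 4)) as [Ht4|Ht4].
2:{ pose proof (log_corr_bound m 0 ltac:(lra)) as A1; pose proof (log_corr_bound m tau ltac:(lra)) as A2.
  apply Rabs_le_between in A1, A2.
  assert (/ 2 < sqrt tau) by (apply Rnot_le_lt; intros HH; apply Ht4; nra).
  assert (/ 8 < tau * sqrt tau) by nra.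
  assert (A3 : - (K + 2) <= tau * (c - ln tau) <= K + 2) by (split; nra).
  apply Rle_trans with (10 + K); [apply Rabs_le; lra|nra]. }
destruct (exp_minus_1_bounds tau ltac:(lra)) as [Ha1 Ha2].
set (al := exp tau - 1) in *.
assert (Ha3 : al <= 3 / 2 * tau) by nra.
assert (HN : 3 <= exp m) by (pose proof (exp_ineq1_le m); lra).
specialize (Hc al (exp m) ltac:(lra) ltac:(lra)).
replace (1 + al) with (exp tau) in Hc by (unfold al; ring).
pose proof (log_corr_expand m tau Hm ltac:(lra)) as Hx.
set (V := RInt (frac_diff_sq (exp tau)) (/ exp m) (exp m)) in *.
unfold Rdiv at 1 in Hc; rewrite <- (exp_Ropp m) in Hc.
assert (Hf := frac_sq_total (/ exp m) (exp m)).
rewrite <- frac_corr_1 in Hf by lra.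
destruct (inv_le_self (exp m) ltac:(lra)) as [HN1 HN2]; specialize (Hf HN1 ltac:(lra)).
set (I0 := frac_corr (exp m) 1) in *.
set (h := tau / 2); assert (Hh : 0 < h <= / 8) by (unfold h; lra).
assert (Hth : tau = 2 * h) by (unfold h; field).
replace (tau / 2) with h in Hx by reflexivity; replace (- tau / 2) with (- h) in Hx by (unfold h; field).
destruct (exp_minus_1_bounds h ltac:(lra)) as [Hh1 Hh2].
pose proof (exp_ineq1_le (- h)) as Hh3.
assert (Hh4 : exp (- h) <= 1 - h + h ^ 2).
{ rewrite exp_Ropp; apply (Rmult_le_reg_r (exp h)); [apply exp_pos|].
  rewrite Rinv_l by (pose proof (exp_pos h); lra); nra. }
set (eh := exp h) in *; set (eh' := exp (- h)) in *.
assert (Hla : 0 <= ln al - ln tau <= 2 * tau).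
{ rewrite <- ln_div by lra.
  assert (Hq : 0 < al / tau) by (apply Rdiv_lt_0_compat; lra).
  pose proof (ln_le_sub (al / tau) Hq).
  assert (Hq1 : 1 <= al / tau) by (apply (Rmult_le_reg_r tau); [lra|]; unfold Rdiv; rewrite Rmult_assoc, Rinv_l; lra).
  assert (Hq2 : al / tau <= 1 + 2 * tau).
  { apply (Rmult_le_reg_r tau); [lra|]; unfold Rdiv; rewrite Rmult_assoc, Rinv_l by lra; nra. }
  split; [|lra]; rewrite <- ln_1; apply ln_le; lra. }
set (la := ln al) in *; set (lt := ln tau) in *.
set (w := tau * sqrt tau).
assert (Hw : 0 < w) by (apply Rmult_lt_0_compat; lra).
assert (Htw : tau ^ 2 <= w) by (unfold w; nra).
assert (Htl : tau * (tau * - lt) <= 2 * w) by (unfold w; nra).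
assert (Htl' : 0 <= tau * (tau * - lt)) by (apply Rmult_le_pos; [lra|apply Rmult_le_pos; lra]).
apply Rabs_le_between in Hc, Hx.
assert (E1 : Rabs (al * (c - la) - tau * (c - lt)) <= (2 * K + 8) * w).
{ replace (al * (c - la) - tau * (c - lt)) with ((al - tau) * (c - lt) - al * (la - lt)) by ring.
  assert (F1 : Rabs ((al - tau) * (c - lt)) <= 2 * tau ^ 2 * (K - lt)).
  { rewrite Rabs_mult; apply Rmult_le_compat; try apply Rabs_pos; apply Rabs_le; lra. }
  assert (F2 : Rabs (al * (la - lt)) <= (3 / 2 * tau) * (2 * tau)).
  { rewrite Rabs_mult; apply Rmult_le_compat; try apply Rabs_pos; apply Rabs_le; lra. }
  assert (F3 : 2 * tau ^ 2 * (K - lt) <= 2 * K * w + 4 * w) by nra.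
  apply Rabs_le_between in F1, F2; apply Rabs_le; split; nra. }
apply Rabs_le_between in E1.
set (M := tau * (c - lt)) in *; set (M' := al * (c - la)) in *.
assert (Hal2 : al ^ 2 <= 3 * w) by nra.
assert (E2 : Rabs (V - M) <= (2 * K + 308) * w + 2 * exp (- m)) by (apply Rabs_le; split; lra).
assert (E3 : Rabs M <= K * tau - tau * lt).
{ unfold M; rewrite Rabs_mult, (Rabs_pos_eq tau) by lra.
  replace (K * tau - tau * lt) with (tau * (K - lt)) by ring; apply Rmult_le_compat_l; [lra|apply Rabs_le; lra]. }
assert (E4 : Rabs ((1 - eh') * M) <= K * w + 2 * w).
{ rewrite Rabs_mult; apply Rle_trans with (tau * (K * tau - tau * lt)).
  - apply Rmult_le_compat; try apply Rabs_pos; [apply Rabs_le; split; nra|easy].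
  - replace (tau * (K * tau - tau * lt)) with (K * tau ^ 2 + tau * (tau * - lt)) by ring; nra. }
assert (E5 : Rabs (eh' * (V - M)) <= (2 * K + 308) * w + 2 * exp (- m)).
{ rewrite Rabs_mult; apply Rle_trans with (1 * Rabs (V - M)); [|lra].
  apply Rmult_le_compat_r; [apply Rabs_pos|apply Rabs_le; split; nra]. }
assert (E6 : Rabs (I0 * (eh + eh' - 2)) <= 2 * w).
{ rewrite Rabs_mult; apply Rmult_le_compat; try apply Rabs_pos; apply Rabs_le; [lra|].
  assert (h ^ 2 <= / 4 * w) by (unfold h; nra); split; nra. }
apply Rabs_le_between in E4, E5, E6.
assert (HKe : 0 <= K * exp (- m)) by (apply Rmult_le_pos; lra).
assert (HKw : 0 <= K * w) by (apply Rmult_le_pos; lra).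
replace (eh' * V) with (eh' * (V - M) + M - (1 - eh') * M) in Hx by ring.
apply Rabs_le; split; lra.
Qed.

(** * The cosine transform of the spline and its second difference *)

Lemma spline_hat_formula A tau : 0 <= A -> tau <> 0 -> spline_hat A tau = (A * tau - sin (A * tau)) / tau ^ 3.
Proof.
intros HA Ht; unfold spline_hat, spline_cos.
rewrite (RInt_FTC (fun t => (A - t) ^ 2 / 2 * (sin (t * tau) / tau) - (A - t) * (cos (t * tau) / tau ^ 2) - sin (t * tau) / tau ^ 3)); auto.
- rewrite Rmult_0_l, sin_0, cos_0; rfield; easy.
- intros t _; unfold spline; auto_derive; auto; field; easy.
- intros; apply continuous_spline_cos_integrand.
Qed.

Lemma spline_hat_even A tau : 0 <= A -> spline_hat A (- tau) = spline_hat A tau.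
Proof.
intros HA; apply RInt_extR; auto; intros t _.
replace (t * - tau) with (- (t * tau)) by ring; now rewrite cos_neg.
Qed.

Lemma spline_hat_bound A tau : 0 <= A -> Rabs (spline_hat A tau) <= A ^ 3 / 2.
Proof.
intros HA; replace (A ^ 3 / 2) with ((A - 0) * (A ^ 2 / 2)) by field.
apply RInt_const_bound; [easy|apply ex_spline_cos|].
intros t Ht; destruct (spline_bound A t ltac:(lra)).
assert (Rabs (cos (t * tau)) <= 1) by (apply Rabs_le, COS_bound).
rewrite Rabs_mult, Rabs_pos_eq by easy; pose proof (Rabs_pos (cos (t * tau))); nra.
Qed.

Lemma spline_hat_scale A tau : 0 < A -> spline_hat A tau = A ^ 3 * spline_hat 1 (A * tau).
Proof.
intros HA; destruct (Req_dec tau 0) as [->|Ht].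
- rewrite Rmult_0_r; unfold spline_hat, spline_cos, spline.
  rewrite (RInt_FTC (fun t => - (A - t) ^ 3 / 6)); [|lra| |].
  + rewrite (RInt_FTC (fun t => - (1 - t) ^ 3 / 6)); [rfield|lra| |].
    * intros; rewrite Rmult_0_r, cos_0; auto_derive; auto; field.
    * intros; auto_cont; auto.
  + intros; rewrite Rmult_0_r, cos_0; auto_derive; auto; field.
  + intros; auto_cont; auto.
- rewrite !spline_hat_formula by nra; rewrite Rmult_1_l; field; lra.
Qed.

Lemma ex_spline_hat A a b : 0 <= A -> ex_RInt (spline_hat A) a b.
Proof. intros HA; apply ex_RInt_everywhere; intros; now apply continuous_spline_hat. Qed.

Lemma RInt_spline_hat_scale A X : 0 < A ->
  RInt (spline_hat A) 0 X = A ^ 2 * RInt (spline_hat 1) 0 (A * X).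
Proof.
intros HA.
replace (RInt (spline_hat 1) 0 (A * X)) with (RInt (spline_hat 1) (A * 0 + 0) (A * X + 0)) by (f_equal; ring).
rewrite <- (RInt_comp_lin (spline_hat 1) A 0) by (apply ex_spline_hat; lra).
rewrite <- RInt_scalR.
- apply RInt_ext; intros x _; change (scal A ?z) with (A * z); rewrite Rplus_0_r, spline_hat_scale by easy; rring.
- apply (ex_RInt_comp_lin (spline_hat 1) A 0), ex_spline_hat; lra.
Qed.

Lemma spline_hat_integral : exists kap, forall Y, 1 <= Y -> Rabs (RInt (spline_hat 1) 0 Y - kap) <= 2 / Y.
Proof.
apply (tail_limit (fun Y => RInt (spline_hat 1) 0 Y) (fun Y => 2 / Y)).
- intros x y Hxy; rewrite <- (RInt_ChaslesR _ 0 x y) by (apply ex_spline_hat; lra).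
  replace (_ + _ - _) with (RInt (spline_hat 1) x y) by rring.
  apply Rle_trans with (- (2 / y) - - (2 / x)).
  + apply (RInt_abs_le_derive _ (fun x => - (2 / x)) (fun x => 2 / x ^ 2)); [lra|apply ex_spline_hat; lra| | |].
    * intros z Hz; auto_derive; [lra|field; lra].
    * intros z Hz; auto_cont; apply Rgt_not_eq; nra.
    * intros z Hz; rewrite spline_hat_formula, Rmult_1_l by lra.
      unfold Rdiv; rewrite Rabs_mult, (Rabs_pos_eq (/ z ^ 3)) by (apply Rlt_le, Rinv_0_lt_compat, pow_lt; lra).
      replace (2 * / z ^ 2) with (2 * z * / z ^ 3) by (field; lra).
      apply Rmult_le_compat_r; [apply Rlt_le, Rinv_0_lt_compat, pow_lt; lra|].
      pose proof (SIN_bound z); apply Rabs_le; lra.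
  + assert (0 < 2 / y) by (apply Rdiv_lt_0_compat; lra); lra.
- intros eps He; apply (inv_lt_eps 2 eps); lra.
Qed.

Definition diff2 (f : R -> R) A D := f (A + D) - 2 * f A + f (A - D).

Definition spline_kernel A D tau := diff2 (fun A => spline_hat A tau) A D.

Lemma continuous_spline_kernel A D tau : 0 <= D <= A -> continuous (spline_kernel A D) tau.
Proof.
intros HD; unfold spline_kernel, diff2.
apply (continuous_plus (fun tau => spline_hat (A + D) tau - 2 * spline_hat A tau) (spline_hat (A - D))); [|apply continuous_spline_hat; lra].
apply (continuous_minus (spline_hat (A + D)) (fun tau => 2 * spline_hat A tau)); [apply continuous_spline_hat; lra|].
apply (continuous_mult (fun _ => 2) (spline_hat A)); [apply continuous_const|apply continuous_spline_hat; lra].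
Qed.

Lemma spline_kernel_formula A D tau : 0 <= D <= A -> tau <> 0 ->
  spline_kernel A D tau = 2 * sin (A * tau) * (1 - cos (D * tau)) / tau ^ 3.
Proof.
intros HD Ht; unfold spline_kernel, diff2; rewrite !spline_hat_formula by (easy || lra).
rewrite Rmult_plus_distr_r, Rmult_minus_distr_r, sin_plus, sin_minus; field; easy.
Qed.

Lemma spline_kernel_even A D tau : 0 <= D <= A -> spline_kernel A D (- tau) = spline_kernel A D tau.
Proof. intros HD; unfold spline_kernel, diff2; rewrite !spline_hat_even by lra; easy. Qed.

Lemma spline_kernel_bound A D tau : 0 <= D <= A -> 0 < tau ->
  Rabs (spline_kernel A D tau) <= 2 * (1 - cos (D * tau)) / tau ^ 3.
Proof.
intros HD Ht; rewrite spline_kernel_formula by lra.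
assert (0 < / tau ^ 3) by (apply Rinv_0_lt_compat, pow_lt; lra).
unfold Rdiv; rewrite !Rabs_mult, (Rabs_pos_eq (/ _)), (Rabs_pos_eq 2) by lra.
apply Rmult_le_compat_r; [lra|].
pose proof (COS_bound (D * tau)); rewrite (Rabs_pos_eq (1 - _)) by lra.
assert (Rabs (sin (A * tau)) <= 1) by (apply Rabs_le, SIN_bound).
apply Rmult_le_compat_r; lra.
Qed.

Lemma cos_lower x : 1 - x ^ 2 / 2 <= cos x.
Proof.
replace x with (2 * (x / 2)) at 2 by field; rewrite cos_2a_sin.
assert (Rabs (sin (x / 2)) <= Rabs (x / 2)).
{ assert (H := fun a b => mvt_bound sin cos a b 1).
  assert (H' : forall a b, a <= b -> Rabs (sin b - sin a) <= 1 * (b - a)).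
  { intros a b Hab; apply H; auto.
    - intros; auto_derive; auto; ring.
    - intros; apply Rabs_le, COS_bound. }
  destruct (Rle_dec 0 (x / 2)).
  - specialize (H' 0 (x / 2) r); rewrite sin_0, !Rminus_0_r in H'; rewrite (Rabs_pos_eq (x / 2)) by easy; lra.
  - specialize (H' (x / 2) 0 ltac:(lra)); rewrite sin_0 in H'; rewrite Rabs_minus_sym, Rminus_0_r in H'.
    rewrite (Rabs_left1 (x / 2)) by lra; lra. }
apply Rsqr_le_abs_1 in H; unfold Rsqr in H; nra.
Qed.

(** [1 - cos x] is at most [x^2 / 2] and at most 2; the first bound settles [x <= 1], the second
    [x > 1]. The power [(1 + x)^(3/2)] is chosen because its reciprocal has an elementary
    primitive. *)
Lemma kernel_decay x : 0 < x -> 2 * (1 - cos x) * ((1 + x) * sqrt (1 + x)) <= 12 * (x * sqrt x).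
Proof.
intros Hx; pose proof (cos_lower x) as H1; pose proof (COS_bound x) as H2.
pose proof (sqrt_lt_R0 x Hx) as Hs; pose proof (sqrt_sqrt x ltac:(lra)) as Es.
pose proof (sqrt_lt_R0 (1 + x) ltac:(lra)) as Hs'; pose proof (sqrt_sqrt (1 + x) ltac:(lra)) as Es'.
set (s := sqrt x) in *; set (s' := sqrt (1 + x)) in *.
destruct (Rle_dec x 1) as [Hx1|Hx1].
- assert (s <= 1) by nra. assert (s' <= 3 / 2) by nra.
  assert ((1 + x) * s' <= 3) by nra.
  assert (0 <= (1 + x) * s') by nra.
  assert (2 * (1 - cos x) * ((1 + x) * s') <= x ^ 2 * 3) by (apply Rmult_le_compat; lra).
  assert (x <= s) by nra. nra.
- assert (s' <= 3 / 2 * s) by nra.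
  assert ((1 + x) * s' <= 2 * x * (3 / 2 * s)) by (apply Rmult_le_compat; lra).
  assert (0 <= (1 + x) * s') by nra.
  assert (2 * (1 - cos x) * ((1 + x) * s') <= 4 * (2 * x * (3 / 2 * s))) by (apply Rmult_le_compat; lra).
  lra.
Qed.

(** Away from 0 the kernel is at most [4 / tau^3], uniformly in [A] and [D], so boundedness of [f]
    gives a bounded contribution. *)
Lemma spline_kernel_tail A D X : 0 <= D <= A -> 1 <= X -> forall f, (forall x, continuous f x) ->
  (forall x, 1 < x -> Rabs (f x) <= 8) -> Rabs (RInt (fun tau => f tau * spline_kernel A D tau) 1 X) <= 16.
Proof.
intros HD HX f Hf Hb.
apply Rle_trans with (- (16 / X ^ 2) - - (16 / 1 ^ 2)).
- apply (RInt_abs_le_derive _ (fun x => - (16 / x ^ 2)) (fun x => 32 / x ^ 3)); auto.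
  + apply ex_RInt_cont; auto; intros; apply (continuous_mult f (spline_kernel A D)); [auto|now apply continuous_spline_kernel].
  + intros x Hx; auto_derive; [nra|field; lra].
  + intros x Hx; auto_cont; apply Rgt_not_eq; apply (pow_lt x 3); lra.
  + intros x Hx; rewrite Rabs_mult.
    assert (H1 := spline_kernel_bound A D x HD ltac:(lra)).
    replace (32 / x ^ 3) with (8 * (4 / x ^ 3)) by (field; lra).
    apply Rmult_le_compat; try apply Rabs_pos; [apply Hb; lra|].
    eapply Rle_trans; [apply H1|]; apply Rmult_le_compat_r; [apply Rlt_le, Rinv_0_lt_compat, pow_lt; lra|].
    pose proof (COS_bound (D * x)); lra.
- assert (0 < 16 / X ^ 2) by (apply Rdiv_lt_0_compat; [lra|apply pow_lt; lra]); lra.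
Qed.

Lemma continuous_32 x : 0 <= x -> continuous (fun x => x * sqrt x) x.
Proof.
intros Hx; apply (continuous_mult (fun x : R => x) sqrt); [apply continuous_id|apply continuous_sqrt].
Qed.

Lemma continuous_abs_spline_kernel A D x : 0 <= D <= A -> continuous (fun x => Rabs (spline_kernel A D x)) x.
Proof.
intros HD; apply (continuous_comp (spline_kernel A D) Rabs); [now apply continuous_spline_kernel|apply continuous_Rabs].
Qed.

(** By the scaling [x = D tau] the integral is of order [sqrt D]; the majorant of the integrand has
    the primitive [- 24 sqrt D / sqrt (1 + D x)]. *)
Lemma spline_kernel_error A D : 0 < D <= A ->
  RInt (fun tau => tau * sqrt tau * Rabs (spline_kernel A D tau)) 0 1 <= 24 * sqrt D.
Proof.
intros HD; assert (HD0 : 0 < D) by lra; sqrt_facts D HD0.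
eapply Rle_trans; [apply Rle_abs|].
apply Rle_trans with (- (24 * sqrt D) / sqrt (1 + D * 1) - - (24 * sqrt D) / sqrt (1 + D * 0)).
- apply (RInt_abs_le_derive _ (fun x => - (24 * sqrt D) / sqrt (1 + D * x))
    (fun x => 12 * (D * sqrt D) / ((1 + D * x) * sqrt (1 + D * x)))); [lra| | | |].
  + apply ex_RInt_cont; [lra|]; intros x Hx.
    apply (continuous_mult (fun x => x * sqrt x) (fun x => Rabs (spline_kernel A D x))); [apply continuous_32; lra|].
    apply continuous_abs_spline_kernel; lra.
  + intros x Hx; assert (Hx0 : 0 < 1 + D * x) by nra; sqrt_facts (1 + D * x) Hx0.
    auto_derive; [repeat split; lra|].
    set (y := 1 + D * x) in *; generalize dependent (sqrt y); intros s Hs Es; rewrite <- Es; field; lra.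
  + intros x Hx; assert (Hx0 : 0 < 1 + D * x) by nra; sqrt_facts (1 + D * x) Hx0.
    auto_cont; repeat split; try lra.
    apply Rgt_not_eq, Rmult_lt_0_compat; lra.
  + intros x Hx; assert (Hx0 : 0 < x) by lra; sqrt_facts x Hx0.
    assert (HDx : 0 < D * x) by now apply Rmult_lt_0_compat.
    assert (Hk := spline_kernel_bound A D x ltac:(lra) Hx0).
    assert (Hd := kernel_decay (D * x) HDx).
    rewrite sqrt_mult in Hd by lra.
    assert (Hx1 : 0 < 1 + D * x) by lra; sqrt_facts (1 + D * x) Hx1.
    assert (Hp : 0 < (1 + D * x) * sqrt (1 + D * x)) by now apply Rmult_lt_0_compat.
    set (P := (1 + D * x) * sqrt (1 + D * x)) in *.
    assert (Hss : 0 < x * sqrt x) by (apply Rmult_lt_0_compat; lra).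
    rewrite Rabs_mult, Rabs_Rabsolu, (Rabs_pos_eq (x * sqrt x)) by lra.
    apply Rle_trans with (x * sqrt x * (2 * (1 - cos (D * x)) / x ^ 3)).
    { apply Rmult_le_compat_l; lra. }
    apply (Rmult_le_reg_r (P * (x * sqrt x))); [repeat apply Rmult_lt_0_compat; lra|].
    replace (12 * (D * sqrt D) / P * (P * (x * sqrt x))) with (12 * (D * x * (sqrt D * sqrt x))) by (field; lra).
    replace (x * sqrt x * (2 * (1 - cos (D * x)) / x ^ 3) * (P * (x * sqrt x))) with
     (2 * (1 - cos (D * x)) * P * ((sqrt x * sqrt x) * / x)) by (field; lra).
    rewrite H2, Rinv_r, Rmult_1_r by lra; easy.
- rewrite Rmult_0_r, Rplus_0_r, sqrt_1.
  assert (0 < sqrt (1 + D * 1)) by (apply sqrt_lt_R0; lra).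
  assert (0 < 24 * sqrt D / sqrt (1 + D * 1)) by (apply Rdiv_lt_0_compat; lra).
  unfold Rdiv in *; lra.
Qed.

Lemma sqrt_lt_of_sq x e : 0 < e -> 0 <= x -> x < e ^ 2 -> sqrt x < e.
Proof.
intros He Hx H; rewrite <- (sqrt_pow2 e) by lra; now apply sqrt_lt_1_alt.
Qed.

(** Continuity at 0 is two-sided. Since [ln] is 0 at non-positive arguments, one bound in terms of
    [|x|] serves both sides for functions such as [x (b - ln x)]. *)
Lemma continuous_at_0 (f : R -> R) K : f 0 = 0 ->
  (forall x, Rabs x <= 1 -> Rabs (f x) <= K * sqrt (Rabs x)) -> continuous f 0.
Proof.
intros H0 H; apply continuity_pt_filterlim; intros e He.
assert (HK : 0 < Rabs K + 1) by (pose proof (Rabs_pos K); lra).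
set (d := e / (Rabs K + 1)); assert (Hd : 0 < d) by now apply Rdiv_lt_0_compat.
exists (Rmin 1 (d ^ 2)); split; [apply Rmin_pos; [lra|now apply pow_lt]|].
intros y [_ Hy]; simpl in Hy; unfold R_dist in Hy; rewrite Rminus_0_r in Hy.
change (dist R_met (f y) (f 0)) with (Rabs (f y - f 0)); rewrite H0, Rminus_0_r.
assert (Hy1 := Rlt_le_trans _ _ _ Hy (Rmin_l _ _)); assert (Hy2 := Rlt_le_trans _ _ _ Hy (Rmin_r _ _)).
assert (Hs := sqrt_lt_of_sq (Rabs y) d Hd (Rabs_pos y) Hy2).
specialize (H y ltac:(lra)); pose proof (sqrt_pos (Rabs y)); pose proof (Rle_abs K).
apply Rle_lt_trans with ((Rabs K + 1) * sqrt (Rabs y)); [nra|].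
replace e with ((Rabs K + 1) * d) by (unfold d; field; lra); now apply Rmult_lt_compat_l.
Qed.

(** Admits 0 as an end point in the fundamental theorem of calculus, which asks for a two-sided
    derivative there. *)
Lemma is_derive_at_0 (f : R -> R) K : f 0 = 0 ->
  (forall x, Rabs x <= 1 -> Rabs (f x) <= K * (Rabs x * sqrt (Rabs x))) -> is_derive f 0 0.
Proof.
intros H0 H; apply is_derive_Reals; intros e He.
assert (HK : 0 < Rabs K + 1) by (pose proof (Rabs_pos K); lra).
set (d := e / (Rabs K + 1)); assert (Hd : 0 < d) by now apply Rdiv_lt_0_compat.
assert (Hm : 0 < Rmin 1 (d ^ 2)) by (apply Rmin_pos; [lra|now apply pow_lt]).
exists (mkposreal _ Hm); intros h Hh Hhd; simpl in Hhd.
rewrite Rplus_0_l, H0, !Rminus_0_r; unfold Rdiv; rewrite Rabs_mult, Rabs_inv.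
assert (Hy1 := Rlt_le_trans _ _ _ Hhd (Rmin_l _ _)); assert (Hy2 := Rlt_le_trans _ _ _ Hhd (Rmin_r _ _)).
assert (Hs := sqrt_lt_of_sq (Rabs h) d Hd (Rabs_pos h) Hy2).
assert (Hp := Rabs_pos_lt h Hh).
specialize (H h ltac:(lra)); pose proof (sqrt_pos (Rabs h)); pose proof (Rle_abs K).
apply (Rmult_lt_reg_r (Rabs h)); [easy|]; rewrite Rmult_assoc, Rinv_l, Rmult_1_r by lra.
assert (0 <= Rabs h * sqrt (Rabs h)) by (apply Rmult_le_pos; lra).
apply Rle_lt_trans with ((Rabs K + 1) * (Rabs h * sqrt (Rabs h))); [nra|].
replace e with ((Rabs K + 1) * d) by (unfold d; field; lra).
rewrite (Rmult_comm (Rabs h)), <- Rmult_assoc; apply Rmult_lt_compat_r; [easy|].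
now apply Rmult_lt_compat_l.
Qed.

Lemma ln_nonpos x : x <= 0 -> ln x = 0.
Proof. intros Hx; unfold ln; destruct (Rlt_dec 0 x); [exfalso; lra|easy]. Qed.

Lemma abs_mul_ln_bound x : Rabs x <= 1 -> Rabs x * Rabs (ln x) <= 2 * sqrt (Rabs x).
Proof.
intros Hx; destruct (Rlt_dec 0 x) as [H|H].
- rewrite (Rabs_pos_eq x) in * by lra; now apply tau_ln_bound.
- rewrite ln_nonpos, Rabs_R0, Rmult_0_r by lra; pose proof (sqrt_pos (Rabs x)); lra.
Qed.

Lemma le_sqrt_self x : 0 <= x <= 1 -> x <= sqrt x.
Proof.
intros Hx; pose proof (sqrt_pos x); pose proof (sqrt_sqrt x ltac:(lra)).
assert (sqrt x <= 1) by (rewrite <- sqrt_1; apply sqrt_le_1; lra); nra.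
Qed.

Lemma continuous_mul_ln b x : 0 <= x -> continuous (fun x => x * (b - ln x)) x.
Proof.
intros [Hx|<-].
- auto_cont; lra.
- apply (continuous_at_0 _ (Rabs b + 2)); [ring|].
  intros y Hy; rewrite Rabs_mult.
  assert (B := abs_mul_ln_bound y Hy); assert (B' := le_sqrt_self (Rabs y) ltac:(split; [apply Rabs_pos|easy])).
  assert (Rabs (b - ln y) <= Rabs b + Rabs (ln y)).
  { unfold Rminus; eapply Rle_trans; [apply Rabs_triang|]; rewrite Rabs_Ropp; lra. }
  pose proof (Rabs_pos y); pose proof (Rabs_pos b).
  apply Rle_trans with (Rabs y * (Rabs b + Rabs (ln y))); [apply Rmult_le_compat_l; lra|nra].
Qed.

(** * The second difference of the main term *)

(** Away from 0 this is [(v - sin v) / v^2]; its integral [cin A] is the cosine integral [Cin A] up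
    to [sin A / A - 1]. The form with [spline_hat] is continuous at 0 as it stands. *)
Definition cin_kernel v := v * spline_hat 1 v.
Definition cin A : R := RInt cin_kernel 0 A.
Definition cin_log A : R := RInt (fun s => cin s / s) 0 A.

Lemma continuous_cin_kernel v : continuous cin_kernel v.
Proof.
apply (continuous_mult (fun v : R => v) (spline_hat 1)); [apply continuous_id|apply continuous_spline_hat; lra].
Qed.

Lemma cin_kernel_bound v : Rabs (cin_kernel v) <= Rabs v / 2.
Proof.
unfold cin_kernel; rewrite Rabs_mult; unfold Rdiv; apply Rmult_le_compat_l; [apply Rabs_pos|].
pose proof (spline_hat_bound 1 v ltac:(lra)); lra.
Qed.

Lemma cin_kernel_formula v : v <> 0 -> cin_kernel v = (v - sin v) / v ^ 2.
Proof.
intros Hv; unfold cin_kernel; rewrite spline_hat_formula, Rmult_1_l by (easy || lra); field; easy.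
Qed.

Lemma is_derive_RInt_cont (f : R -> R) a x : (forall x, continuous f x) -> is_derive (fun x => RInt f a x) x (f x).
Proof.
intros Hf; apply (is_derive_RInt f (fun x => RInt f a x) a x); [|apply Hf].
exists (mkposreal 1 Rlt_0_1); intros y _; apply (RInt_correct (V := R_CompleteNormedModule)).
apply ex_RInt_everywhere; auto.
Qed.

Lemma is_derive_cin x : is_derive cin x (cin_kernel x).
Proof. apply (is_derive_RInt_cont cin_kernel 0 x), continuous_cin_kernel. Qed.

Lemma cin_bound s : Rabs (cin s) <= s ^ 2 / 2.
Proof.
assert (Hex : forall a b, ex_RInt cin_kernel a b).
{ intros; apply ex_RInt_everywhere; intros; apply continuous_cin_kernel. }
unfold cin; destruct (Rle_dec 0 s) as [Hs|Hs].
- replace (s ^ 2 / 2) with ((s - 0) * (s / 2)) by field.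
  apply RInt_const_bound; auto; intros x Hx; eapply Rle_trans; [apply cin_kernel_bound|].
  rewrite Rabs_pos_eq; lra.
- rewrite <- (opp_RInt_swap cin_kernel s 0) by auto; change (opp ?z) with (- z); rewrite Rabs_Ropp.
  replace (s ^ 2 / 2) with ((0 - s) * (- s / 2)) by field.
  apply RInt_const_bound; [lra|auto|]; intros x Hx; eapply Rle_trans; [apply cin_kernel_bound|].
  rewrite Rabs_left1; lra.
Qed.

Lemma cin_div_bound s : Rabs (cin s / s) <= Rabs s / 2.
Proof.
destruct (Req_dec s 0) as [->|Hs].
- unfold Rdiv; rewrite Rinv_0, Rmult_0_r, Rabs_R0; lra.
- unfold Rdiv; rewrite Rabs_mult, Rabs_inv.
  assert (Hp := Rabs_pos_lt s Hs); assert (B := cin_bound s).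
  apply (Rmult_le_reg_r (Rabs s)); [easy|]; rewrite Rmult_assoc, Rinv_l, Rmult_1_r by lra.
  replace (Rabs s * / 2 * Rabs s) with (s ^ 2 / 2); [easy|].
  rewrite <- (pow2_abs s); field.
Qed.

(** At 0 the quotient has the default value [0 / 0 = 0], which is also its limit because [cin] is
    quadratic there. *)
Lemma continuous_cin_div s : continuous (fun s => cin s / s) s.
Proof.
destruct (Req_dec s 0) as [->|Hs].
- apply (continuous_at_0 _ 1); [unfold Rdiv; rewrite Rinv_0; ring|].
  intros x Hx; eapply Rle_trans; [apply cin_div_bound|].
  pose proof (Rabs_pos x); pose proof (le_sqrt_self (Rabs x) ltac:(lra)); lra.
- apply continuous_of_ex_derive; apply (ex_derive_div cin (fun s => s)); auto.
  + exists (cin_kernel s); apply is_derive_cin.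
  + apply ex_derive_id.
Qed.

Lemma is_derive_cin_log x : is_derive cin_log x (cin x / x).
Proof. apply (is_derive_RInt_cont (fun s => cin s / s) 0 x), continuous_cin_div. Qed.

Lemma cin_log_bound s : Rabs (cin_log s) <= s ^ 2 / 2.
Proof.
assert (Hex : forall a b, ex_RInt (fun s => cin s / s) a b).
{ intros; apply ex_RInt_everywhere; intros; apply continuous_cin_div. }
unfold cin_log; destruct (Rle_dec 0 s) as [Hs|Hs].
- replace (s ^ 2 / 2) with ((s - 0) * (s / 2)) by field.
  apply RInt_const_bound; auto; intros x Hx; eapply Rle_trans; [apply cin_div_bound|].
  rewrite Rabs_pos_eq; lra.
- rewrite <- (opp_RInt_swap (fun s => cin s / s) s 0) by auto; change (opp ?z) with (- z); rewrite Rabs_Ropp.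
  replace (s ^ 2 / 2) with ((0 - s) * (- s / 2)) by field.
  apply RInt_const_bound; [lra|auto|]; intros x Hx; eapply Rle_trans; [apply cin_div_bound|].
  rewrite Rabs_left1; lra.
Qed.

Definition main_int b A : R := RInt (fun tau => tau * (b - ln tau) * spline_hat A tau) 0 1.

(** After scaling, the integrand is [A] times the derivative of [cin (A tau) (b - ln tau) + cin_log
    (A tau)]: the term [- cin (A tau) / tau] coming from the logarithm is cancelled by the
    derivative of [cin_log]. At [tau = 1] the logarithm vanishes. *)
Lemma main_int_formula b A : 0 < A -> main_int b A = A * (cin_log A + b * cin A).
Proof.
intros HA; unfold main_int.
set (h := fun tau => A * cin_kernel (A * tau) * (b - ln tau)).
set (H := fun tau => cin (A * tau) * (b - ln tau) + cin_log (A * tau)).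
assert (HA2 : 0 < A ^ 2) by (apply pow_lt; lra).
assert (Hc0 : cin 0 = 0) by exact (RInt_point 0 cin_kernel).
assert (Hcl0 : cin_log 0 = 0) by exact (RInt_point 0 (fun s => cin s / s)).
assert (Hk0 : cin_kernel 0 = 0) by apply Rmult_0_l.
assert (Hbl : forall y, Rabs y <= 1 -> Rabs y * Rabs (b - ln y) <= (Rabs b + 2) * sqrt (Rabs y)).
{ intros y Hy; assert (B := abs_mul_ln_bound y Hy); assert (B' := le_sqrt_self (Rabs y) ltac:(split; [apply Rabs_pos|easy])).
  assert (Rabs (b - ln y) <= Rabs b + Rabs (ln y)).
  { unfold Rminus; eapply Rle_trans; [apply Rabs_triang|]; rewrite Rabs_Ropp; lra. }
  pose proof (Rabs_pos y); pose proof (Rabs_pos b).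
  apply Rle_trans with (Rabs y * (Rabs b + Rabs (ln y))); [apply Rmult_le_compat_l; lra|nra]. }
assert (HD : forall tau, 0 <= tau <= 1 -> is_derive H tau (h tau)).
{ intros tau [[Ht|<-] _].
  - unfold H, h.
    assert (D1 : is_derive (fun tau => cin (A * tau)) tau (A * cin_kernel (A * tau))).
    { apply (is_derive_comp cin (fun tau => A * tau)); [apply is_derive_cin|auto_derive; auto; ring]. }
    assert (D2 : is_derive (fun tau => cin_log (A * tau)) tau (A * (cin (A * tau) / (A * tau)))).
    { apply (is_derive_comp cin_log (fun tau => A * tau)); [apply is_derive_cin_log|auto_derive; auto; ring]. }
    assert (D3 : is_derive (fun tau => b - ln tau) tau (- / tau)).
    { auto_derive; [easy|field; lra]. }
    assert (D4 := is_derive_plus _ _ _ _ _ (is_derive_mult _ _ _ _ _ D1 D3 Rmult_comm) D2).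
    match type of D4 with is_derive _ _ ?z => replace (A * cin_kernel (A * tau) * (b - ln tau)) with z; [exact D4|] end.
    change (A * cin_kernel (A * tau) * (b - ln tau) + cin (A * tau) * - / tau + A * (cin (A * tau) / (A * tau)) =
      A * cin_kernel (A * tau) * (b - ln tau)); field; lra.
  - replace (h 0) with 0 by (unfold h; rewrite Rmult_0_r, Hk0; ring).
    apply (is_derive_at_0 H (A ^ 2 * (Rabs b + 3))); [unfold H; rewrite Rmult_0_r, Hc0, Hcl0; ring|].
    intros x Hx; unfold H; eapply Rle_trans; [apply Rabs_triang|]; rewrite Rabs_mult.
    assert (B1 := cin_bound (A * x)); assert (B2 := cin_log_bound (A * x)); specialize (Hbl x Hx).
    rewrite Rpow_mult_distr, <- (pow2_abs x) in B1, B2.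
    pose proof (Rabs_pos x); pose proof (Rabs_pos b); pose proof (le_sqrt_self (Rabs x) ltac:(lra)); pose proof (sqrt_pos (Rabs x)).
    assert (Rabs (cin (A * x)) * Rabs (b - ln x) <= A ^ 2 * Rabs x * ((Rabs b + 2) * sqrt (Rabs x))).
    { apply Rle_trans with (A ^ 2 * Rabs x ^ 2 / 2 * Rabs (b - ln x)); [apply Rmult_le_compat_r; [apply Rabs_pos|easy]|].
      replace (A ^ 2 * Rabs x ^ 2 / 2 * Rabs (b - ln x)) with (A ^ 2 * Rabs x * (Rabs x * Rabs (b - ln x)) / 2) by field.
      assert (0 <= A ^ 2 * Rabs x) by nra.
      assert (0 <= Rabs x * Rabs (b - ln x)) by (apply Rmult_le_pos; apply Rabs_pos).
      assert (A ^ 2 * Rabs x * (Rabs x * Rabs (b - ln x)) <= A ^ 2 * Rabs x * ((Rabs b + 2) * sqrt (Rabs x))) by (apply Rmult_le_compat_l; easy).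
      assert (0 <= A ^ 2 * Rabs x * (Rabs x * Rabs (b - ln x))) by (apply Rmult_le_pos; easy). lra. }
    assert (A ^ 2 * Rabs x ^ 2 <= A ^ 2 * (Rabs x * sqrt (Rabs x))) by (apply Rmult_le_compat_l; nra).
    nra. }
assert (HC : forall tau, 0 <= tau <= 1 -> continuous h tau).
{ intros tau [[Ht|<-] _].
  - unfold h; apply (continuous_mult (fun tau => A * cin_kernel (A * tau)) (fun tau => b - ln tau)).
    + apply (continuous_mult (fun _ => A) (fun tau => cin_kernel (A * tau))); [apply continuous_const|].
      apply (continuous_comp (fun tau => A * tau) cin_kernel); [|apply continuous_cin_kernel].
      auto_cont; auto.
    + auto_cont; auto.
  - apply (continuous_at_0 h (A ^ 2 * (Rabs b + 2))); [unfold h; rewrite Rmult_0_r, Hk0; ring|].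
    intros x Hx; unfold h; rewrite !Rabs_mult, (Rabs_pos_eq A) by lra.
    specialize (Hbl x Hx); assert (B := cin_kernel_bound (A * x)); rewrite Rabs_mult, (Rabs_pos_eq A) in B by lra.
    pose proof (Rabs_pos x); pose proof (Rabs_pos (b - ln x)).
    apply Rle_trans with (A * (A * Rabs x) * Rabs (b - ln x)).
    + apply Rmult_le_compat_r; [easy|]; apply Rmult_le_compat_l; [lra|]; assert (0 <= A * Rabs x) by nra; lra.
    + replace (A * (A * Rabs x) * Rabs (b - ln x)) with (A ^ 2 * (Rabs x * Rabs (b - ln x))) by ring.
      rewrite (Rmult_assoc (A ^ 2)); apply Rmult_le_compat_l; lra. }
transitivity (A * RInt h 0 1).
{ rewrite <- RInt_scalR by (apply ex_RInt_cont; [lra|exact HC]).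
  apply RInt_extR; [lra|]; intros tau Ht; unfold h, cin_kernel; rewrite (spline_hat_scale A tau) by easy; ring. }
rewrite (RInt_FTC H h) by (lra || assumption).
unfold H; rewrite Rmult_1_r, Rmult_0_r, Hc0, Hcl0, ln_1; ring.
Qed.

Lemma diff2_main_int b A D : 0 <= D <= A ->
  RInt (fun tau => tau * (b - ln tau) * spline_kernel A D tau) 0 1 = diff2 (main_int b) A D.
Proof.
intros HD; unfold diff2, main_int.
assert (Hex : forall B, 0 <= B -> ex_RInt (fun tau => tau * (b - ln tau) * spline_hat B tau) 0 1).
{ intros B HB; apply ex_RInt_cont; [lra|]; intros tau Ht.
  apply (continuous_mult (fun tau => tau * (b - ln tau)) (spline_hat B)); [apply continuous_mul_ln; lra|now apply continuous_spline_hat]. }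
rewrite <- RInt_scalR by (apply Hex; lra).
rewrite <- RInt_minusR; [|apply Hex; lra|apply (ex_RInt_scalR 2), Hex; lra].
rewrite <- RInt_plusR; [|apply ex_RInt_minusR; [apply Hex; lra|apply (ex_RInt_scalR 2), Hex; lra]|apply Hex; lra].
apply RInt_extR; [lra|]; intros tau _; unfold spline_kernel, diff2; ring.
Qed.

(** The derivative of [cin x - ln x] is [- sin x / x^2], whose integral converges absolutely with
    tail at most [1 / x]. *)
Lemma cin_asymp : exists c, forall x, 1 <= x -> Rabs (cin x - ln x - c) <= / x.
Proof.
apply (tail_limit (fun x => cin x - ln x) (fun x => / x)).
- intros x y Hxy.
  replace (cin y - ln y - (cin x - ln x)) with (RInt (fun v => - (sin v / v ^ 2)) x y).
  + apply Rle_trans with (/ x - / y); [|assert (0 < / y) by (apply Rinv_0_lt_compat; lra); lra].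
    apply RInt_bound_inv_sq; try lra.
    * apply ex_RInt_cont; [lra|]; intros; auto_cont; apply Rgt_not_eq; nra.
    * intros v Hv; rewrite Rabs_Ropp; unfold Rdiv; rewrite Rabs_mult.
      assert (0 < / v ^ 2) by (apply Rinv_0_lt_compat; nra).
      assert (Rabs (sin v) <= 1) by (apply Rabs_le, SIN_bound).
      rewrite (Rabs_pos_eq (/ v ^ 2)) by lra; nra.
  + rewrite (RInt_FTC (fun x => cin x - ln x)); [reflexivity|lra| |].
    * intros v Hv; assert (D1 := is_derive_cin v).
      assert (D2 : is_derive ln v (/ v)) by (auto_derive; [lra|field; lra]).
      assert (D3 := is_derive_minus _ _ _ _ _ D1 D2).
      match type of D3 with is_derive _ _ ?z => replace (- (sin v / v ^ 2)) with z; [exact D3|] end.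
      change (cin_kernel v - / v = - (sin v / v ^ 2)); rewrite cin_kernel_formula by lra; field; lra.
    * intros v Hv; auto_cont; apply Rgt_not_eq; nra.
- intros eps He; destruct (inv_lt_eps 1 eps) as (X & HX & H); try lra; exists X; lra.
Qed.

Lemma cin_log_asymp c : (forall x, 1 <= x -> Rabs (cin x - ln x - c) <= / x) ->
  exists c2, forall x, 1 <= x -> Rabs (cin_log x - (ln x ^ 2 / 2 + c * ln x) - c2) <= / x.
Proof.
intros Hc.
apply (tail_limit (fun x => cin_log x - (ln x ^ 2 / 2 + c * ln x)) (fun x => / x)).
- intros x y Hxy.
  replace (cin_log y - (ln y ^ 2 / 2 + c * ln y) - (cin_log x - (ln x ^ 2 / 2 + c * ln x)))
   with (RInt (fun v => cin v / v - (ln v + c) / v) x y).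
  + apply Rle_trans with (/ x - / y); [|assert (0 < / y) by (apply Rinv_0_lt_compat; lra); lra].
    apply RInt_bound_inv_sq; try lra.
    * apply ex_RInt_cont; [lra|]; intros v Hv.
      apply (continuous_minus (fun v => cin v / v) (fun v => (ln v + c) / v)); [apply continuous_cin_div|].
      auto_cont; lra.
    * intros v Hv; replace (cin v / v - (ln v + c) / v) with ((cin v - ln v - c) * / v) by (field; lra).
      assert (0 < / v) by (apply Rinv_0_lt_compat; lra).
      rewrite Rabs_mult, (Rabs_pos_eq (/ v)) by lra.
      replace (/ v ^ 2) with (/ v * / v) by (field; lra).
      apply Rmult_le_compat_r; [lra|apply Hc; lra].
  + rewrite (RInt_FTC (fun x => cin_log x - (ln x ^ 2 / 2 + c * ln x))); [reflexivity|lra| |].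
    * intros v Hv; assert (D1 := is_derive_cin_log v).
      assert (D2 : is_derive (fun x => ln x ^ 2 / 2 + c * ln x) v ((ln v + c) / v)) by (auto_derive; [lra|field; lra]).
      exact (is_derive_minus _ _ _ _ _ D1 D2).
    * intros v Hv.
      apply (continuous_minus (fun v => cin v / v) (fun v => (ln v + c) / v)); [apply continuous_cin_div|].
      auto_cont; lra.
- intros eps He; destruct (inv_lt_eps 1 eps) as (X & HX & H); try lra; exists X; lra.
Qed.

Lemma diff2_Lipschitz (W W' : R -> R) A D L : 0 <= D ->
  (forall x, A - D <= x <= A + D -> is_derive W x (W' x)) ->
  (forall x, A - D <= x <= A + D -> Rabs (W' x) <= L) -> Rabs (diff2 W A D) <= 2 * D * L.
Proof.
intros HD H1 H2.
assert (B1 := mvt_bound W W' A (A + D) L ltac:(lra)); assert (B2 := mvt_bound W W' (A - D) A L ltac:(lra)).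
unfold diff2; replace (W (A + D) - 2 * W A + W (A - D)) with ((W (A + D) - W A) - (W A - W (A - D))) by ring.
apply Rle_trans with (Rabs (W (A + D) - W A) + Rabs (W A - W (A - D))).
- unfold Rminus at 1; eapply Rle_trans; [apply Rabs_triang|]; rewrite Rabs_Ropp; lra.
- assert (Rabs (W (A + D) - W A) <= L * (A + D - A)) by (apply B1; intros; [apply H1|apply H2]; lra).
  assert (Rabs (W A - W (A - D)) <= L * (A - (A - D))) by (apply B2; intros; [apply H1|apply H2]; lra).
  lra.
Qed.

(** The mean value bound is applied twice in [s] to [f (A + s) + f (A - s)], starting from [f2],
    which is Lipschitz with constant [L]. *)
Lemma diff2_taylor (f f1 f2 f3 : R -> R) A D L : 0 <= D ->
  (forall x, A - D <= x <= A + D -> is_derive f x (f1 x)) ->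
  (forall x, A - D <= x <= A + D -> is_derive f1 x (f2 x)) ->
  (forall x, A - D <= x <= A + D -> is_derive f2 x (f3 x)) ->
  (forall x, A - D <= x <= A + D -> Rabs (f3 x) <= L) -> Rabs (diff2 f A D - D ^ 2 * f2 A) <= 2 * L * D ^ 3.
Proof.
intros HD H0 H1 H2 H3.
assert (HL : 0 <= L) by (eapply Rle_trans; [apply Rabs_pos|apply (H3 A); lra]).
assert (B2 : forall s, 0 <= s <= D -> Rabs (f2 (A + s) + f2 (A - s) - 2 * f2 A) <= 2 * L * D).
{ intros s Hs.
  assert (C1 : Rabs (f2 (A + s) - f2 A) <= L * (A + s - A)) by (apply (mvt_bound f2 f3); intros; [lra|apply H2|apply H3]; lra).
  assert (C2 : Rabs (f2 A - f2 (A - s)) <= L * (A - (A - s))) by (apply (mvt_bound f2 f3); intros; [lra|apply H2|apply H3]; lra).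
  apply Rabs_le_between in C1, C2; apply Rabs_le; nra. }
assert (Dp : forall (g g' : R -> R) s, 0 <= s <= D -> (forall x, A - D <= x <= A + D -> is_derive g x (g' x)) ->
   is_derive (fun s => g (A + s)) s (g' (A + s))).
{ intros g g' s Hs Hg; replace (g' (A + s)) with (1 * g' (A + s)) by ring.
  apply (is_derive_comp g (fun s => A + s)); [apply Hg; lra|auto_derive; auto; ring]. }
assert (Dm : forall (g g' : R -> R) s, 0 <= s <= D -> (forall x, A - D <= x <= A + D -> is_derive g x (g' x)) ->
   is_derive (fun s => g (A - s)) s (- g' (A - s))).
{ intros g g' s Hs Hg; replace (- g' (A - s)) with (-1 * g' (A - s)) by ring.
  apply (is_derive_comp g (fun s => A - s)); [apply Hg; lra|auto_derive; auto; ring]. }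
assert (B1 : forall s, 0 <= s <= D -> Rabs (f1 (A + s) - f1 (A - s) - 2 * s * f2 A) <= 2 * L * D ^ 2).
{ intros s Hs.
  assert (C := mvt_bound (fun s => f1 (A + s) - f1 (A - s) - 2 * s * f2 A) (fun s => f2 (A + s) + f2 (A - s) - 2 * f2 A) 0 s (2 * L * D)).
  cbv beta in C; rewrite Rplus_0_r, Rminus_0_r in C.
  replace (f1 (A + s) - f1 (A - s) - 2 * s * f2 A - (f1 A - f1 A - 2 * 0 * f2 A)) with (f1 (A + s) - f1 (A - s) - 2 * s * f2 A) in C by ring.
  eapply Rle_trans; [apply C|].
  - lra.
  - intros x Hx.
    assert (E1 := is_derive_minus _ _ _ _ _ (Dp f1 f2 x ltac:(lra) H1) (Dm f1 f2 x ltac:(lra) H1)).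
    assert (E2 : is_derive (fun s => 2 * s * f2 A) x (2 * f2 A)) by (auto_derive; auto; ring).
    assert (E3 := is_derive_minus _ _ _ _ _ E1 E2).
    match type of E3 with is_derive _ _ ?z => replace (f2 (A + x) + f2 (A - x) - 2 * f2 A) with z; [exact E3|] end.
    change (f2 (A + x) - - f2 (A - x) - 2 * f2 A = f2 (A + x) + f2 (A - x) - 2 * f2 A); ring.
  - intros x Hx; apply B2; lra.
  - rewrite Rminus_0_r; replace (2 * L * D ^ 2) with (2 * L * D * D) by ring.
    apply Rmult_le_compat_l; [nra|lra]. }
assert (C := mvt_bound (fun s => f (A + s) + f (A - s) - 2 * f A - s ^ 2 * f2 A) (fun s => f1 (A + s) - f1 (A - s) - 2 * s * f2 A) 0 D (2 * L * D ^ 2)).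
cbv beta in C; rewrite Rplus_0_r, Rminus_0_r in C.
replace (f (A + D) + f (A - D) - 2 * f A - D ^ 2 * f2 A - (f A + f A - 2 * f A - 0 ^ 2 * f2 A)) with (diff2 f A D - D ^ 2 * f2 A) in C by (unfold diff2; ring).
eapply Rle_trans; [apply C|].
- lra.
- intros x Hx.
  assert (E1 := is_derive_plus _ _ _ _ _ (Dp f f1 x ltac:(lra) H0) (Dm f f1 x ltac:(lra) H0)).
  assert (E2 : is_derive (fun s => 2 * f A + s ^ 2 * f2 A) x (2 * x * f2 A)) by (auto_derive; auto; ring).
  assert (E3 := is_derive_minus _ _ _ _ _ E1 E2).
  apply (is_derive_ext (fun s => f (A + s) + f (A - s) - (2 * f A + s ^ 2 * f2 A))); [intros; cbv beta; rring|].
  exact E3.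
- exact (fun x Hx => B1 x Hx).
- rewrite Rminus_0_r; right; ring.
Qed.

Lemma ln_ge_0 x : 1 <= x -> 0 <= ln x.
Proof. intros Hx; rewrite <- ln_1; apply ln_le; lra. Qed.

(** The oscillating part of the main term has a second derivative containing [b cos x / x], as large
    as the term [c / A] to be isolated, so Taylor's formula would lose too much. It is split off as
    [W], whose first derivative is [O(1 / A)], and estimated through two first differences. The rest
    is the smooth [Psi] and a linear function, which second differences annihilate. *)
Lemma main_diff2 b : exists c K, 0 <= K /\ forall A D, 2 <= A -> 0 < D <= A / 2 ->
  Rabs (diff2 (main_int b) A D - D ^ 2 * ((ln A + c) / A)) <= K * (D / A + D ^ 3 * (1 + ln A) / A ^ 2).
Proof.
destruct cin_asymp as [c0 Hc0]; destruct (cin_log_asymp c0 Hc0) as [c2 Hc2].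
set (c1 := c0 + b + 1).
set (L1 := 1 + Rabs (b + 1) + Rabs b).
assert (HL1 : 0 <= L1) by (pose proof (Rabs_pos (b + 1)); pose proof (Rabs_pos b); unfold L1; lra).
assert (Hc1 := Rabs_pos c1).
exists c1, (4 * L1 + 8 * (2 + Rabs c1)); split; [lra|].
intros A D HA HD.
(* [Psi] has the derivative [ln^2 / 2 + c1 ln], the growing part of the derivative of the main term,
   and hence the second derivative [(ln x + c1) / x]; [k] collects the constants left in that first
   derivative. *)
set (Psi := fun x => x * (ln x ^ 2 / 2 + (c1 - 1) * ln x + 1 - c1)).
set (k := c2 + (b + 1) * c0 + b).
set (W := fun x => x * (cin_log x + b * cin x) - Psi x - k * x).
assert (E : diff2 (main_int b) A D = diff2 W A D + diff2 Psi A D).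
{ unfold diff2; rewrite !main_int_formula by lra; unfold W; ring. }
assert (BW : Rabs (diff2 W A D) <= 2 * D * (2 * L1 / A)).
{ apply (diff2_Lipschitz W (fun x => (cin_log x - (ln x ^ 2 / 2 + c0 * ln x) - c2) + (b + 1) * (cin x - ln x - c0) - b * (sin x / x))); [lra| |].
  - intros x Hx; assert (Hx0 : 0 < x) by lra.
    assert (D1 : is_derive (fun x => cin_log x + b * cin x) x (cin x / x + b * cin_kernel x)).
    { apply (is_derive_plus cin_log (fun x => b * cin x)); [apply is_derive_cin_log|].
      apply (is_derive_scal cin x b), is_derive_cin. }
    assert (D2 : is_derive (fun x => x) x 1) by (auto_derive; auto).
    assert (D3 := is_derive_mult _ _ _ _ _ D2 D1 Rmult_comm).
    assert (D4 : is_derive (fun x => Psi x + k * x) x (ln x ^ 2 / 2 + c1 * ln x + k)).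
    { unfold Psi; auto_derive; [lra|field; lra]. }
    assert (D5 := is_derive_minus _ _ _ _ _ D3 D4).
    apply (is_derive_ext (fun x => x * (cin_log x + b * cin x) - (Psi x + k * x))); [intros; unfold W; rring|].
    match type of D5 with is_derive _ _ ?z => match goal with |- is_derive _ _ ?y => replace y with z; [exact D5|] end end.
    change (1 * (cin_log x + b * cin x) + x * (cin x / x + b * cin_kernel x) - (ln x ^ 2 / 2 + c1 * ln x + k) =
     cin_log x - (ln x ^ 2 / 2 + c0 * ln x) - c2 + (b + 1) * (cin x - ln x - c0) - b * (sin x / x)).
    rewrite cin_kernel_formula by lra; unfold k, c1; field; lra.
  - intros x Hx; assert (Hx1 : 1 <= x) by lra.
    assert (Hi : 0 < / x) by (apply Rinv_0_lt_compat; lra).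
    assert (Hi2 : / x <= 2 / A).
    { replace (2 / A) with (/ (A / 2)) by (field; lra); apply Rinv_le_contravar; lra. }
    assert (Hs : Rabs (sin x / x) <= / x).
    { unfold Rdiv; rewrite Rabs_mult, (Rabs_pos_eq (/ x)) by lra.
      assert (Rabs (sin x) <= 1) by (apply Rabs_le, SIN_bound); nra. }
    specialize (Hc0 x Hx1); specialize (Hc2 x Hx1).
    apply Rle_trans with (L1 * / x).
    + unfold L1; eapply Rle_trans; [unfold Rminus at 1; apply Rabs_triang|]; rewrite Rabs_Ropp.
      assert (Rabs (b * (sin x / x)) <= Rabs b * / x) by (rewrite Rabs_mult; apply Rmult_le_compat_l; [apply Rabs_pos|easy]).
      assert (Rabs ((b + 1) * (cin x - ln x - c0)) <= Rabs (b + 1) * / x) by (rewrite Rabs_mult; apply Rmult_le_compat_l; [apply Rabs_pos|easy]).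
      eapply Rle_trans; [apply Rplus_le_compat_r, Rabs_triang|]; lra.
    + unfold Rdiv in *; nra. }
assert (HlA := ln_ge_0 A ltac:(lra)).
assert (BP : Rabs (diff2 Psi A D - D ^ 2 * ((ln A + c1) / A)) <= 2 * (4 * (2 + Rabs c1) * (1 + ln A) / A ^ 2) * D ^ 3).
{ apply (diff2_taylor Psi (fun x => ln x ^ 2 / 2 + c1 * ln x) (fun x => (ln x + c1) / x) (fun x => (1 - ln x - c1) / x ^ 2)); [lra| | | |].
  - intros x Hx; unfold Psi; auto_derive; [lra|field; lra].
  - intros x Hx; auto_derive; [lra|field; lra].
  - intros x Hx; auto_derive; [lra|field; lra].
  - intros x Hx; unfold Rdiv; rewrite Rabs_mult.
    assert (Hx1 : 1 <= x) by lra; assert (HA2 : 0 < A ^ 2) by nra.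
    assert (Hi2 : 0 < / x ^ 2 <= 4 / A ^ 2).
    { split; [apply Rinv_0_lt_compat; nra|].
      replace (4 / A ^ 2) with (/ (A / 2) ^ 2) by (field; lra); apply Rinv_le_contravar; [nra|apply pow_incr; lra]. }
    assert (Hlx := ln_ge_0 x Hx1).
    assert (Hlx2 : ln x <= ln A + 1).
    { apply Rle_trans with (ln (A * (3 / 2))); [apply ln_le; lra|].
      rewrite ln_mult by lra; pose proof (ln_le_sub (3 / 2) ltac:(lra)); lra. }
    assert (Hcc : - Rabs c1 <= c1 <= Rabs c1) by (split; [pose proof (Rle_abs (- c1)); rewrite Rabs_Ropp in *; lra|apply Rle_abs]).
    rewrite (Rabs_pos_eq (/ x ^ 2)) by lra.
    apply Rle_trans with ((2 + Rabs c1) * (1 + ln A) * (4 / A ^ 2)).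
    + apply Rmult_le_compat; [apply Rabs_pos|lra| |lra].
      apply Rabs_le; nra.
    + right; field; lra. }
rewrite E.
assert (0 <= D / A) by (apply Rmult_le_pos; [lra|apply Rlt_le, Rinv_0_lt_compat; lra]).
assert (HD3 : 0 <= D ^ 3 * (1 + ln A) / A ^ 2).
{ apply Rmult_le_pos; [apply Rmult_le_pos; [apply pow_le; lra|lra]|apply Rlt_le, Rinv_0_lt_compat; nra]. }
replace (2 * (4 * (2 + Rabs c1) * (1 + ln A) / A ^ 2) * D ^ 3) with (8 * (2 + Rabs c1) * (D ^ 3 * (1 + ln A) / A ^ 2)) in BP by (field; lra).
replace (2 * D * (2 * L1 / A)) with (4 * L1 * (D / A)) in BW by (field; lra).
apply Rabs_le_between in BW, BP; apply Rabs_le.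
assert (0 <= L1 * (D ^ 3 * (1 + ln A) / A ^ 2)) by now apply Rmult_le_pos.
assert (0 <= (2 + Rabs c1) * (D / A)) by (apply Rmult_le_pos; lra).
split; lra.
Qed.

(** * The smoothed mass of the measure *)

(** Lets the cut-off [m] tend to infinity in an inequality whose other quantities do not depend on
    it. *)
Lemma le_of_le_inv X Y Q : 0 <= Q -> (forall m, 2 <= m -> X <= Y + Q / m) -> X <= Y.
Proof.
intros HQ H; apply Rnot_lt_le; intros Hlt.
set (m := 2 + Q / (X - Y)).
assert (Hq : 0 <= Q / (X - Y)) by (apply Rmult_le_pos; [easy|apply Rlt_le, Rinv_0_lt_compat; lra]).
specialize (H m ltac:(unfold m; lra)).
assert (Hm : 0 < m) by (unfold m; lra).
assert (E : Q = (m - 2) * (X - Y)) by (unfold m; field; lra).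
apply (Rmult_le_compat_r m) in H; [|lra].
replace ((Y + Q / m) * m) with (Y * m + Q) in H by (field; lra); nra.
Qed.

Lemma exp_neg_le_inv m : 0 < m -> exp (- m) <= / m.
Proof.
intros Hm; rewrite exp_Ropp; apply Rinv_le_contravar; [easy|].
pose proof (exp_ineq1_le m); lra.
Qed.

Lemma RInt_sym (f : R -> R) X : 0 <= X -> (forall x, continuous f x) ->
  RInt f (- X) X = RInt (fun x => f x + f (- x)) 0 X.
Proof.
intros HX Hf.
assert (Hex : forall a b, ex_RInt f a b) by (intros; apply ex_RInt_everywhere; auto).
assert (E : RInt f (- X) 0 = RInt (fun x => f (- x)) 0 X).
{ assert (C := RInt_comp_lin f (-1) 0 0 X).
  replace (-1 * 0 + 0) with 0 in C by ring; replace (-1 * X + 0) with (- X) in C by ring.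
  specialize (C (Hex _ _)).
  rewrite <- (opp_RInt_swap f 0 (- X)), <- C by apply Hex.
  rewrite <- RInt_opp.
  - apply RInt_ext; intros x _; change (opp (scal (-1) (f (-1 * x + 0)))) with (- (-1 * f (-1 * x + 0))).
    replace (-1 * x + 0) with (- x) by ring; rring.
  - apply (ex_RInt_comp_lin f (-1) 0); apply Hex. }
assert (Hex' : ex_RInt (fun x => f (- x)) 0 X).
{ apply ex_RInt_cont; auto; intros x _; apply (continuous_comp (fun x => - x) f); auto.
  auto_cont; auto. }
rewrite RInt_plusR, <- E, <- (RInt_ChaslesR f (- X) 0 X) by auto; rring.
Qed.

Definition spline_sq A : R := RInt (fun t => spline A t * mellin_sq t) 0 A.

Lemma RInt_spline_kernel A D a b : 0 <= D <= A ->
  RInt (spline_kernel A D) a b = diff2 (fun A => RInt (spline_hat A) a b : R) A D.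
Proof.
intros HD; unfold diff2.
rewrite <- RInt_scalR by (apply ex_spline_hat; lra).
rewrite <- RInt_minusR; [|apply ex_spline_hat; lra|apply (ex_RInt_scalR 2), ex_spline_hat; lra].
rewrite <- RInt_plusR; [|apply ex_RInt_minusR; [apply ex_spline_hat; lra|apply (ex_RInt_scalR 2), ex_spline_hat; lra]|apply ex_spline_hat; lra].
apply RInt_ext; reflexivity.
Qed.

Lemma RInt_log_corr_kernel m A D a b : 0 <= m -> 0 <= D <= A ->
  RInt (fun tau => log_corr m tau * spline_kernel A D tau) a b =
  diff2 (fun A => RInt (fun tau => log_corr m tau * spline_hat A tau) a b : R) A D.
Proof.
intros Hm HD; unfold diff2.
assert (Hex : forall B, 0 <= B -> ex_RInt (fun tau => log_corr m tau * spline_hat B tau) a b).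
{ intros B HB; apply ex_RInt_everywhere; intros tau.
  apply (continuous_mult (log_corr m) (spline_hat B)); [now apply continuous_log_corr|now apply continuous_spline_hat]. }
rewrite <- RInt_scalR by (apply Hex; lra).
rewrite <- RInt_minusR; [|apply Hex; lra|apply (ex_RInt_scalR 2), Hex; lra].
rewrite <- RInt_plusR; [|apply ex_RInt_minusR; [apply Hex; lra|apply (ex_RInt_scalR 2), Hex; lra]|apply Hex; lra].
apply RInt_ext; intros tau _; unfold spline_kernel, diff2; rring.
Qed.

Lemma diff2_approx (f g : R -> R) A D e : 0 <= D -> D <= A ->
  (forall B, 0 <= B <= A + D -> Rabs (f B - g B) <= e) -> Rabs (diff2 f A D - diff2 g A D) <= 4 * e.
Proof.
intros HD HA H; unfold diff2.
assert (H1 := H (A + D) ltac:(lra)); assert (H2 := H A ltac:(lra)); assert (H3 := H (A - D) ltac:(lra)).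
apply Rabs_le_between in H1, H2, H3; apply Rabs_le; lra.
Qed.

(** By scaling, the integral of [spline_hat B] over the half-line is [B^2 kap], and the second
    difference of [B^2] is [2 D^2]. *)
Lemma spline_kernel_total A D kap m : 0 <= D -> 1 <= A - D -> 1 <= m ->
  (forall Y, 1 <= Y -> Rabs (RInt (spline_hat 1) 0 Y - kap) <= 2 / Y) ->
  Rabs (RInt (spline_kernel A D) 0 (2 * m) - 2 * D ^ 2 * kap) <= 4 * A / m.
Proof.
intros HD HA Hm Hk; rewrite RInt_spline_kernel by lra.
assert (B : forall B, 1 <= B -> Rabs (RInt (spline_hat B) 0 (2 * m) - B ^ 2 * kap) <= B / m).
{ intros B HB; rewrite RInt_spline_hat_scale by lra.
  rewrite <- Rmult_minus_distr_l, Rabs_mult, (Rabs_pos_eq (B ^ 2)) by (apply pow2_ge_0).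
  replace (B / m) with (B ^ 2 * (2 / (B * (2 * m)))) by (field; lra).
  apply Rmult_le_compat_l; [apply pow2_ge_0|apply Hk; nra]. }
unfold diff2.
assert (B1 := B (A + D) ltac:(lra)); assert (B2 := B A ltac:(lra)); assert (B3 := B (A - D) ltac:(lra)).
revert B1 B2 B3; rint_atoms; intros B1 B2 B3.
apply Rabs_le_between in B1, B2, B3.
replace (4 * A / m) with ((A + D) / m + 2 * (A / m) + (A - D) / m) by (field; lra).
apply Rabs_le; split; nra.
Qed.

(** The even part of the autocorrelation is its value at 0 minus half of a deficit [E]. The constant
    gives [n D^2]. The deficit gives minus the main integral, from its expansion on [[0, 1]], and a
    bounded contribution beyond. *)
Lemma spline_sq_diff2 : exists n c K, 0 <= K /\ forall A D, 2 <= A -> 1 <= D <= A / 2 ->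
  Rabs (diff2 spline_sq A D - D ^ 2 * (n - (ln A + c) / A)) <= K * (1 + sqrt D + D ^ 3 * (1 + ln A) / A ^ 2).
Proof.
destruct log_corr_asymp as (b & C & HC & Hlc).
destruct log_corr_0_limit as [I0 HI0].
destruct spline_hat_integral as [kap Hkap].
destruct (main_diff2 b) as (c & K & HK & Hmain).
exists (4 * I0 * kap), c, (24 * C + 16 + K); split; [lra|].
intros A D HA HD.
assert (HDA : 0 <= D <= A) by lra.
set (Main := RInt (fun tau => tau * (b - ln tau) * spline_kernel A D tau) 0 1).
assert (HM : Main = diff2 (main_int b) A D) by (apply diff2_main_int; lra).
specialize (Hmain A D HA ltac:(lra)); rewrite <- HM in Hmain.
(* A crude bound growing with [A]; it is only ever multiplied by cut-off errors, which vanish with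
   [1 / m]. *)
set (kb := 2 * (2 * A) ^ 3).
assert (Hkb : forall tau, Rabs (spline_kernel A D tau) <= kb).
{ intros tau; unfold spline_kernel, diff2, kb.
  assert (Hb : forall B, 0 <= B <= 2 * A -> Rabs (spline_hat B tau) <= (2 * A) ^ 3 / 2).
  { intros B HB; eapply Rle_trans; [apply spline_hat_bound; lra|].
    apply Rmult_le_compat_r; [lra|apply pow_incr; lra]. }
  assert (H1 := Hb (A + D) ltac:(lra)); assert (H2 := Hb A ltac:(lra)); assert (H3 := Hb (A - D) ltac:(lra)).
  apply Rabs_le_between in H1, H2, H3; apply Rabs_le; lra. }
assert (Hkb0 : 0 <= kb) by (eapply Rle_trans; [apply Rabs_pos|apply (Hkb 0)]).
assert (Hck : forall x, continuous (spline_kernel A D) x) by (intros; now apply continuous_spline_kernel).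
(* [A] and [D] are fixed here and [m] is free: every error due to the cut-off is a constant,
   depending on [A] and [D], divided by [m]. *)
assert (Hm : forall m, 2 <= m -> Rabs (diff2 spline_sq A D - (4 * I0 * kap * D ^ 2 - Main)) <=
   (24 * C * sqrt D + 16) + (1536 * A ^ 3 + 16 * A + 8 * D ^ 2 * Rabs kap + (C + 6) * kb) / m).
{ intros m Hm.
  assert (Hm0 : 0 <= m) by lra.
  assert (Him : 0 < / m) by (apply Rinv_0_lt_compat; lra).
  assert (Hem := exp_neg_le_inv m ltac:(lra)); assert (Hem0 := exp_pos (- m)).
  assert (Hem2 : exp (- m / 2) <= 2 * / m).
  { replace (- m / 2) with (- (m / 2)) by field; eapply Rle_trans; [apply exp_neg_le_inv; lra|]; right; field; lra. }
  set (l := log_corr m).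
  assert (Hcl : forall x, continuous l x) by (intros; apply continuous_log_corr; lra).
  set (l0 := l 0).
  assert (Hl0 : Rabs (l0 - I0) <= 2 * / m) by (eapply Rle_trans; [apply HI0; lra|lra]).
  assert (Hlb : forall x, Rabs (l x) <= 2) by (intros; apply log_corr_bound; lra).
  assert (S1 : Rabs (diff2 spline_sq A D - RInt (fun tau => l tau * spline_kernel A D tau) (- (2 * m)) (2 * m)) <= 1536 * A ^ 3 * / m).
  { unfold l; rewrite RInt_log_corr_kernel by lra.
    apply Rle_trans with (4 * (24 * (2 * A) ^ 3 * (2 * / m))); [|right; ring].
    apply (diff2_approx spline_sq); try lra; intros B HB.
    apply Rle_trans with (24 * B ^ 3 * exp (- m / 2)); [exact (spline_log_corr B m (proj1 HB) Hm0)|].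
    assert (B ^ 3 <= (2 * A) ^ 3) by (apply pow_incr; lra).
    assert (0 <= B ^ 3) by (apply pow_le; lra).
    pose proof (exp_pos (- m / 2)).
    apply Rmult_le_compat; lra. }
  set (E := fun tau => 2 * l0 - l tau - l (- tau)).
  assert (HcE : forall x, continuous E x).
  { intros x; apply (continuous_minus (fun tau => 2 * l0 - l tau) (fun tau => l (- tau))).
    - apply (continuous_minus (fun _ => 2 * l0) l); [apply continuous_const|auto].
    - apply (continuous_comp (fun tau => - tau) l); [|auto].
      auto_cont; auto. }
  assert (HEb : forall x, Rabs (E x) <= 8).
  { intros x; assert (H1 := Hlb 0); assert (H2 := Hlb x); assert (H3 := Hlb (- x)); fold l0 in H1.
    apply Rabs_le_between in H1, H2, H3; apply Rabs_le; unfold E; lra. }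
  assert (Hexk : forall a b, ex_RInt (spline_kernel A D) a b) by (intros; apply ex_RInt_everywhere; auto).
  assert (HcEk : forall x, continuous (fun tau => E tau * spline_kernel A D tau) x) by (intros; apply (continuous_mult E (spline_kernel A D)); auto).
  assert (HexE : forall a b, ex_RInt (fun tau => E tau * spline_kernel A D tau) a b) by (intros; apply ex_RInt_everywhere; auto).
  (* The symmetric integral is folded onto the positive half-line, the kernel being even; this is
     where [l tau + l (- tau)] becomes [2 l0 - E tau]. *)
  assert (S2 : RInt (fun tau => l tau * spline_kernel A D tau) (- (2 * m)) (2 * m) =
    2 * l0 * RInt (spline_kernel A D) 0 (2 * m) - (RInt (fun tau => E tau * spline_kernel A D tau) 0 1 + RInt (fun tau => E tau * spline_kernel A D tau) 1 (2 * m))).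
  { rewrite RInt_ChaslesR by auto.
    rewrite RInt_sym; [|lra|intros; apply (continuous_mult l (spline_kernel A D)); auto].
    rewrite <- RInt_scalR by auto.
    rewrite <- RInt_minusR; [|apply (ex_RInt_scalR (2 * l0)); auto|auto].
    apply RInt_ext; intros x _; unfold E; rewrite spline_kernel_even by lra; rring. }
  assert (S3 := spline_kernel_tail A D (2 * m) HDA ltac:(lra) E HcE (fun x _ => HEb x)).
  assert (S4 := spline_kernel_total A D kap m ltac:(lra) ltac:(lra) ltac:(lra) Hkap).
  assert (S5 : Rabs (RInt (fun tau => E tau * spline_kernel A D tau) 0 1 - Main) <= 24 * C * sqrt D + (C + 6) * kb * / m).
  { assert (HexM : ex_RInt (fun tau => tau * (b - ln tau) * spline_kernel A D tau) 0 1).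
    { apply ex_RInt_cont; [lra|]; intros x Hx.
      apply (continuous_mult (fun tau => tau * (b - ln tau)) (spline_kernel A D)); [apply continuous_mul_ln; lra|auto]. }
    assert (Hex3 : ex_RInt (fun tau => tau * sqrt tau * Rabs (spline_kernel A D tau)) 0 1).
    { apply ex_RInt_cont; [lra|]; intros x Hx.
      apply (continuous_mult (fun x => x * sqrt x) (fun x => Rabs (spline_kernel A D x))); [apply continuous_32; lra|].
      now apply continuous_abs_spline_kernel. }
    unfold Main; rewrite <- RInt_minusR by auto.
    apply Rle_trans with (RInt (fun tau => C * (tau * sqrt tau * Rabs (spline_kernel A D tau)) + (C + 6) * kb * / m) 0 1).
    - apply RInt_abs_le; [lra|now apply ex_RInt_minusR| |].
      + apply ex_RInt_plusR; [now apply ex_RInt_scalR|apply ex_RInt_const].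
      + intros x Hx.
        replace (_ - _) with ((E x - x * (b - ln x)) * spline_kernel A D x) by ring.
        assert (A1 := Hlc m x Hm ltac:(lra)); assert (A2 := log_corr_even m x Hm ltac:(lra)); fold l l0 in A1, A2.
        assert (A3 : Rabs (E x - x * (b - ln x)) <= C * (x * sqrt x) + (C + 6) * / m).
        { apply Rabs_le_between in A1, A2; apply Rabs_le; unfold E.
          assert (C * exp (- m) <= C * / m) by (apply Rmult_le_compat_l; lra). lra. }
        rewrite Rabs_mult; assert (A4 := Hkb x); assert (A5 := Rabs_pos (spline_kernel A D x)).
        apply Rle_trans with ((C * (x * sqrt x) + (C + 6) * / m) * Rabs (spline_kernel A D x)); [apply Rmult_le_compat_r; easy|].
        rewrite Rmult_plus_distr_r, Rmult_assoc; apply Rplus_le_compat_l.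
        replace ((C + 6) * kb * / m) with ((C + 6) * / m * kb) by ring.
        apply Rmult_le_compat_l; [apply Rmult_le_pos; lra|easy].
    - rewrite RInt_plusR; [|now apply (ex_RInt_scalR C)|apply ex_RInt_const].
      rewrite RInt_scalR, RInt_constR by easy.
      assert (S := spline_kernel_error A D ltac:(lra)).
      apply (Rmult_le_compat_l C) in S; [|easy].
      revert S; rint_atoms; intros S; lra. }
  assert (S6 : Rabs (2 * l0 * RInt (spline_kernel A D) 0 (2 * m) - 4 * I0 * kap * D ^ 2) <= (16 * A + 8 * D ^ 2 * Rabs kap) * / m).
  { set (J := RInt (spline_kernel A D) 0 (2 * m)) in *.
    replace (2 * l0 * J - 4 * I0 * kap * D ^ 2) with (2 * l0 * (J - 2 * D ^ 2 * kap) + (l0 - I0) * (4 * D ^ 2 * kap)) by rring.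
    eapply Rle_trans; [apply Rabs_triang|]; rewrite Rmult_plus_distr_r; apply Rplus_le_compat.
    - rewrite Rabs_mult; replace (16 * A * / m) with (4 * (4 * A / m)) by (field; lra).
      apply Rmult_le_compat; try apply Rabs_pos; [|easy].
      rewrite Rabs_mult, Rabs_pos_eq by lra; specialize (Hlb 0); fold l0 in Hlb; lra.
    - rewrite Rabs_mult; replace (8 * D ^ 2 * Rabs kap * / m) with (2 * / m * (4 * D ^ 2 * Rabs kap)) by ring.
      apply Rmult_le_compat; try apply Rabs_pos; [easy|].
      rewrite !Rabs_mult, (Rabs_pos_eq 4), (Rabs_pos_eq (D ^ 2)) by (lra || apply pow2_ge_0); lra. }
  rewrite S2 in S1; clear S2 HexE HcEk Hexk HcE HEb.
  revert S1 S3 S5 S6; rint_atoms; intros S1 S3 S5 S6.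
  apply Rabs_le_between in S1, S3, S5, S6; apply Rabs_le; unfold Rdiv; lra. }
apply le_of_le_inv in Hm.
2:{ pose proof (pow2_ge_0 D); pose proof (Rabs_pos kap); assert (0 <= A ^ 3) by (apply pow_le; lra).
  assert (0 <= D ^ 2 * Rabs kap) by (apply Rmult_le_pos; lra).
  assert (0 <= (C + 6) * kb) by (apply Rmult_le_pos; lra). lra. }
assert (HlA := ln_ge_0 A ltac:(lra)).
assert (HD3 : 0 <= D ^ 3 * (1 + ln A) / A ^ 2).
{ apply Rmult_le_pos; [apply Rmult_le_pos; [apply pow_le; lra|lra]|apply Rlt_le, Rinv_0_lt_compat; nra]. }
assert (HDA1 : D / A <= 1).
{ apply (Rmult_le_reg_r A); [lra|]; unfold Rdiv; rewrite Rmult_assoc, Rinv_l; lra. }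
pose proof (sqrt_pos D).
set (T3 := D ^ 3 * (1 + ln A) / A ^ 2) in *; set (th := (ln A + c) / A) in *.
assert (HK1 : K * (D / A) <= K * 1) by (apply Rmult_le_compat_l; lra).
assert (0 <= C * T3) by now apply Rmult_le_pos.
assert (0 <= K * sqrt D) by now apply Rmult_le_pos.
rewrite Rmult_plus_distr_l in Hmain.
apply Rabs_le_between in Hm, Hmain; apply Rabs_le; split; nra.
Qed.

(** * Removing the smoothing *)

Definition mellin_mass A : R := RInt mellin_sq 0 A.

Lemma ex_mellin_sq_mult (f : R -> R) a b : (forall x, continuous f x) -> ex_RInt (fun t => f t * mellin_sq t) a b.
Proof.
intros Hf; apply ex_RInt_everywhere; intros t.
apply (continuous_mult f mellin_sq); [auto|apply continuous_mellin_sq].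
Qed.

Lemma ex_mellin_sq a b : ex_RInt mellin_sq a b.
Proof. apply ex_RInt_everywhere; intros; apply continuous_mellin_sq. Qed.

(* The second difference in [A] of [(A - t)_+^2 / 2] lies between [D^2] times the indicator functions
   of [t <= A - D] and of [t <= A + D]. *)
Lemma spline_sq_sandwich A D : 0 <= D <= A ->
  D ^ 2 * mellin_mass (A - D) <= diff2 spline_sq A D <= D ^ 2 * mellin_mass (A + D).
Proof.
intros HD.
assert (Hcs : forall B x, continuous (spline B) x) by (intros; apply continuous_of_ex_derive; unfold spline; auto_derive; auto).
assert (Hex : forall B a b, ex_RInt (fun t => spline B t * mellin_sq t) a b) by (intros; now apply ex_mellin_sq_mult).
assert (Hex2 : forall k B a b, ex_RInt (fun t => k * (spline B t * mellin_sq t)) a b) by (intros; now apply (ex_RInt_scalR k)).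
set (I1 := RInt (fun t => spline (A + D) t * mellin_sq t - 2 * (spline A t * mellin_sq t)) (A - D) A).
set (I2 := RInt (fun t => spline (A + D) t * mellin_sq t) A (A + D)).
assert (E : diff2 spline_sq A D = D ^ 2 * mellin_mass (A - D) + I1 + I2).
{ unfold diff2, spline_sq, mellin_mass, I1, I2.
  rewrite <- (RInt_ChaslesR _ 0 A (A + D)), <- (RInt_ChaslesR _ 0 (A - D) A) by auto.
  rewrite <- (RInt_ChaslesR (fun t => spline A t * mellin_sq t) 0 (A - D) A) by auto.
  rewrite <- RInt_scalR by apply ex_mellin_sq.
  (* For [t <= A - D] all three parabolas are present, and their second difference is exactly
     [D^2]. *)
  assert (S : RInt (fun x => D ^ 2 * mellin_sq x) 0 (A - D) =
    RInt (fun t => spline (A + D) t * mellin_sq t) 0 (A - D) - 2 * RInt (fun t => spline A t * mellin_sq t) 0 (A - D) +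
    RInt (fun t => spline (A - D) t * mellin_sq t) 0 (A - D)).
  { rewrite <- RInt_scalR, <- RInt_minusR, <- RInt_plusR by (auto || (apply ex_RInt_minusR; auto)).
    apply RInt_ext; intros t _; unfold spline; rfield. }
  rewrite S, RInt_minusR, RInt_scalR by auto; rring. }
assert (P1 : 0 <= I1 <= D ^ 2 * RInt mellin_sq (A - D) A).
{ unfold I1; rewrite <- RInt_scalR by apply ex_mellin_sq; split.
  - apply RInt_ge_0; [lra|apply ex_RInt_minusR; auto|]; intros t Ht.
    replace (_ - _) with ((spline (A + D) t - 2 * spline A t) * mellin_sq t) by ring.
    apply Rmult_le_pos; [unfold spline; nra|apply mellin_sq_ge0].
  - apply RInt_le; [lra|apply ex_RInt_minusR; auto|apply (ex_RInt_scalR (D ^ 2)), ex_mellin_sq|]; intros t Ht.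
    replace (_ - _) with ((spline (A + D) t - 2 * spline A t) * mellin_sq t) by ring.
    apply Rmult_le_compat_r; [apply mellin_sq_ge0|unfold spline; nra]. }
assert (P2 : 0 <= I2 <= D ^ 2 * RInt mellin_sq A (A + D)).
{ unfold I2; rewrite <- RInt_scalR by apply ex_mellin_sq; split.
  - apply RInt_ge_0; [lra|auto|]; intros t Ht.
    apply Rmult_le_pos; [unfold spline; nra|apply mellin_sq_ge0].
  - apply RInt_le; [lra|auto|apply (ex_RInt_scalR (D ^ 2)), ex_mellin_sq|]; intros t Ht.
    apply Rmult_le_compat_r; [apply mellin_sq_ge0|unfold spline; nra]. }
assert (E2 : mellin_mass (A + D) = mellin_mass (A - D) + RInt mellin_sq (A - D) A + RInt mellin_sq A (A + D)).
{ unfold mellin_mass; rewrite !RInt_ChaslesR by apply ex_mellin_sq; reflexivity. }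
rewrite E, E2; revert P1 P2; rint_atoms; intros P1 P2; split; nra.
Qed.

(** With [z] the eighth root of [B], the step [D = z^6] and [sqrt D = z^3] are monomials in [z], as
    are all the resulting error terms. *)
Definition root8 x := sqrt (sqrt (sqrt x)).

Lemma root8_pow x : 0 <= x -> root8 x ^ 8 = x.
Proof.
intros Hx; unfold root8.
pose proof (sqrt_pos x); pose proof (sqrt_pos (sqrt x)).
replace (sqrt (sqrt (sqrt x)) ^ 8) with (((sqrt (sqrt (sqrt x)) ^ 2) ^ 2) ^ 2) by ring.
rewrite !pow2_sqrt by easy; easy.
Qed.

Lemma root8_ge M x : 0 <= M -> M ^ 8 <= x -> M <= root8 x.
Proof.
intros HM Hx; unfold root8.
assert (E : M = sqrt (sqrt (sqrt (M ^ 8)))).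
{ replace (M ^ 8) with (((M ^ 2) ^ 2) ^ 2) by ring; rewrite !sqrt_pow2; try easy; repeat apply pow_le; easy. }
rewrite E; assert (0 <= M ^ 8) by now apply pow_le.
repeat apply sqrt_le_1; try apply sqrt_pos; lra.
Qed.

(** The sandwich at [A = B + D] bounds the mass on [[0, B]] from above, and at [A = B - D] from
    below. *)
Lemma mellin_mass_asymp : exists n c K, 0 <= K /\ forall B, 256 <= B ->
  Rabs (mellin_mass B - (n - (ln B + c) / B)) <= K / (B * root8 B).
Proof.
destruct spline_sq_diff2 as (n & c & K & HK & H).
exists n, c, (38 * K + 4 * (9 + Rabs c)); split; [pose proof (Rabs_pos c); lra|].
intros B HB.
set (z := root8 B).
assert (Ez : z ^ 8 = B) by (apply root8_pow; lra).
assert (Hz : 2 <= z) by (apply root8_ge; lra).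
(* [D = B^(3/4)]. Divided by [D^2], the error [sqrt D] becomes [z^(-9)], and [D^3 ln A / A^2]
   becomes [O(z^(-9))] because the logarithm is [O(z)]. This is smaller than [1 / B = z^(-8)]. *)
set (D := z ^ 6).
assert (HD1 : 1 <= D) by (apply pow_R1_Rle; lra).
assert (HBD : B = z ^ 2 * D) by (unfold D; rewrite <- Ez; ring).
assert (HD4 : 4 * D <= B) by (rewrite HBD; apply Rmult_le_compat_r; nra).
assert (HsD : sqrt D = z ^ 3).
{ unfold D; replace (z ^ 6) with ((z ^ 3) ^ 2) by ring; apply sqrt_pow2, pow_le; lra. }
assert (Hlz : ln B = 8 * ln z) by (rewrite <- Ez, ln_pow by lra; simpl INR; ring).
assert (Hlz2 := ln_le_sub z ltac:(lra)); assert (Hlz3 := ln_ge_0 z ltac:(lra)).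
assert (Hz9 : 0 < z ^ 9) by (apply pow_lt; lra).
assert (Hlx : forall x, B / 2 <= x <= 2 * B -> 0 <= ln x <= 8 * z).
{ intros x Hx; split; [apply ln_ge_0; lra|].
  apply Rle_trans with (ln (2 * B)); [apply ln_le; lra|].
  rewrite ln_mult by lra; pose proof (ln_le_sub 2 ltac:(lra)); lra. }
assert (Hx2 : forall x, B / 2 <= x -> 0 < / x ^ 2 <= 4 / z ^ 16).
{ intros x Hx; split; [apply Rinv_0_lt_compat; nra|].
  replace (4 / z ^ 16) with (/ (B / 2) ^ 2) by (rewrite <- Ez; field; lra).
  apply Rinv_le_contravar; [nra|apply pow_incr; lra]. }
(* With [ln A <= 8 z] and [A >= B / 2] the bracket is at most [(1 + 1 + 36) z^3]. *)
assert (Herr : forall A, B - D <= A <= B + D ->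
  K * (1 + sqrt D + D ^ 3 * (1 + ln A) / A ^ 2) <= D ^ 2 * (38 * K / z ^ 9)).
{ intros A HA.
  assert (HlA := Hlx A ltac:(lra)); assert (HA2 := Hx2 A ltac:(lra)).
  replace (D ^ 2 * (38 * K / z ^ 9)) with (K * (38 * z ^ 3)) by (unfold D; field; lra).
  apply Rmult_le_compat_l; [easy|]; rewrite HsD.
  assert (1 <= z ^ 3) by (apply pow_R1_Rle; lra).
  assert (D ^ 3 * (1 + ln A) / A ^ 2 <= 36 * z ^ 3).
  { apply Rle_trans with (z ^ 18 * (9 * z) * (4 / z ^ 16)).
    - unfold Rdiv at 1; apply Rmult_le_compat; [|lra| |lra].
      + apply Rmult_le_pos; [apply pow_le; lra|lra].
      + replace (D ^ 3) with (z ^ 18) by (unfold D; ring); apply Rmult_le_compat_l; [apply pow_le; lra|lra].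
    - right; field; lra. }
  lra. }
set (th := fun x => (ln x + c) / x).
(* Moving the argument of the main term by [D] costs again [O(z^(-9))]. *)
assert (Hth : forall a b, B - D <= a -> a <= b -> b <= B + D -> b - a <= D -> Rabs (th b - th a) <= 4 * (9 + Rabs c) / z ^ 9).
{ intros a b Ha Hab Hb Hba.
  apply Rle_trans with ((9 + Rabs c) * z * (4 / z ^ 16) * (b - a)).
  - apply (mvt_bound th (fun x => (1 - ln x - c) / x ^ 2)); [easy| |].
    + intros x Hx; unfold th; auto_derive; [lra|field; lra].
    + intros x Hx; assert (H1 := Hlx x ltac:(lra)); assert (H2 := Hx2 x ltac:(lra)).
      unfold Rdiv at 1; rewrite Rabs_mult, (Rabs_pos_eq (/ x ^ 2)) by lra.
      apply Rmult_le_compat; [apply Rabs_pos|lra| |lra].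
      assert (Hcc : - Rabs c <= c <= Rabs c) by (split; [pose proof (Rle_abs (- c)); rewrite Rabs_Ropp in *; lra|apply Rle_abs]).
      apply Rabs_le; pose proof (Rabs_pos c); split; nra.
  - replace (4 * (9 + Rabs c) / z ^ 9) with ((9 + Rabs c) * z * (4 / z ^ 16) * D) by (unfold D; field; lra).
    apply Rmult_le_compat_l; [|easy].
    pose proof (Rabs_pos c); assert (0 < 4 / z ^ 16) by (apply Rdiv_lt_0_compat; [lra|apply pow_lt; lra]).
    apply Rmult_le_pos; [apply Rmult_le_pos; lra|lra]. }
assert (HD2 : 0 < D ^ 2) by nra.
assert (U : mellin_mass B <= n - th B + (38 * K / z ^ 9 + 4 * (9 + Rabs c) / z ^ 9)).
{ assert (S := proj1 (spline_sq_sandwich (B + D) D ltac:(lra))).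
  replace (B + D - D) with B in S by ring.
  assert (S2 := H (B + D) D ltac:(lra) ltac:(lra)); assert (S3 := Herr (B + D) ltac:(lra)).
  assert (S4 := Hth B (B + D) ltac:(lra) ltac:(lra) ltac:(lra) ltac:(lra)).
  fold (th (B + D)) in S2.
  apply Rabs_le_between in S2, S4.
  apply (Rmult_le_reg_l (D ^ 2)); [easy|].
  apply Rle_trans with (D ^ 2 * (n - th (B + D)) + D ^ 2 * (38 * K / z ^ 9)); [lra|].
  rewrite <- Rmult_plus_distr_l; apply Rmult_le_compat_l; lra. }
assert (Lo : n - th B - (38 * K / z ^ 9 + 4 * (9 + Rabs c) / z ^ 9) <= mellin_mass B).
{ assert (S := proj2 (spline_sq_sandwich (B - D) D ltac:(lra))).
  replace (B - D + D) with B in S by ring.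
  assert (S2 := H (B - D) D ltac:(lra) ltac:(lra)); assert (S3 := Herr (B - D) ltac:(lra)).
  assert (S4 := Hth (B - D) B ltac:(lra) ltac:(lra) ltac:(lra) ltac:(lra)).
  fold (th (B - D)) in S2.
  apply Rabs_le_between in S2, S4.
  apply (Rmult_le_reg_l (D ^ 2)); [easy|].
  apply Rle_trans with (D ^ 2 * (n - th (B - D)) - D ^ 2 * (38 * K / z ^ 9)); [|lra].
  rewrite <- Rmult_minus_distr_l; apply Rmult_le_compat_l; lra. }
replace ((38 * K + 4 * (9 + Rabs c)) / (B * z)) with (38 * K / z ^ 9 + 4 * (9 + Rabs c) / z ^ 9)
 by (rewrite <- Ez; field; lra).
fold (th B); apply Rabs_le; lra.
Qed.

(** * The mean square of zeta on the critical line *)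

Definition Z2_int T : R := RInt Z2 0 T.

Lemma ex_Z2 a b : ex_RInt Z2 a b.
Proof. apply ex_RInt_everywhere; intros; apply continuous_Z2. Qed.

Lemma is_derive_mellin_mass t : is_derive mellin_mass t (mellin_sq t).
Proof. apply (is_derive_RInt_cont mellin_sq 0 t), continuous_mellin_sq. Qed.

Lemma continuous_mellin_mass t : continuous mellin_mass t.
Proof. apply continuous_of_ex_derive; exists (mellin_sq t); apply is_derive_mellin_mass. Qed.

Lemma Z2_int_parts T : 0 <= T ->
  Z2_int T = (/ 4 + T ^ 2) * mellin_mass T - RInt (fun t => 2 * t * mellin_mass t) 0 T.
Proof.
intros HT.
assert (HcT : forall x, continuous (fun t => 2 * t * mellin_mass t) x).
{ intros x; apply (continuous_mult (fun t => 2 * t) mellin_mass); [|apply continuous_mellin_mass].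
  auto_cont; auto. }
assert (Hex : ex_RInt (fun t => 2 * t * mellin_mass t) 0 T) by (apply ex_RInt_cont; auto).
assert (E : RInt (fun t => Z2 t + 2 * t * mellin_mass t) 0 T = (/ 4 + T ^ 2) * mellin_mass T - (/ 4 + 0 ^ 2) * mellin_mass 0).
{ apply (RInt_FTC (fun t => (/ 4 + t ^ 2) * mellin_mass t)); auto.
  - intros t _.
    assert (D1 : is_derive (fun t => / 4 + t ^ 2) t (2 * t)) by (auto_derive; auto; ring).
    assert (D2 := is_derive_mult _ _ _ _ _ D1 (is_derive_mellin_mass t) Rmult_comm).
    match type of D2 with is_derive _ _ ?z => replace (Z2 t + 2 * t * mellin_mass t) with z; [exact D2|] end.
    change (2 * t * mellin_mass t + (/ 4 + t ^ 2) * mellin_sq t = Z2 t + 2 * t * mellin_mass t).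
    rewrite Z2_mellin; ring.
  - intros t _; apply (continuous_plus Z2 (fun t => 2 * t * mellin_mass t)); [apply continuous_Z2|apply HcT]. }
assert (H0 : mellin_mass 0 = 0) by exact (RInt_point 0 mellin_sq).
rewrite H0, RInt_plusR in E by (auto; apply ex_Z2).
unfold Z2_int; revert E; rint_atoms; intros E; lra.
Qed.

Lemma root8_inv_small K eps : 0 <= K -> 0 < eps -> exists X, 256 <= X /\ forall x, X <= x -> K / root8 x <= eps.
Proof.
intros HK He; set (M := 2 + K / eps).
assert (HM : 2 <= M) by (unfold M; assert (0 <= K / eps) by (apply Rmult_le_pos; [easy|apply Rlt_le, Rinv_0_lt_compat; lra]); lra).
exists (M ^ 8); split; [replace 256 with (2 ^ 8) by ring; apply pow_incr; lra|].
intros x Hx; assert (H := root8_ge M x ltac:(lra) Hx).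
apply (Rmult_le_reg_r (root8 x)); [lra|]; unfold Rdiv; rewrite Rmult_assoc, Rinv_l, Rmult_1_r by lra.
apply Rle_trans with (eps * M); [unfold M|apply Rmult_le_compat_l; lra].
replace (eps * (2 + K / eps)) with (2 * eps + K) by (field; lra); lra.
Qed.

(** In [T^2 mellin_mass T] minus the integral of [2 t mellin_mass t] the terms [n T^2] cancel. The
    term [- (ln t + c) / t] of the mass contributes [- T (ln T + c) + 2 T ln T - 2 T + 2 c T], hence
    the coefficient 1 of [T ln T] and the value [a = c - 2]. *)
Lemma Z2_int_asymp : exists a, forall eps, 0 < eps -> exists T0, 1 <= T0 /\ forall T, T0 <= T ->
  Rabs (Z2_int T - (T * ln T + a * T)) <= eps * T.
Proof.
destruct mellin_mass_asymp as (n & c & K & HK & H).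
exists (c - 2); intros eps He.
destruct (root8_inv_small K (eps / 8) HK ltac:(lra)) as (X & HX & HXe).
set (e := fun t => mellin_mass t - (n - (ln t + c) / t)).
assert (He1 : forall t, 256 <= t -> Rabs (e t) <= K / (t * root8 t)) by exact H.
assert (He2 : forall t, X <= t -> Rabs (t * e t) <= eps / 8).
{ intros t Ht; rewrite Rabs_mult, Rabs_pos_eq by lra.
  eapply Rle_trans; [apply Rmult_le_compat_l; [lra|apply He1; lra]|].
  assert (2 <= root8 t) by (apply root8_ge; lra).
  replace (t * (K / (t * root8 t))) with (K / root8 t) by (field; lra); now apply HXe. }
assert (HcT : forall x, continuous (fun t => 2 * t * mellin_mass t) x).
{ intros x; apply (continuous_mult (fun t => 2 * t) mellin_mass); [|apply continuous_mellin_mass].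
  auto_cont; auto. }
assert (Hex : forall a b, ex_RInt (fun t => 2 * t * mellin_mass t) a b) by (intros; apply ex_RInt_everywhere; auto).
set (c3 := RInt (fun t => 2 * t * mellin_mass t) 0 X : R).
(* A primitive of [2 t (n - (ln t + c) / t)]. *)
set (P := fun t => n * t ^ 2 - 2 * t * ln t + 2 * t - 2 * c * t).
set (Q := Rabs n + Rabs c3 + Rabs (P X) + 1 + Rabs c + Rabs (eps * X)).
exists (X + 8 * Q / eps); split.
{ assert (0 <= 8 * Q / eps); [|lra].
  apply Rmult_le_pos; [|apply Rlt_le, Rinv_0_lt_compat; lra].
  unfold Q; pose proof (Rabs_pos n); pose proof (Rabs_pos c3); pose proof (Rabs_pos (P X)); pose proof (Rabs_pos c); pose proof (Rabs_pos (eps * X)); lra. }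
intros T HT.
assert (HQ0 : 0 <= Q) by (unfold Q; pose proof (Rabs_pos n); pose proof (Rabs_pos c3); pose proof (Rabs_pos (P X)); pose proof (Rabs_pos c); pose proof (Rabs_pos (eps * X)); lra).
assert (HQe : 0 <= 8 * Q / eps) by (apply Rmult_le_pos; [lra|apply Rlt_le, Rinv_0_lt_compat; lra]).
assert (HQT : Q <= eps / 8 * T).
{ assert (H1 : eps / 8 * (8 * Q / eps) <= eps / 8 * T) by (apply Rmult_le_compat_l; lra).
  replace (eps / 8 * (8 * Q / eps)) with Q in H1 by (field; lra); easy. }
rewrite Z2_int_parts, <- (RInt_ChaslesR _ 0 X T) by (auto; lra); fold c3.
assert (HI : Rabs (RInt (fun t => 2 * t * mellin_mass t) X T - (P T - P X)) <= (T - X) * (eps / 4)).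
{ rewrite <- (RInt_FTC P (fun t => 2 * n * t - 2 * (ln t + c))); [|lra| |].
  - rewrite <- RInt_minusR.
    + apply RInt_const_bound; [lra| |].
      * apply ex_RInt_minusR; auto; apply ex_RInt_cont; [lra|]; intros t Ht; auto_cont; lra.
      * intros t Ht; replace (_ - _) with (2 * (t * e t)) by (unfold e; field; lra).
        rewrite Rabs_mult, (Rabs_pos_eq 2) by lra; specialize (He2 t ltac:(lra)); lra.
    + auto.
    + apply ex_RInt_cont; [lra|]; intros t Ht; auto_cont; lra.
  - intros t Ht; unfold P; auto_derive; [lra|field; lra].
  - intros t Ht; auto_cont; lra. }
assert (EN : mellin_mass T = n - (ln T + c) / T + e T) by (unfold e; ring).
rewrite EN; assert (HeT := He2 T ltac:(lra)).
assert (HlT := ln_ge_0 T ltac:(lra)); assert (HlT2 := ln_le_sub T ltac:(lra)).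
assert (HeT' : Rabs (e T) <= eps / 8).
{ rewrite Rabs_mult, (Rabs_pos_eq T) in HeT by lra; pose proof (Rabs_pos (e T)); nra. }
assert (HeT2 : Rabs (T ^ 2 * e T) <= eps / 8 * T).
{ replace (T ^ 2 * e T) with (T * (T * e T)) by ring; rewrite Rabs_mult, (Rabs_pos_eq T) by lra.
  rewrite Rmult_comm; apply Rmult_le_compat_r; lra. }
assert (Hth : Rabs (/ 4 * ((ln T + c) / T)) <= 1 + Rabs c).
{ assert (Hi : 0 < / T <= 1) by (split; [apply Rinv_0_lt_compat; lra|rewrite <- Rinv_1; apply Rinv_le_contravar; lra]).
  assert (Hl1 : 0 <= ln T * / T <= 1) by (split; [apply Rmult_le_pos; lra|apply (Rmult_le_reg_r T); [lra|rewrite Rmult_assoc, Rinv_l; lra]]).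
  assert (Hc1 : Rabs (c * / T) <= Rabs c).
  { rewrite Rabs_mult, (Rabs_pos_eq (/ T)) by lra; pose proof (Rabs_pos c); nra. }
  replace (/ 4 * ((ln T + c) / T)) with (/ 4 * (ln T * / T) + / 4 * (c * / T)) by (field; lra).
  apply Rabs_le_between in Hc1; pose proof (Rabs_pos c); apply Rabs_le; lra. }
set (J := RInt (fun t => 2 * t * mellin_mass t) X T : R) in *.
assert (E2 : (/ 4 + T ^ 2) * (n - (ln T + c) / T + e T) - (c3 + J) - (T * ln T + (c - 2) * T) =
  / 4 * n - / 4 * ((ln T + c) / T) + / 4 * e T + T ^ 2 * e T - c3 + P X - (J - (P T - P X))).
{ unfold P; field; lra. }
rewrite E2.
assert (HXe2 : Rabs (eps * X) = eps * X) by (apply Rabs_pos_eq; nra).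
pose proof (Rle_abs n); pose proof (Rle_abs c3); pose proof (Rle_abs (P X)).
pose proof (Rle_abs (- n)); pose proof (Rle_abs (- c3)); pose proof (Rle_abs (- P X)).
rewrite Rabs_Ropp in *.
unfold Q in HQT; rewrite HXe2 in HQT.
apply Rabs_le_between in HI, HeT', HeT2, Hth.
assert (0 < eps * X) by nra; assert (0 < eps * T) by nra.
assert (eps * 1 <= eps * T) by (apply Rmult_le_compat_l; lra).
apply Rabs_le; split; lra.
Qed.

(** * The constant [c0] of the exponential mean *)

Lemma exp_ge_pow4 s : 0 <= s -> s ^ 4 / 256 <= exp s.
Proof.
intros Hs; replace s with (s / 4 + s / 4 + s / 4 + s / 4) at 2 by field; rewrite !exp_plus.
pose proof (exp_ineq1_le (s / 4)).
replace (s ^ 4 / 256) with ((s / 4) * (s / 4) * (s / 4) * (s / 4)) by field.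
repeat apply Rmult_le_compat; try lra; repeat apply Rmult_le_pos; lra.
Qed.

Lemma exp_neg_decay s : 0 < s -> exp (- s) <= 256 / s ^ 4.
Proof.
intros Hs; rewrite exp_Ropp; replace (256 / s ^ 4) with (/ (s ^ 4 / 256)) by (field; lra).
apply Rinv_le_contravar; [apply Rdiv_lt_0_compat; [apply pow_lt; lra|lra]|apply exp_ge_pow4; lra].
Qed.

(* Cubic Taylor bound at [u = 1] of [2 u ln u], whose fourth derivative is positive. *)
Lemma ln_taylor u : 0 < u -> 2 * (u - 1) + (u - 1) ^ 2 - (u - 1) ^ 3 / 3 <= 2 * u * ln u.
Proof.
intros Hu.
set (g := fun u => ln u - (2 * (u - 1) + (u - 1) ^ 2 - (u - 1) ^ 3 / 3) / (2 * u)).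
assert (Hg : 0 <= g u).
{ assert (g1 : g 1 = 0) by (unfold g; rewrite ln_1; field).
  destruct (MVT_gen g 1 u (fun u => (u - 1) ^ 3 / 3 / u ^ 2)) as (x & Hx & E).
  - intros x Hx; assert (Hx0 : 0 < x) by (apply Rlt_trans with (Rmin 1 u); [apply Rmin_pos; lra|lra]).
    unfold g; auto_derive; [repeat split; lra|field; lra].
  - intros x Hx; assert (Hx0 : 0 < x) by (apply Rlt_le_trans with (Rmin 1 u); [apply Rmin_pos; lra|lra]).
    apply continuity_pt_filterlim, continuous_of_ex_derive; unfold g; auto_derive; repeat split; lra.
  - assert (Hx0 : 0 < x) by (apply Rlt_le_trans with (Rmin 1 u); [apply Rmin_pos; lra|lra]).
    rewrite g1, Rminus_0_r in E; rewrite E.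
    replace ((x - 1) ^ 3 / 3 / x ^ 2 * (u - 1)) with ((x - 1) ^ 2 * ((x - 1) * (u - 1)) * / (3 * x ^ 2)) by (field; lra).
    assert (0 <= (x - 1) * (u - 1)).
    { destruct (Rle_dec 1 u) as [H1|H1].
      - rewrite Rmin_left, Rmax_right in Hx by lra; apply Rmult_le_pos; lra.
      - rewrite Rmin_right, Rmax_left in Hx by lra; nra. }
    apply Rmult_le_pos; [apply Rmult_le_pos; [apply pow2_ge_0|easy]|apply Rlt_le, Rinv_0_lt_compat; nra]. }
apply (Rmult_le_compat_l (2 * u)) in Hg; [|lra]; unfold g in Hg.
replace (2 * u * (ln u - (2 * (u - 1) + (u - 1) ^ 2 - (u - 1) ^ 3 / 3) / (2 * u))) with
 (2 * u * ln u - (2 * (u - 1) + (u - 1) ^ 2 - (u - 1) ^ 3 / 3)) in Hg by (field; lra).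
lra.
Qed.

Lemma ln_2_lower : 2 / 3 <= ln 2.
Proof. pose proof (ln_taylor 2 ltac:(lra)); lra. Qed.

Definition gamma_log s := s * ln s * exp (- s).

Lemma continuous_gamma_log s : 0 <= s -> continuous gamma_log s.
Proof.
intros Hs; apply (continuous_mult (fun s => s * ln s) (fun s => exp (- s))).
- apply (continuous_ext (fun x => - (x * (0 - ln x)))); [intros; rring|].
  apply (continuous_opp (fun x => x * (0 - ln x))); now apply continuous_mul_ln.
- auto_cont; auto.
Qed.

Lemma ex_gamma_log a b : 0 <= a -> a <= b -> ex_RInt gamma_log a b.
Proof. intros Ha Hab; apply ex_RInt_cont; auto; intros; apply continuous_gamma_log; lra. Qed.

(** The cubic Taylor polynomial of [s ln s] at [s = 2], a minorant that can be integrated exactly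
    against [exp (- s)]. *)
Definition taylor2 s := 2 * ln 2 + (1 + ln 2) * (s - 2) + (s - 2) ^ 2 / 4 - (s - 2) ^ 3 / 24.

Lemma taylor2_le s : 0 < s -> taylor2 s <= s * ln s.
Proof.
intros Hs; pose proof (ln_taylor (s / 2) ltac:(lra)) as H.
rewrite ln_div in H by lra; unfold taylor2.
replace (2 * (s / 2) * (ln s - ln 2)) with (s * ln s - s * ln 2) in H by field.
replace ((s / 2 - 1) ^ 2) with ((s - 2) ^ 2 / 4) in H by field.
replace ((s / 2 - 1) ^ 3) with ((s - 2) ^ 3 / 8) in H by field.
lra.
Qed.

(* [c0] is [1 - gamma = 0.42...]; any lower bound above [0.18] will do. *)
Lemma gamma_log_integral : exists c0, / 4 <= c0 /\ forall S, 1 <= S -> Rabs (RInt gamma_log 0 S - c0) <= 256 / S.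
Proof.
destruct (tail_limit (fun S => RInt gamma_log 0 S) (fun S => 256 / S)) as [c0 Hc0].
- intros x y Hxy; rewrite <- (RInt_ChaslesR _ 0 x y) by (apply ex_gamma_log; lra).
  replace (_ + _ - _) with (RInt gamma_log x y) by rring.
  apply Rle_trans with (- (256 / y) - - (256 / x)).
  + apply (RInt_abs_le_derive _ (fun x => - (256 / x)) (fun x => 256 / x ^ 2)); [lra|apply ex_gamma_log; lra| | |].
    * intros z Hz; auto_derive; [lra|field; lra].
    * intros z Hz; auto_cont; apply Rgt_not_eq; nra.
    * intros z Hz; unfold gamma_log.
      assert (Hl := ln_ge_0 z ltac:(lra)); assert (Hl2 := ln_le_sub z ltac:(lra)); assert (He := exp_pos (- z)).
      assert (0 <= z * ln z <= z ^ 2) by (split; nra).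
      rewrite Rabs_pos_eq by (apply Rmult_le_pos; lra).
      apply Rle_trans with (z ^ 2 * (256 / z ^ 4)); [apply Rmult_le_compat; try lra; apply exp_neg_decay; lra|].
      right; field; lra.
  + assert (0 < 256 / y) by (apply Rdiv_lt_0_compat; lra); lra.
- intros eps He; apply (inv_lt_eps 256 eps); lra.
- exists c0; split; [|exact Hc0].
  (* [P] is the sum of [taylor2] and its derivatives, so [- P s exp (- s)] is a primitive of
     [taylor2 s exp (- s)]. The integral over the half-line is then [P 0 = ln 2 - 5/12], which is at
     least [1/4] because [ln 2 >= 2/3]. *)
  set (P := fun s => taylor2 s + (1 + ln 2 + (s - 2) / 2 - (s - 2) ^ 2 / 8) + (/ 2 - (s - 2) / 4) - / 4).
  assert (Hcx : forall x, continuous (fun s => taylor2 s * exp (- s)) x).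
  { intros x; apply continuous_of_ex_derive; unfold taylor2; auto_derive; auto. }
  apply (le_of_le_inv _ _ (256 + 256 * 20)); [lra|]; intros S HS.
  assert (H1 := Hc0 S ltac:(lra)); apply Rabs_le_between in H1.
  assert (H2 : RInt (fun s => taylor2 s * exp (- s)) 0 S <= RInt gamma_log 0 S).
  { apply RInt_le; [lra|apply ex_RInt_cont; [lra|auto]|apply ex_gamma_log; lra|].
    intros s Hs; unfold gamma_log; apply Rmult_le_compat_r; [apply Rlt_le, exp_pos|apply taylor2_le; lra]. }
  rewrite (RInt_FTC (fun s => - P s * exp (- s))) in H2; [|lra| |auto].
  2:{ intros s _; unfold P, taylor2; auto_derive; auto; field. }
  rewrite Ropp_0, exp_0 in H2.
  assert (HP0 : P 0 = ln 2 - 5 / 12) by (unfold P, taylor2; field).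
  assert (Hl := ln_2_lower); assert (Hl2 := ln_le_sub 2 ltac:(lra)).
  assert (HPS : P S <= 20 * S ^ 3).
  { unfold P, taylor2; assert (4 <= S ^ 2) by nra; assert (S ^ 2 <= S ^ 3) by nra.
    assert (0 <= (S - 2) ^ 3) by (apply pow_le; lra); assert (0 <= (S - 2) ^ 2) by (apply pow_le; lra).
    assert ((S - 2) ^ 2 <= S ^ 2) by (apply pow_incr; lra).
    assert ((1 + ln 2) * (S - 2) <= 2 * S) by nra. nra. }
  assert (He := exp_neg_decay S ltac:(lra)); assert (He0 := exp_pos (- S)).
  assert (HPe : P S * exp (- S) <= 256 * 20 / S).
  { apply Rle_trans with (20 * S ^ 3 * exp (- S)); [apply Rmult_le_compat_r; lra|].
    apply Rle_trans with (20 * S ^ 3 * (256 / S ^ 4)); [apply Rmult_le_compat_l; [|easy]|right; field; lra].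
    apply Rmult_le_pos; [lra|apply pow_le; lra]. }
  replace ((256 + 256 * 20) / S) with (256 / S + 256 * 20 / S) by (field; lra).
  revert H1 H2; rint_atoms; intros H1 H2; rewrite HP0 in H2; lra.
Qed.

(** * The exponentially weighted mean square *)

Lemma Z2_int_0 : Z2_int 0 = 0.
Proof. exact (RInt_point 0 Z2). Qed.

Lemma is_derive_Z2_int t : is_derive Z2_int t (Z2 t).
Proof. apply (is_derive_RInt_cont Z2 0 t), continuous_Z2. Qed.

Lemma continuous_Z2_int t : continuous Z2_int t.
Proof. apply continuous_of_ex_derive; exists (Z2 t); apply is_derive_Z2_int. Qed.

Lemma Z2_int_le s t : s <= t -> Z2_int s <= Z2_int t.
Proof.
intros H; unfold Z2_int; rewrite <- (RInt_ChaslesR Z2 0 s t) by apply ex_Z2.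
assert (0 <= RInt Z2 s t) by (apply RInt_ge_0; auto; [apply ex_Z2|intros; apply Z2_ge0]).
revert H0; rint_atoms; intros; lra.
Qed.

(** The exponential mean starts at 0, so the expansion is needed on the whole half-line; the compact
    range is absorbed by [C]. *)
Lemma Z2_int_remainder : exists a, forall eps, 0 < eps -> exists C, 0 <= C /\ forall t, 0 <= t ->
  Rabs (Z2_int t - (t * ln t + a * t)) <= C + eps * t.
Proof.
destruct Z2_int_asymp as [a Ha]; exists a; intros eps He.
destruct (Ha eps He) as (T0 & HT0 & H).
exists (Z2_int T0 + 2 + T0 ^ 2 + Rabs a * T0).
assert (H0 : 0 <= Z2_int T0) by (rewrite <- Z2_int_0; apply Z2_int_le; lra).
assert (HaT : 0 <= Rabs a * T0) by (apply Rmult_le_pos; [apply Rabs_pos|lra]).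
assert (HC : 0 <= Z2_int T0 + 2 + T0 ^ 2 + Rabs a * T0) by nra.
split; [easy|]; intros t Ht.
assert (0 <= eps * t) by (apply Rmult_le_pos; lra).
destruct (Rle_dec T0 t) as [Hl|Hl]; [specialize (H t Hl); lra|].
assert (B1 : 0 <= Z2_int t <= Z2_int T0) by (split; [rewrite <- Z2_int_0|]; apply Z2_int_le; lra).
assert (B2 : Rabs (t * ln t) <= 2 + T0 ^ 2).
{ rewrite Rabs_mult; destruct (Rle_dec t 1) as [Ht1|Ht1].
  - assert (B := abs_mul_ln_bound t ltac:(rewrite Rabs_pos_eq; lra)).
    rewrite (Rabs_pos_eq t) in * by lra.
    assert (sqrt t <= 1) by (rewrite <- sqrt_1; apply sqrt_le_1; lra). nra.
  - assert (Hl1 := ln_ge_0 t ltac:(lra)); assert (Hl2 := ln_le_sub t ltac:(lra)).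
    rewrite !Rabs_pos_eq by lra; nra. }
assert (B3 : Rabs (a * t) <= Rabs a * T0).
{ rewrite Rabs_mult, (Rabs_pos_eq t) by lra; apply Rmult_le_compat_l; [apply Rabs_pos|lra]. }
apply Rabs_le_between in B2, B3; apply Rabs_le; lra.
Qed.

(** With [y = phi / 2] the weight [exp (- 2 t / phi)] of the integral equation becomes
    [exp (- t / y)], and [y] is the ladder [phi_1] itself. *)
Definition Z2_laplace y m : R := RInt (fun t => Z2 t * exp (- (t / y))) 0 m.

Lemma Z2_laplace_parts y m : 0 < y -> 0 <= m ->
  Z2_laplace y m = Z2_int m * exp (- (m / y)) + / y * RInt (fun t => Z2_int t * exp (- (t / y))) 0 m.
Proof.
intros Hy Hm.
assert (Hce : forall x, continuous (fun t => exp (- (t / y))) x) by (intros; auto_cont; auto).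
assert (C1 : forall x, continuous (fun t => Z2 t * exp (- (t / y))) x).
{ intros x; apply (continuous_mult Z2 (fun t => exp (- (t / y)))); [apply continuous_Z2|auto]. }
assert (C2 : forall x, continuous (fun t => / y * (Z2_int t * exp (- (t / y)))) x).
{ intros x; apply (continuous_mult (fun _ => / y) (fun t => Z2_int t * exp (- (t / y)))); [apply continuous_const|].
  apply (continuous_mult Z2_int (fun t => exp (- (t / y)))); [apply continuous_Z2_int|auto]. }
assert (C3 : ex_RInt (fun t => Z2_int t * exp (- (t / y))) 0 m).
{ apply ex_RInt_cont; auto; intros; apply (continuous_mult Z2_int (fun t => exp (- (t / y)))); [apply continuous_Z2_int|auto]. }
assert (E : RInt (fun t => Z2 t * exp (- (t / y)) - / y * (Z2_int t * exp (- (t / y)))) 0 m =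
  Z2_int m * exp (- (m / y)) - Z2_int 0 * exp (- (0 / y))).
{ apply (RInt_FTC (fun t => Z2_int t * exp (- (t / y)))); auto.
  - intros t _.
    assert (D1 : is_derive (fun t => exp (- (t / y))) t (- / y * exp (- (t / y)))) by (auto_derive; [auto|unfold Rdiv; field; lra]).
    assert (D2 := is_derive_mult _ _ _ _ _ (is_derive_Z2_int t) D1 Rmult_comm).
    match type of D2 with is_derive _ _ ?z => match goal with |- is_derive _ _ ?w => replace w with z; [exact D2|] end end.
    change (Z2 t * exp (- (t / y)) + Z2_int t * (- / y * exp (- (t / y))) = Z2 t * exp (- (t / y)) - / y * (Z2_int t * exp (- (t / y)))); ring.
  - intros t _; apply (continuous_minus (fun t => Z2 t * exp (- (t / y))) (fun t => / y * (Z2_int t * exp (- (t / y))))); auto. }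
rewrite RInt_minusR, RInt_scalR, Z2_int_0 in E; auto; try (apply ex_RInt_cont; auto).
unfold Z2_laplace; revert E; rint_atoms; intros E; lra.
Qed.

(** Serves to integrate an error [C + eps t] against [exp (- t / y) / y], a density of mass 1 and
    mean [y] on the half-line. *)
Lemma exp_moments y m : 0 < y -> 0 <= m ->
  / y * RInt (fun t => exp (- (t / y))) 0 m <= 1 /\ / y * RInt (fun t => t * exp (- (t / y))) 0 m <= y.
Proof.
intros Hy Hm.
rewrite (RInt_FTC (fun t => - y * exp (- (t / y)))); auto.
2:{ intros t _; auto_derive; auto; unfold Rdiv; field; lra. }
2:{ intros t _; auto_cont; auto. }
rewrite (RInt_FTC (fun t => - (y * (t + y)) * exp (- (t / y)))); auto.
2:{ intros t _; auto_derive; auto; unfold Rdiv; field; lra. }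
2:{ intros t _; auto_cont; auto. }
replace (- (0 / y)) with 0 by (field; lra); rewrite exp_0.
pose proof (exp_pos (- (m / y))); split.
- apply (Rmult_le_reg_l y); [easy|]; rewrite <- Rmult_assoc, Rinv_r by lra; nra.
- apply (Rmult_le_reg_l y); [easy|]; rewrite <- Rmult_assoc, Rinv_r by lra.
  assert (0 <= y * (m + y) * exp (- (m / y))) by (apply Rmult_le_pos; [apply Rmult_le_pos; lra|lra]); nra.
Qed.

(** The substitution [t = y s] splits [ln t] into [ln y + ln s]; the first part leads to an
    elementary integral, the second to [gamma_log]. *)
Lemma main_laplace a y m : 0 < y -> 0 <= m ->
  / y * RInt (fun t => (t * ln t + a * t) * exp (- (t / y))) 0 m =
  y * (RInt gamma_log 0 (m / y) + (ln y + a) * (1 - (1 + m / y) * exp (- (m / y)))).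
Proof.
intros Hy Hm; set (S := m / y).
assert (HS : 0 <= S) by (apply Rmult_le_pos; [easy|apply Rlt_le, Rinv_0_lt_compat; easy]).
assert (ES : m = y * S + 0) by (unfold S; field; lra).
assert (Hex : ex_RInt (fun t => (t * ln t + a * t) * exp (- (t / y))) 0 m).
{ apply ex_RInt_cont; auto; intros x Hx.
  apply (continuous_mult (fun t => t * ln t + a * t) (fun t => exp (- (t / y)))).
  - apply (continuous_ext (fun x => - (x * (- a - ln x)))); [intros; rring|].
    apply (continuous_opp (fun x => x * (- a - ln x))); apply continuous_mul_ln; lra.
  - auto_cont; auto. }
assert (E : RInt (fun t => (t * ln t + a * t) * exp (- (t / y))) 0 m =
  RInt (fun s => y * ((y * s + 0) * ln (y * s + 0) + a * (y * s + 0)) * exp (- ((y * s + 0) / y))) 0 S).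
{ rewrite ES in Hex |- *; replace 0 with (y * 0 + 0) in Hex at 1 by ring.
  replace (RInt (fun t => (t * ln t + a * t) * exp (- (t / y))) 0 (y * S + 0)) with
   (RInt (fun t => (t * ln t + a * t) * exp (- (t / y))) (y * 0 + 0) (y * S + 0)) by (f_equal; ring).
  rewrite <- (RInt_comp_lin (fun t => (t * ln t + a * t) * exp (- (t / y))) y 0 0 S) by exact Hex.
  apply RInt_ext; intros s _; change (scal y ?z) with (y * z); rring. }
assert (Hcs : forall x, continuous (fun s => s * exp (- s)) x) by (intros; auto_cont; auto).
rewrite E, (RInt_extR _ (fun s => y ^ 2 * gamma_log s + y ^ 2 * (ln y + a) * (s * exp (- s)))); auto.
- rewrite RInt_lin2; [|apply ex_gamma_log; lra|apply ex_RInt_cont; auto].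
  rewrite (RInt_FTC (fun s => - (1 + s) * exp (- s)) (fun s => s * exp (- s))); auto.
  + rewrite Ropp_0, exp_0; rfield; lra.
  + intros s _; auto_derive; auto; ring.
- intros s Hs; unfold gamma_log; rewrite Rplus_0_r, ln_mult by lra.
  replace (y * s / y) with s by (field; lra); ring.
Qed.

Lemma abs_bounds x : - Rabs x <= x <= Rabs x.
Proof. split; [pose proof (Rle_abs (- x)); rewrite Rabs_Ropp in *; lra|apply Rle_abs]. Qed.

Lemma ex_Z2_laplace y a b : ex_RInt (fun t => Z2 t * exp (- (t / y))) a b.
Proof.
apply ex_RInt_everywhere; intros x.
apply (continuous_mult Z2 (fun t => exp (- (t / y)))); [apply continuous_Z2|].
auto_cont; auto.
Qed.

(** The condition [14 y ln (2 y) <= m] is [7 phi ln phi <= m] at [phi = 2 y]. It makes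
    [exp (- m / y)] at most [y^(-14)], so that the boundary term and the missing tail stay bounded,
    uniformly in [m]. *)
Lemma laplace_asymp : exists a c0, / 4 <= c0 /\
  (forall eps, 0 < eps -> exists T0, 1 <= T0 /\ forall T, T0 <= T -> Rabs (Z2_int T - (T * ln T + a * T)) <= eps * T) /\
  (forall eps, 0 < eps -> exists y0, 1 <= y0 /\ forall y m, y0 <= y -> 14 * y * ln (2 * y) <= m ->
     Rabs (Z2_laplace y m - y * (ln y + a + c0)) <= eps * y).
Proof.
destruct Z2_int_remainder as [a Ha]; destruct gamma_log_integral as (c0 & Hc0 & Hg).
exists a, c0; split; [easy|]; split.
{ intros eps He; destruct (Ha (eps / 2) ltac:(lra)) as (C & HC & H).
  assert (HCe : 0 <= 2 * C / eps) by (apply Rmult_le_pos; [lra|apply Rlt_le, Rinv_0_lt_compat; lra]).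
  exists (1 + 2 * C / eps); split; [lra|]; intros T HT.
  eapply Rle_trans; [apply H; lra|].
  assert (eps / 2 * (2 * C / eps) <= eps / 2 * T) by (apply Rmult_le_compat_l; lra).
  replace (eps / 2 * (2 * C / eps)) with C in H0 by (field; lra); lra. }
intros eps He; destruct (Ha (eps / 4) ltac:(lra)) as (C & HC & H).
pose proof (Rabs_pos a) as Hap.
set (C2 := 1 + Rabs a + C + eps).
set (Q := 16 * C2 + C + 2 * (1 + Rabs a)).
assert (HQ : 0 <= Q) by (unfold Q, C2; lra).
assert (HQe : 0 <= 2 * Q / eps) by (apply Rmult_le_pos; [lra|apply Rlt_le, Rinv_0_lt_compat; lra]).
assert (He1 : 0 < 1024 / eps) by (apply Rdiv_lt_0_compat; lra).
exists (1 + 2 * Q / eps + exp (1024 / eps + 1)); split; [pose proof (exp_pos (1024 / eps + 1)); lra|].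
intros y m Hy Hm; assert (Hexp := exp_pos (1024 / eps + 1)).
assert (Hy1 : 1 <= y) by lra.
assert (Hly : 1024 / eps + 1 <= ln y) by (rewrite <- (ln_exp (1024 / eps + 1)); apply ln_le; lra).
assert (Hl2 : ln y <= ln (2 * y)) by (apply ln_le; lra).
set (S := m / y).
assert (ES : m = y * S) by (unfold S; field; lra).
assert (HS : 14 * ln (2 * y) <= S) by (apply (Rmult_le_reg_l y); lra).
assert (HS1 : 14 * (1024 / eps + 1) <= S) by lra.
assert (Hm0 : 1 <= m) by nra.
(* [exp (- S)] is split into two equal factors, each at most [y^(-2)]; the powers of [S] are
   absorbed by the exponential decay of one of them. *)
set (q := exp (- (S / 2))).
assert (Hq0 : 0 < q) by apply exp_pos.
assert (Hqq : exp (- S) = q * q) by (unfold q; rewrite <- exp_plus; f_equal; field).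
assert (Hq : q <= / y ^ 2).
{ apply Rle_trans with (exp (- (2 * ln y))).
  - destruct (Req_dec (S / 2) (2 * ln y)) as [E|E]; [unfold q; rewrite E; lra|].
    apply Rlt_le, exp_increasing; lra.
  - rewrite exp_Ropp; replace (2 * ln y) with (ln y + ln y) by ring; rewrite exp_plus, exp_ln by lra.
    right; f_equal; ring. }
assert (Hiq : exp (S / 2) * q = 1) by (unfold q; rewrite exp_Ropp; apply Rinv_r; pose proof (exp_pos (S / 2)); lra).
assert (Hy2 : 0 < y ^ 2) by nra.
assert (Hqy : y ^ 2 * q <= 1).
{ apply Rle_trans with (y ^ 2 * / y ^ 2); [apply Rmult_le_compat_l; lra|rewrite Rinv_r; lra]. }
assert (E1 : 0 <= (1 + S) * exp (- S) <= 2 * q).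
{ rewrite Hqq; pose proof (exp_ineq1_le (S / 2)); split; [apply Rmult_le_pos; nra|].
  apply Rle_trans with (2 * exp (S / 2) * (q * q)); [apply Rmult_le_compat_r; nra|nra]. }
assert (E2 : S ^ 2 * q <= 16).
{ assert (S ^ 2 / 16 <= exp (S / 2)).
  { replace (S / 2) with (S / 4 + S / 4) by field; rewrite exp_plus; pose proof (exp_ineq1_le (S / 4)); nra. }
  apply Rle_trans with (16 * exp (S / 2) * q); [apply Rmult_le_compat_r; lra|lra]. }
rewrite Z2_laplace_parts by lra; fold S.
assert (B1 : 0 <= Z2_int m * exp (- S) <= 16 * C2).
{ assert (F0 : 0 <= Z2_int m) by (rewrite <- Z2_int_0; apply Z2_int_le; lra).
  assert (F1 : Z2_int m <= C2 * m ^ 2).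
  { assert (Hm' := H m ltac:(lra)); apply Rabs_le_between in Hm'.
    assert (Hlm := ln_le_sub m ltac:(lra)); assert (Hlm0 := ln_ge_0 m Hm0); pose proof (abs_bounds a).
    assert (m * ln m <= m ^ 2) by nra. assert (a * m <= Rabs a * m ^ 2) by (apply Rle_trans with (Rabs a * m); [apply Rmult_le_compat_r; lra|apply Rmult_le_compat_l; nra]).
    assert (1 <= m ^ 2) by nra. assert (m <= m ^ 2) by nra.
    assert (C * 1 <= C * m ^ 2) by (apply Rmult_le_compat_l; lra).
    assert (eps * m <= eps * m ^ 2) by (apply Rmult_le_compat_l; lra).
    assert (0 < eps * m) by nra. unfold C2; lra. }
  split; [apply Rmult_le_pos; [easy|apply Rlt_le, exp_pos]|].
  assert (HC2 : 0 <= C2) by (unfold C2; lra).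
  apply Rle_trans with (C2 * m ^ 2 * exp (- S)); [apply Rmult_le_compat_r; [apply Rlt_le, exp_pos|easy]|].
  rewrite Hqq, ES; replace (C2 * (y * S) ^ 2 * (q * q)) with (C2 * ((S ^ 2 * q) * (y ^ 2 * q))) by ring.
  rewrite (Rmult_comm 16); apply Rmult_le_compat_l; [easy|].
  assert (0 <= S ^ 2 * q) by (apply Rmult_le_pos; [apply pow2_ge_0|lra]).
  assert (0 <= y ^ 2 * q) by nra. nra. }
assert (Hce : forall x, continuous (fun t => exp (- (t / y))) x) by (intros; auto_cont; auto).
assert (Hm00 : 0 <= m) by lra.
assert (X1 : ex_RInt (fun t => Z2_int t * exp (- (t / y))) 0 m).
{ apply ex_RInt_cont; auto; intros; apply (continuous_mult Z2_int (fun t => exp (- (t / y)))); [apply continuous_Z2_int|auto]. }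
assert (X2 : ex_RInt (fun t => (t * ln t + a * t) * exp (- (t / y))) 0 m).
{ apply ex_RInt_cont; auto; intros x Hx.
  apply (continuous_mult (fun t => t * ln t + a * t) (fun t => exp (- (t / y)))); [|auto].
  apply (continuous_ext (fun x => - (x * (- a - ln x)))); [intros; rring|].
  apply (continuous_opp (fun x => x * (- a - ln x))); apply continuous_mul_ln; lra. }
assert (X3 : ex_RInt (fun t => exp (- (t / y))) 0 m) by (apply ex_RInt_cont; auto).
assert (X4 : ex_RInt (fun t => t * exp (- (t / y))) 0 m).
{ apply ex_RInt_cont; auto; intros; auto_cont; auto. }
assert (Hiy : 0 < / y) by (apply Rinv_0_lt_compat; lra).
destruct (exp_moments y m ltac:(lra) Hm00) as [M1 M2].
assert (B2 : Rabs (/ y * RInt (fun t => Z2_int t * exp (- (t / y))) 0 m -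
   / y * RInt (fun t => (t * ln t + a * t) * exp (- (t / y))) 0 m) <= C + eps / 4 * y).
{ rewrite <- Rmult_minus_distr_l, <- RInt_minusR, Rabs_mult, (Rabs_pos_eq (/ y)) by (lra || assumption).
  apply Rle_trans with (/ y * RInt (fun t => C * exp (- (t / y)) + eps / 4 * (t * exp (- (t / y)))) 0 m).
  - apply Rmult_le_compat_l; [lra|]; apply RInt_abs_le; [easy|now apply ex_RInt_minusR| |].
    + apply ex_RInt_plusR; [now apply (ex_RInt_scalR C)|now apply (ex_RInt_scalR (eps / 4))].
    + intros t Ht; rewrite <- Rmult_minus_distr_r, Rabs_mult, (Rabs_pos_eq (exp _)) by (apply Rlt_le, exp_pos).
      rewrite <- Rmult_assoc, <- Rmult_plus_distr_r; apply Rmult_le_compat_r; [apply Rlt_le, exp_pos|apply H; lra].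
  - rewrite RInt_lin2 by easy; revert M1 M2; rint_atoms; intros M1 M2; nra. }
rewrite main_laplace in B2 by lra; fold S in B2.
assert (B3 : Rabs (RInt gamma_log 0 S - c0) <= eps / 4).
{ eapply Rle_trans; [apply Hg; lra|].
  apply (Rmult_le_reg_r S); [lra|]; unfold Rdiv at 1; rewrite Rmult_assoc, Rinv_l, Rmult_1_r by lra.
  assert (eps / 4 * (14 * (1024 / eps + 1)) <= eps / 4 * S) by (apply Rmult_le_compat_l; lra).
  replace (eps / 4 * (14 * (1024 / eps + 1))) with (3584 + 7 / 2 * eps) in H0 by (field; lra); lra. }
assert (B4 : Rabs (y * ((ln y + a) * ((1 + S) * exp (- S)))) <= 2 * (1 + Rabs a)).
{ assert (Hl := ln_le_sub y ltac:(lra)).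
  replace (y * ((ln y + a) * ((1 + S) * exp (- S)))) with ((y * ((1 + S) * exp (- S))) * (ln y + a)) by ring.
  rewrite Rabs_mult, Rabs_pos_eq by (apply Rmult_le_pos; lra).
  apply Rle_trans with ((y * (2 * q)) * (y * (1 + Rabs a))).
  - apply Rmult_le_compat; [apply Rmult_le_pos; lra|apply Rabs_pos|apply Rmult_le_compat_l; lra|].
    eapply Rle_trans; [apply Rabs_triang|]; rewrite (Rabs_pos_eq (ln y)) by lra; nra.
  - replace (y * (2 * q) * (y * (1 + Rabs a))) with (2 * (1 + Rabs a) * (y ^ 2 * q)) by ring.
    rewrite <- (Rmult_1_r (2 * (1 + Rabs a))) at 2; apply Rmult_le_compat_l; lra. }
assert (HQy : Q <= eps / 2 * y).
{ assert (eps / 2 * (2 * Q / eps) <= eps / 2 * y) by (apply Rmult_le_compat_l; lra).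
  replace (eps / 2 * (2 * Q / eps)) with Q in H0 by (field; lra); easy. }
revert B2 B3; rint_atoms; intros B2 B3; unfold Q in HQy.
match type of B3 with Rabs (?g - _) <= _ => assert (B5 : Rabs (y * (g - c0)) <= y * (eps / 4))
  by (rewrite Rabs_mult, (Rabs_pos_eq y) by lra; apply Rmult_le_compat_l; lra) end.
apply Rabs_le_between in B2, B4, B5; apply Rabs_le; split; nra.
Qed.

(** * Asymptotic solution of the integral equation *)

(** At [y = T] the first expression exceeds the second by [c0 T], and its slope near [T] is
    [ln T + O(1)], so [y] lies about [c0 T / ln T] below [T]. The tolerance involves [y] too, since
    the expansion in [y] is used before [y] is known to be close to [T]. *)
Lemma ladder_inverse a c0 : 0 <= c0 -> forall eps, 0 < eps -> eps <= 1 -> exists T0, 2 <= T0 /\ forall T y, T0 <= T -> 0 < y ->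
  Rabs (y * (ln y + a + c0) - T * (ln T + a)) <= eps / 8 * (y + T) -> Rabs (y - (T - c0 * (T / ln T))) <= eps * (T / ln T).
Proof.
intros Hc0 eps He He1.
pose proof (Rabs_pos a) as Hap; pose proof (abs_bounds a) as Hab.
set (K := 3 + Rabs a + c0).
set (L := 8 * K + 8 * K * (c0 + 1) / eps).
assert (HL0 : 0 <= 8 * K * (c0 + 1) / eps).
{ apply Rmult_le_pos; [|apply Rlt_le, Rinv_0_lt_compat; lra]; apply Rmult_le_pos; unfold K; lra. }
exists (exp L + 2); split; [pose proof (exp_pos L); lra|].
intros T y HT Hy H.
pose proof (exp_pos L).
assert (HlT : L <= ln T) by (rewrite <- (ln_exp L); apply ln_le; lra).
assert (HK : 3 <= K) by (unfold K; lra).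
assert (HlK : 8 * K <= ln T) by (unfold L in HlT; lra).
assert (HlK2 : 8 * K * (c0 + 1) <= eps * ln T).
{ assert (eps * (8 * K * (c0 + 1) / eps) <= eps * ln T) by (apply Rmult_le_compat_l; unfold L in HlT; lra).
  replace (eps * (8 * K * (c0 + 1) / eps)) with (8 * K * (c0 + 1)) in H1 by (field; lra); easy. }
assert (Hln2 : 0 <= ln 2 <= 1) by (split; [pose proof ln_2_lower; lra|pose proof (ln_le_sub 2 ltac:(lra)); lra]).
apply Rabs_le_between in H.
(* Rough localisation, [T / 2 <= y <= 2 T], which is what makes the slope comparable with [ln T]. *)
assert (Hy2 : y <= 2 * T).
{ apply Rnot_lt_le; intros Hlt.
  assert (ln T <= ln y) by (apply ln_le; lra).
  assert (y * (ln T + a + c0 - / 8) <= y * (ln y + a + c0 - eps / 8)) by (apply Rmult_le_compat_l; lra).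
  assert (2 * T * (ln T + a + c0 - / 8) <= y * (ln T + a + c0 - / 8)) by (apply Rmult_le_compat_r; unfold K in *; lra).
  assert (0 < T * (ln T + a + 2 * c0 - / 4 - / 8)) by (apply Rmult_lt_0_compat; unfold K in *; lra).
  assert (eps / 8 * T <= / 8 * T) by (apply Rmult_le_compat_r; lra).
  nra. }
assert (Hy1 : T / 2 <= y).
{ apply Rnot_lt_le; intros Hlt.
  assert (ln y <= ln T) by (apply ln_le; lra).
  assert (y * (ln y + a + c0) <= y * (ln T + Rabs a + c0)) by (apply Rmult_le_compat_l; lra).
  assert (y * (ln T + Rabs a + c0) <= T / 2 * (ln T + Rabs a + c0)) by (apply Rmult_le_compat_r; unfold K in *; lra).
  assert (0 < T * (ln T / 2 - 2 * Rabs a - c0 - / 4)) by (apply Rmult_lt_0_compat; unfold K in *; lra).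
  assert (eps / 8 * (y + T) <= / 8 * (2 * T)) by (apply Rmult_le_compat; lra).
  assert (T * (ln T - Rabs a) <= T * (ln T + a)) by (apply Rmult_le_compat_l; lra).
  nra. }
(* The slope [ln x + a + c0 + 1] at a point between [y] and [T] differs from [ln T] by at most
   [K]. *)
assert (HMVT : exists k, Rabs k <= K /\ T * (ln T + a + c0) - y * (ln y + a + c0) = (ln T + k) * (T - y)).
{ destruct (MVT_gen (fun u => u * (ln u + a + c0)) y T (fun u => ln u + a + c0 + 1)) as (x & Hx & E).
  - intros x Hx; assert (0 < Rmin y T) by (apply Rmin_pos; lra).
    auto_derive; [lra|field; lra].
  - intros x Hx; assert (0 < Rmin y T) by (apply Rmin_pos; lra).
    apply continuity_pt_filterlim.
    apply (continuous_of_ex_derive (fun u => u * (ln u + a + c0))); auto_derive; lra.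
  - exists (ln x + a + c0 + 1 - ln T); split; [|rewrite E; ring].
    assert (Hx1 : T / 2 <= x <= 2 * T).
    { destruct Hx; split; [apply Rle_trans with (Rmin y T); [apply Rmin_glb; lra|easy]|apply Rle_trans with (Rmax y T); [easy|apply Rmax_lub; lra]]. }
    assert (ln x <= ln (2 * T)) by (apply ln_le; lra).
    assert (ln (T / 2) <= ln x) by (apply ln_le; lra).
    rewrite ln_mult in * by lra; rewrite ln_div in * by lra.
    apply Rabs_le; unfold K; lra. }
destruct HMVT as (k & Hk & E).
set (d := T - y) in *.
apply Rabs_le_between in Hk.
assert (HyT : eps / 8 * (y + T) <= 3 / 8 * eps * T) by nra.
assert (Ed : Rabs ((ln T + k) * d - c0 * T) <= 3 / 8 * eps * T) by (rewrite <- E; apply Rabs_le; split; nra).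
assert (HlT0 : 0 < ln T) by lra.
assert (Hd1 : Rabs d <= 2 * (c0 + 1) * (T / ln T)).
{ apply (Rmult_le_reg_l (ln T / 2)); [lra|].
  replace (ln T / 2 * (2 * (c0 + 1) * (T / ln T))) with ((c0 + 1) * T) by (field; lra).
  apply Rle_trans with (Rabs ((ln T + k) * d)).
  - rewrite Rabs_mult, (Rabs_pos_eq (ln T + k)) by lra; apply Rmult_le_compat_r; [apply Rabs_pos|lra].
  - apply Rabs_le_between in Ed; apply Rabs_le; split; nra. }
assert (Hd2 : Rabs (k * d) <= K * (2 * (c0 + 1) * (T / ln T))).
{ rewrite Rabs_mult; apply Rmult_le_compat; try apply Rabs_pos; [apply Rabs_le; lra|easy]. }
assert (Hd3 : K * (2 * (c0 + 1) * (T / ln T)) <= eps / 4 * T).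
{ apply (Rmult_le_reg_r (ln T)); [lra|].
  replace (K * (2 * (c0 + 1) * (T / ln T)) * ln T) with (8 * K * (c0 + 1) * (T / 4)) by (field; lra).
  replace (eps / 4 * T * ln T) with (eps * ln T * (T / 4)) by field.
  apply Rmult_le_compat_r; lra. }
assert (Hf : Rabs (ln T * d - c0 * T) <= eps * T).
{ apply Rabs_le_between in Ed, Hd2; apply Rabs_le; split; nra. }
replace (y - (T - c0 * (T / ln T))) with (- ((ln T * d - c0 * T) * / ln T)) by (unfold d; field; lra).
rewrite Rabs_Ropp, Rabs_mult, (Rabs_pos_eq (/ ln T)) by (apply Rlt_le, Rinv_0_lt_compat; lra).
unfold Rdiv; rewrite <- Rmult_assoc; apply Rmult_le_compat_r; [apply Rlt_le, Rinv_0_lt_compat; lra|easy].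
Qed.

(** Once an integrability proof exists, the value chosen by epsilon has its defining property and is
    the Riemann integral. *)
Lemma Rint_RInt f a b : ex_RInt f a b -> Rint f a b = RInt f a b.
Proof.
intros Hex; unfold Rint.
assert (H : exists pr : Riemann_integrable f a b, RiemannInt pr = RInt f a b).
{ exists (ex_RInt_Reals_0 f a b Hex); symmetry; apply RInt_Reals. }
destruct (epsilon_spec (inhabits 0) (fun v => exists pr : Riemann_integrable f a b, RiemannInt pr = v) (ex_intro _ _ H)) as [pr E].
rewrite <- E; symmetry; apply RInt_Reals.
Qed.

Lemma ladder_eq_laplace (phi mu : R -> R) T : 0 < phi T ->
  Rint (fun t => Z2 t * exp (- (2 * t) / phi T)) 0 (mu (phi T)) = Z2_laplace (phi T / 2) (mu (phi T)).
Proof.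
intros Hp.
assert (E : forall t, Z2 t * exp (- (t / (phi T / 2))) = Z2 t * exp (- (2 * t) / phi T)) by (intros; do 2 f_equal; field; lra).
unfold Z2_laplace; rewrite Rint_RInt.
- apply RInt_ext; intros; symmetry; apply E.
- apply (ex_RInt_ext (fun t => Z2 t * exp (- (t / (phi T / 2))))); [intros; apply E|apply ex_Z2_laplace].
Qed.

(** Enlarging [y] or the upper limit increases the integral of a non-negative function. A negative
    [m1] has to be covered, as [mu] may be negative at small arguments; the integral is then at most
    0. *)
Lemma Z2_laplace_mono y1 y2 m1 m2 : 0 < y1 -> y1 <= y2 -> m1 <= m2 -> 0 <= m2 -> Z2_laplace y1 m1 <= Z2_laplace y2 m2.
Proof.
intros Hy1 Hy Hm Hm2; unfold Z2_laplace.
assert (Hpos : forall y t, 0 <= Z2 t * exp (- (t / y))) by (intros; apply Rmult_le_pos; [apply Z2_ge0|apply Rlt_le, exp_pos]).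
assert (H2 : 0 <= RInt (fun t => Z2 t * exp (- (t / y2))) 0 m2) by (apply RInt_ge_0; auto; apply ex_Z2_laplace).
destruct (Rle_dec 0 m1) as [H1|H1].
- apply Rle_trans with (RInt (fun t => Z2 t * exp (- (t / y2))) 0 m1).
  + apply RInt_le; auto; try apply ex_Z2_laplace.
    intros t Ht; apply Rmult_le_compat_l; [apply Z2_ge0|].
    assert (t / y2 <= t / y1) by (apply Rmult_le_compat_l; [lra|apply Rinv_le_contravar; lra]).
    destruct (Req_dec (- (t / y1)) (- (t / y2))) as [E|E]; [rewrite E; lra|apply Rlt_le, exp_increasing; lra].
  + apply RInt_le_ge0; auto; try lra; apply ex_Z2_laplace.
- assert (H3 : 0 <= RInt (fun t => Z2 t * exp (- (t / y1))) m1 0) by (apply RInt_ge_0; auto; [lra|apply ex_Z2_laplace]).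
  rewrite <- (opp_RInt_swap _ m1 0) by apply ex_Z2_laplace; change (opp ?z) with (- z).
  revert H2 H3; rint_atoms; intros; lra.
Qed.

(** If [phi T <= Y], the left side of the equation is at most an exponential mean with a parameter
    [y] independent of [T]. Its expansion is uniform in the upper limit, hence bounds it by [B]
    however large [mu (phi T)] is, whereas the right side is at least [T]. *)
Lemma phi_diverges mu phi : solves_ladder_eq mu phi ->
  forall Y, exists T0, forall T, T0 <= T -> Y < phi T.
Proof.
destruct laplace_asymp as (a & c0 & Hc0 & HF & HL); intros [T0 HT0] Y.
destruct (HF 1 ltac:(lra)) as (T1 & HT1 & HF1); destruct (HL 1 ltac:(lra)) as (y0 & Hy0 & HL1).
set (y := Rmax y0 (Y / 2)).
assert (Hy1 : y0 <= y) by apply Rmax_l; assert (Hy2 : Y / 2 <= y) by apply Rmax_r.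
set (B := y * (ln y + a + c0) + y).
set (T2 := exp (1 + Rabs a + 1) + Rabs B).
exists (T0 + T1 + T2 + Rabs T0 + 1); intros T HT.
pose proof (abs_bounds T0); pose proof (abs_bounds B); pose proof (abs_bounds a); pose proof (exp_pos (1 + Rabs a + 1)).
assert (HT2 : T2 <= T) by lra.
destruct (HT0 T) as [Hphi E]; [unfold T2 in *; lra|].
apply Rnot_le_lt; intros Hle.
rewrite ladder_eq_laplace, Rint_RInt in E by (easy || apply ex_Z2).
specialize (HF1 T ltac:(unfold T2 in *; lra)).
assert (HlT : 1 + Rabs a + 1 <= ln T) by (rewrite <- (ln_exp (1 + Rabs a + 1)); apply ln_le; unfold T2 in *; lra).
(* The upper limit is raised, if necessary, into the range where the expansion is available. *)
set (m := Rmax (mu (phi T)) (14 * y * ln (2 * y))).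
assert (Hm1 : mu (phi T) <= m) by apply Rmax_l; assert (Hm2 : 14 * y * ln (2 * y) <= m) by apply Rmax_r.
assert (Hm0 : 0 <= m).
{ eapply Rle_trans; [|apply Hm2]; apply Rmult_le_pos; [lra|apply ln_ge_0; lra]. }
assert (HM := Z2_laplace_mono (phi T / 2) y (mu (phi T)) m ltac:(lra) ltac:(lra) Hm1 Hm0).
rewrite E in HM; specialize (HL1 y m Hy1 Hm2).
apply Rabs_le_between in HF1, HL1; change (RInt Z2 0 T) with (Z2_int T) in HM.
assert (T <= T * (ln T + a - 1)) by (rewrite <- (Rmult_1_r T) at 1; apply Rmult_le_compat_l; unfold T2 in *; lra).
assert (HB1 : Z2_int T <= B) by (unfold B; lra).
assert (HB2 : T <= Z2_int T) by lra.
unfold T2 in *; lra.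
Qed.

(** For large [T] the value [phi T] has entered the range where the growth of [mu] and the expansion
    hold. Both sides of the equation are then expanded with tolerance [eps / 8] and the same
    constant [a]. *)
Lemma ladder_asymp mu phi : (exists y0, forall y, y0 <= y -> 7 * y * ln y <= mu y) -> solves_ladder_eq mu phi ->
  exists c0, / 4 <= c0 /\ forall eps, 0 < eps -> exists T0, 2 <= T0 /\ forall T, T0 <= T ->
  Rabs (phi T / 2 - (T - c0 * (T / ln T))) <= eps * (T / ln T).
Proof.
intros [Y0 Hmu] Hphi; assert (Hdiv := phi_diverges mu phi Hphi).
destruct laplace_asymp as (a & c0 & Hc0 & HF & HL); destruct Hphi as [T1 HT1].
exists c0; split; [easy|].
assert (Hmain : forall eps, 0 < eps -> eps <= 1 -> exists T0, 2 <= T0 /\ forall T, T0 <= T ->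
  Rabs (phi T / 2 - (T - c0 * (T / ln T))) <= eps * (T / ln T)).
{ intros eps He He1.
  destruct (ladder_inverse a c0 ltac:(lra) eps He He1) as (T2 & HT2 & HI).
  destruct (HF (eps / 8) ltac:(lra)) as (T3 & HT3 & HF3).
  destruct (HL (eps / 8) ltac:(lra)) as (y0 & Hy0 & HL4).
  destruct (Hdiv (2 * y0 + Rabs Y0)) as [T4 HT4].
  pose proof (abs_bounds T1); pose proof (abs_bounds T4); pose proof (abs_bounds Y0).
  exists (T2 + T3 + Rabs T1 + Rabs T4); split; [lra|]; intros T HT.
  specialize (HT4 T ltac:(lra)); destruct (HT1 T ltac:(lra)) as [Hp E].
  apply HI; [lra|lra|].
  rewrite ladder_eq_laplace, Rint_RInt in E by (easy || apply ex_Z2).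
  specialize (HF3 T ltac:(lra)).
  specialize (HL4 (phi T / 2) (mu (phi T)) ltac:(lra)); rewrite E in HL4.
  change (RInt Z2 0 T) with (Z2_int T) in HL4.
  specialize (Hmu (phi T) ltac:(lra)).
  replace (14 * (phi T / 2) * ln (2 * (phi T / 2))) with (7 * phi T * ln (phi T)) in HL4
   by (replace (2 * (phi T / 2)) with (phi T) by field; field).
  specialize (HL4 Hmu).
  apply Rabs_le_between in HF3, HL4; apply Rabs_le; split; nra. }
intros eps He; destruct (Rle_dec eps 1) as [H1|H1]; [now apply Hmain|].
destruct (Hmain 1 ltac:(lra) ltac:(lra)) as (T0 & HT0 & H); exists T0; split; [easy|].
intros T HT; eapply Rle_trans; [now apply H|].
apply Rmult_le_compat_r; [|lra].
apply Rmult_le_pos; [lra|apply Rlt_le, Rinv_0_lt_compat].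
pose proof ln_2_lower; pose proof (ln_le 2 T ltac:(lra) ltac:(lra)); lra.
Qed.

(** * Iterates of the ladder *)

(** A displacement [V <= T / ln^2 T] is eventually below any multiple of [T / ln T], which is the
    case [k = 0]. In the inductive step [x / ln x] has slope at most [2 / ln T] near [T], so that
    replacing [w / ln w] by [T / ln T] costs only [O(T / ln^2 T)]. *)
Lemma iterates_asymp (phi1 : R -> R) c0 : 0 <= c0 ->
  (forall eps, 0 < eps -> exists T0, 2 <= T0 /\ forall T, T0 <= T -> Rabs (phi1 T - (T - c0 * (T / ln T))) <= eps * (T / ln T)) ->
  forall k eps, 0 < eps -> exists T0, 3 <= T0 /\ forall T V, T0 <= T -> 0 <= V <= T / (ln T) ^ 2 ->
  Rabs (iterR k phi1 (T + V) - (T - INR k * c0 * (T / ln T))) <= eps * (T / ln T).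
Proof.
intros Hc0 H k; induction k as [|k IH]; intros eps He.
- exists (exp (1 + / eps) + 3); split; [pose proof (exp_pos (1 + / eps)); lra|]; intros T V HT HV.
  assert (Hie : 0 < / eps) by (apply Rinv_0_lt_compat; lra).
  pose proof (exp_pos (1 + / eps)).
  assert (HlT : 1 + / eps <= ln T) by (rewrite <- (ln_exp (1 + / eps)); apply ln_le; lra).
  unfold iterR, Nat.iter; simpl INR; simpl.
  replace (T + V - (T - 0 * c0 * (T / ln T))) with V by ring.
  rewrite Rabs_pos_eq by lra; eapply Rle_trans; [apply HV|].
  replace (T / ln T ^ 2) with (/ ln T * (T / ln T)) by (field; lra).
  apply Rmult_le_compat_r; [apply Rmult_le_pos; [lra|apply Rlt_le, Rinv_0_lt_compat; lra]|].
  rewrite <- (Rinv_inv eps); apply Rinv_le_contravar; lra.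
- assert (Hk := pos_INR k).
  (* Of the tolerance [eps], one sixth is spent on the inductive hypothesis, one third on the new
     application of [phi1], whose scale [w / ln w] is at most twice [T / ln T], and one third on the
     change of scale. *)
  set (e' := Rmin 1 (eps / 6)).
  assert (He' : 0 < e') by (apply Rmin_pos; lra).
  assert (He1 : e' <= 1) by apply Rmin_l; assert (He6 : e' <= eps / 6) by apply Rmin_r.
  destruct (IH e' He') as (T1 & HT1 & H1); destruct (H e' He') as (T2 & HT2 & H2).
  set (Q := INR k * c0 + 1).
  assert (HQ : 1 <= Q) by (unfold Q; nra).
  assert (Hce : 0 <= 6 * c0 * Q / eps).
  { apply Rmult_le_pos; [nra|apply Rlt_le, Rinv_0_lt_compat; lra]. }
  set (L := 4 * Q + 4 + 6 * c0 * Q / eps).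
  exists (T1 + 2 * T2 + exp L); split; [pose proof (exp_pos L); lra|]; intros T V HT HV.
  pose proof (exp_pos L).
  specialize (H1 T V ltac:(lra) HV).
  change (iterR (S k) phi1 (T + V)) with (phi1 (iterR k phi1 (T + V))).
  set (w := iterR k phi1 (T + V)) in *.
  assert (HlT : L <= ln T) by (rewrite <- (ln_exp L); apply ln_le; lra).
  assert (HlT1 : 4 * Q + 4 <= ln T) by (unfold L in HlT; lra).
  assert (HlT2 : 6 * c0 * Q <= eps * ln T).
  { assert (E : eps * (6 * c0 * Q / eps) <= eps * ln T) by (apply Rmult_le_compat_l; unfold L in HlT; lra).
    replace (eps * (6 * c0 * Q / eps)) with (6 * c0 * Q) in E by (field; lra); easy. }
  set (R0 := T / ln T) in *.
  assert (ER : R0 * ln T = T) by (unfold R0; field; lra).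
  assert (HR0 : 0 < R0) by (unfold R0; apply Rdiv_lt_0_compat; lra).
  assert (HwT : Rabs (w - T) <= Q * R0).
  { apply Rabs_le_between in H1; apply Rabs_le; unfold Q.
    assert (e' * R0 <= 1 * R0) by (apply Rmult_le_compat_r; lra).
    assert (0 <= INR k * c0 * R0) by (apply Rmult_le_pos; [nra|lra]). lra. }
  assert (HQR : Q * R0 <= T / 4) by (rewrite <- ER; nra).
  assert (Hw1 : 3 / 4 * T <= w <= 5 / 4 * T) by (apply Rabs_le_between in HwT; lra).
  specialize (H2 w ltac:(lra)).
  assert (Hln2 : ln 2 <= 1) by (pose proof (ln_le_sub 2 ltac:(lra)); lra).
  assert (HLu : forall u, 3 / 4 * T <= u -> ln T - 1 <= ln u).
  { intros u Hu; apply Rle_trans with (ln (T / 2)); [rewrite ln_div by lra; lra|apply ln_le; lra]. }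
  assert (HLip : forall u v, 3 / 4 * T <= u -> u <= v -> Rabs (v / ln v - u / ln u) <= 2 / ln T * (v - u)).
  { intros u v Hu Huv; apply (mvt_bound (fun x => x / ln x) (fun x => / ln x * (1 - / ln x))); [easy| |].
    - intros x Hx; specialize (HLu x ltac:(lra)); auto_derive; [repeat split; lra|field; lra].
    - intros x Hx; specialize (HLu x ltac:(lra)).
      assert (0 < / ln x) by (apply Rinv_0_lt_compat; lra).
      assert (/ ln x <= 2 / ln T).
      { replace (2 / ln T) with (/ (ln T / 2)) by (field; lra); apply Rinv_le_contravar; lra. }
      assert (/ ln x <= 1) by (rewrite <- Rinv_1; apply Rinv_le_contravar; lra).
      rewrite Rabs_pos_eq; nra. }
  assert (HR : Rabs (w / ln w - R0) <= 2 / ln T * (Q * R0)).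
  { assert (0 < 2 / ln T) by (apply Rdiv_lt_0_compat; lra).
    apply Rle_trans with (2 / ln T * Rabs (w - T)); [|apply Rmult_le_compat_l; lra].
    unfold R0; destruct (Rle_dec w T).
    - rewrite Rabs_minus_sym, (Rabs_minus_sym w), (Rabs_pos_eq (T - w)) by lra; apply HLip; lra.
    - rewrite (Rabs_pos_eq (w - T)) by lra; apply HLip; lra. }
  assert (HR2 : c0 * (2 / ln T * (Q * R0)) <= eps / 3 * R0).
  { apply (Rmult_le_reg_r (ln T)); [lra|].
    replace (c0 * (2 / ln T * (Q * R0)) * ln T) with (6 * c0 * Q * (R0 / 3)) by (field; lra).
    replace (eps / 3 * R0 * ln T) with (eps * ln T * (R0 / 3)) by field.
    apply Rmult_le_compat_r; lra. }
  assert (HR3 : Rabs (c0 * (w / ln w - R0)) <= eps / 3 * R0).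
  { rewrite Rabs_mult, (Rabs_pos_eq c0) by lra; eapply Rle_trans; [|apply HR2]; apply Rmult_le_compat_l; lra. }
  assert (HR4 : w / ln w <= 2 * R0).
  { apply Rabs_le_between in HR; assert (2 / ln T * (Q * R0) <= R0); [|lra].
    apply (Rmult_le_reg_r (ln T)); [lra|].
    replace (2 / ln T * (Q * R0) * ln T) with (2 * Q * R0) by (field; lra); nra. }
  rewrite S_INR.
  assert (e' * (w / ln w) <= eps / 6 * (2 * R0)).
  { apply Rmult_le_compat; try lra; apply Rmult_le_pos; [lra|apply Rlt_le, Rinv_0_lt_compat].
    specialize (HLu w ltac:(lra)); lra. }
  assert (e' * R0 <= eps / 6 * R0) by (apply Rmult_le_compat_r; lra).
  apply Rabs_le_between in H1, H2, HR3; apply Rabs_le; split; nra.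
Qed.

Lemma exists_uniform_bound (P : nat -> R -> Prop) N :
  (forall k, (k <= N)%nat -> exists T0, forall T, T0 <= T -> P k T) ->
  exists T0, forall k T, (k <= N)%nat -> T0 <= T -> P k T.
Proof.
induction N as [|N IH]; intros H.
- destruct (H 0%nat (le_n _)) as [T0 HT0]; exists T0; intros k T Hk HT.
  replace k with 0%nat by lia; auto.
- destruct IH as [T0 HT0]; [intros; apply H; lia|].
  destruct (H (S N) (le_n _)) as [T1 HT1]; exists (Rmax T0 T1); intros k T Hk HT.
  pose proof (Rmax_l T0 T1); pose proof (Rmax_r T0 T1).
  destruct (Nat.eq_dec k (S N)) as [->|]; [apply HT1; lra|apply HT0; [lia|lra]].
Qed.

Theorem mainTheorem2 (n : nat) (mu phi : R -> R)
  (Hmu : exists y0, forall y, y0 <= y -> 7 * y * ln y <= mu y)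
  (Hphi : solves_ladder_eq mu phi)
  (Hincr : exists T0, forall t1 t2, T0 <= t1 -> t1 < t2 ->
             phi t1 / 2 < phi t2 / 2) :
  let phi1 := fun t => phi t / 2 in
  (* (i), first part: t ~ phi1^k(t) as t -> oo *)
  (forall k, (k <= S n)%nat ->
     forall eps, 0 < eps -> exists t0, forall t, t0 <= t ->
       Rabs (iterR k phi1 t / t - 1) < eps) /\
  (forall eps, 0 < eps -> forall U : R -> R, exists T0, forall T, T0 <= T ->
     0 < U T <= T / (ln T) ^ 2 ->
     (* (i), second part *)
     (forall k, (k <= S n)%nat -> (1 - eps) * T <= iterR k phi1 T) /\
     (* (ii) *)
     (forall k, (1 <= k <= S n)%nat ->
        iterR k phi1 (T + U T) - iterR k phi1 T
          < / (2 * INR n + 5) * (T / ln T)) /\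
     (* (iii) *)
     (forall k, (k <= n)%nat ->
        iterR k phi1 T - iterR (S k) phi1 (T + U T) > 18 / 100 * (T / ln T))).
Proof.
intros phi1.
destruct (ladder_asymp mu phi Hmu Hphi) as (c0 & Hc0 & Hasy).
assert (Hit := iterates_asymp phi1 c0 ltac:(lra) Hasy).
assert (Hsim : forall k eps, 0 < eps -> exists t0, 0 < t0 /\ forall t, t0 <= t -> Rabs (iterR k phi1 t - t) < eps * t).
{ intros k eps He; destruct (Hit k 1 ltac:(lra)) as (T0 & HT0 & H).
  assert (Hk := pos_INR k); set (Q := INR k * c0 + 1).
  assert (HQ : 0 < Q) by (unfold Q; nra).
  assert (HQe : 0 < Q / eps) by (apply Rdiv_lt_0_compat; lra).
  exists (T0 + exp (Q / eps + 1)); split; [pose proof (exp_pos (Q / eps + 1)); lra|]; intros t Ht.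
  pose proof (exp_pos (Q / eps + 1)).
  assert (Hl : Q / eps + 1 <= ln t) by (rewrite <- (ln_exp (Q / eps + 1)); apply ln_le; lra).
  specialize (H t 0 ltac:(lra)); rewrite Rplus_0_r in H.
  assert (HR : 0 < t / ln t) by (apply Rdiv_lt_0_compat; lra).
  specialize (H ltac:(split; [lra|apply Rmult_le_pos; [lra|apply Rlt_le, Rinv_0_lt_compat, pow_lt; lra]])).
  assert (HQR : Q * (t / ln t) < eps * t).
  { apply (Rmult_lt_reg_r (ln t)); [lra|].
    replace (Q * (t / ln t) * ln t) with (Q * t) by (field; lra).
    replace (eps * t * ln t) with (eps * ln t * t) by ring; apply Rmult_lt_compat_r; [lra|].
    apply Rlt_le_trans with (eps * (Q / eps + 1)); [|apply Rmult_le_compat_l; lra].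
    replace (eps * (Q / eps + 1)) with (Q + eps) by (field; lra); lra. }
  apply Rabs_le_between in H; unfold Q in HQR.
  assert (0 <= INR k * c0 * (t / ln t)) by (apply Rmult_le_pos; [nra|lra]).
  apply Rabs_def1; lra. }
split.
- intros k Hk eps He; destruct (Hsim k eps He) as (t0 & Ht0 & H); exists t0; intros t Ht; specialize (H t Ht).
  replace (iterR k phi1 t / t - 1) with ((iterR k phi1 t - t) * / t) by (field; lra).
  rewrite Rabs_mult, (Rabs_pos_eq (/ t)) by (apply Rlt_le, Rinv_0_lt_compat; lra).
  apply (Rmult_lt_reg_r t); [lra|]; rewrite Rmult_assoc, Rinv_l, Rmult_1_r by lra; easy.
- intros eps He U.
  set (N5 := 2 * INR n + 5); assert (HN5 : 5 <= N5) by (unfold N5; pose proof (pos_INR n); lra).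
  (* One tolerance for both bounds: two errors [e] stay below [/ N5 = 8 e], and [1/4 - 2 e >= 1/5]
     exceeds [0.18]. *)
  set (e := / (8 * N5)).
  assert (He0 : 0 < e) by (apply Rinv_0_lt_compat; lra).
  assert (He1 : e <= / 40) by (apply Rinv_le_contravar; lra).
  assert (He2 : / N5 = 8 * e) by (unfold e; field; lra).
  destruct (exists_uniform_bound (fun k T => Rabs (iterR k phi1 T - T) < eps * T) (S n)) as [T1 HT1].
  { intros k _; destruct (Hsim k eps He) as (t0 & _ & H); now exists t0. }
  (* With [V] quantified after the threshold, [V = 0] and [V = U T] can both be taken at the same
     [T]. *)
  destruct (exists_uniform_bound (fun k T => 3 <= T /\ forall V, 0 <= V <= T / (ln T) ^ 2 ->
     Rabs (iterR k phi1 (T + V) - (T - INR k * c0 * (T / ln T))) <= e * (T / ln T)) (S n)) as [T2 HT2].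
  { intros k _; destruct (Hit k e He0) as (t0 & Ht0 & H); exists t0; intros T HT; split; [lra|auto]. }
  exists (Rmax T1 T2); intros T HT HU.
  assert (HTa := Rle_trans _ _ _ (Rmax_l T1 T2) HT); assert (HTb := Rle_trans _ _ _ (Rmax_r T1 T2) HT).
  assert (HT3 : 3 <= T) by (apply (HT2 0%nat T ltac:(lia) HTb)).
  assert (HR : 0 < T / ln T).
  { apply Rdiv_lt_0_compat; [lra|]; pose proof ln_2_lower; pose proof (ln_le 2 T ltac:(lra) ltac:(lra)); lra. }
  assert (H0 : forall k, (k <= S n)%nat -> Rabs (iterR k phi1 T - (T - INR k * c0 * (T / ln T))) <= e * (T / ln T)).
  { intros k Hk; destruct (HT2 k T Hk HTb) as [_ H]; specialize (H 0); rewrite Rplus_0_r in H; apply H; lra. }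
  assert (HUk : forall k, (k <= S n)%nat -> Rabs (iterR k phi1 (T + U T) - (T - INR k * c0 * (T / ln T))) <= e * (T / ln T)).
  { intros k Hk; destruct (HT2 k T Hk HTb) as [_ H]; apply H; lra. }
  set (R0 := T / ln T) in *.
  split; [|split].
  + intros k Hk; specialize (HT1 k T Hk HTa); apply Rabs_def2 in HT1; lra.
  + intros k [_ Hk]; specialize (H0 k Hk); specialize (HUk k Hk).
    fold N5; rewrite He2; apply Rabs_le_between in H0, HUk; nra.
  + intros k Hk; specialize (H0 k ltac:(lia)); specialize (HUk (S k) ltac:(lia)); rewrite S_INR in HUk.
    apply Rabs_le_between in H0, HUk.
    assert (/ 4 * R0 <= c0 * R0) by (apply Rmult_le_compat_r; lra).
    assert (e * R0 <= / 40 * R0) by (apply Rmult_le_compat_r; lra).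
    nra.
Qed.
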